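(* There exist a function $f$ in the Besov class $B_{\infty,1}^1(\mathbb R^2)$ and Borel spectral measures $E_1,E_2,E_3$ on $\mathbb R$ such that the divided difference $\mathfrak D^{[1]}f$ does not belong to the Haagerup tensor product $L^\infty(E_1)\otimes_{\rm h}L^\infty(E_2)\otimes_{\rm h}L^\infty(E_3)$.
   Context: $\mathfrak D^{[1]}f(x_1,x_2,y)=\frac{f(x_1,y)-f(x_2,y)}{x_1-x_2}$, with value $\frac{\partial f}{\partial x}(x_1,y)$ when $x_1=x_2$. Besov class: fix an infinitely differentiable $w\ge0$ on $\mathbb R$ with $\operatorname{supp}w\subset[1/2,2]$ and $w(s)=1-w(s/2)$ for $s\in[1,2]$. Define $W_n$, $n\in\mathbb Z$, on $\mathbb R^2$ by $(\mathscr FW_n)(x)=w(\|x\|_2/2^n)$ ($\mathscr F$ the Fourier transform), and $f_n=f*W_n$. $B_{\infty,1}^1(\mathbb R^2)$ is the space of tempered distributions $f$ with $\|f\|_{B_{\infty,1}^1}:=\sum_{n\in\mathbb Z}2^n\|f_n\|_{L^\infty}<\infty$ and $\partial f/\partial x_i=\sum_n\partial f_n/\partial x_i$ in $\mathscr S'(\mathbb R^2)$ for $i=1,2$. Such $f$ are continuously differentiable functions. $\mathcal B$ is the space of matrices inducing bounded operators on $\ell^2$, with operator norm; $L^\infty_E(\ell^2)$ and $L^\infty_E(\mathcal B)$ are the spaces of $E$-essentially bounded measurable $\ell^2$-valued, resp. $\mathcal B$-valued (entrywise measurable), functions. $L^\infty(E_1)\otimes_{\rm h}L^\infty(E_2)\otimes_{\rm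 h}L^\infty(E_3)$ is the space of functions $\Psi(x_1,x_2,x_3)=\sum_{j,k\ge0}\alpha_j(x_1)\beta_{jk}(x_2)\gamma_k(x_3)$ with $\{\alpha_j\}\in L^\infty_{E_1}(\ell^2)$, $\{\beta_{jk}\}\in L^\infty_{E_2}(\mathcal B)$, $\{\gamma_k\}\in L^\infty_{E_3}(\ell^2)$, where $\sum_{j,k\ge0}$ means $\lim_{M,N\to\infty}\sum_{j=0}^N\sum_{k=0}^M$. *)

(* Defs.v *)
From HB Require Import structures.
From mathcomp Require Import all_boot all_order all_algebra.
From mathcomp Require Import complex sesquilinear lra.
From mathcomp Require Import all_classical all_reals all_analysis.
Set Implicit Arguments.
Unset Strict Implicit.
Unset Printing Implicit Defensive.
Import Order.TTheory GRing.Theory Num.Theory.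
Import numFieldNormedType.Exports.
Local Open Scope classical_set_scope.
Local Open Scope ring_scope.
Local Open Scope complex_scope.

(* `|z| : R[i] is the modulus viewed as a complex number; this is the same
   modulus as a real number. *)
Definition cabs (R : realType) (z : R[i]) : R := complex.Re `|z|.

Definition cmeasurable (R : realType) d (T : measurableType d)
    (f : T -> R[i]) : Prop :=
  measurable_fun setT (fun x => complex.Re (f x)) /\
  measurable_fun setT (fun x => complex.Im (f x)).

Definition leb2 (R : realType) :
    {measure set (measurableTypeR R * measurableTypeR R) -> \bar R} :=
  (@lebesgue_measure R \x @lebesgue_measure R)%E.
Arguments leb2 R : clear implicits.

Definition cintegrable (R : realType) (f : R * R -> R[i]) : Prop :=
  (leb2 R).-integrable setT (fun x => (complex.Re (f x))%:E) /\
  (leb2 R).-integrable setT (fun x => (complex.Im (f x))%:E).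

Definition cint (R : realType) (f : R * R -> R[i]) : R[i] :=
  (\int[leb2 R]_x complex.Re (f x)) +i* (\int[leb2 R]_x complex.Im (f x)).

Definition axis (R : realType) (b : bool) : R * R :=
  if b then (0, 1) else (1, 0).

(* Iterated partial derivatives are indexed by words in the two coordinate
   directions (false: first variable, true: second variable). *)
Definition rpartial (R : realType) (s : seq bool) (g : R * R -> R) :
    R * R -> R :=
  foldr (fun b h x => 'D_(axis R b) h x) g s.

Definition smooth2 (R : realType) (g : R * R -> R) : Prop :=
  forall s : seq bool, continuous (rpartial s g) /\
    forall (b : bool) (x : R * R), derivable (rpartial s g) x (axis R b).

Definition cpartial (R : realType) (s : seq bool) (f : R * R -> R[i])
    (x : R * R) : R[i] :=
  rpartial s (fun y => complex.Re (f y)) x +i*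
  rpartial s (fun y => complex.Im (f y)) x.

Definition contdiff (R : realType) (f : R * R -> R[i]) : Prop :=
  forall b : bool,
    (forall x, derivable (fun y => complex.Re (f y)) x (axis R b) /\
               derivable (fun y => complex.Im (f y)) x (axis R b)) /\
    continuous (rpartial [:: b] (fun y => complex.Re (f y))) /\
    continuous (rpartial [:: b] (fun y => complex.Im (f y))).

(* |x_1|^m |x_2|^n |d^s f (x)| <= C for all x *)
Definition seminorm_le (R : realType) (s : seq bool) (m n : nat)
    (f : R * R -> R[i]) (C : R) : Prop :=
  forall x : R * R, `|x.1| ^+ m * `|x.2| ^+ n * cabs (cpartial s f x) <= C.

Definition schwartz (R : realType) (f : R * R -> R[i]) : Prop :=
  [/\ smooth2 (fun x => complex.Re (f x)),
      smooth2 (fun x => complex.Im (f x)) &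
      forall s m n, exists C, seminorm_le s m n f C].

(* A functional is a total map on functions R * R -> R[i]; only its values on
   Schwartz functions are meaningful.  The second clause is continuity at 0
   for the topology of the Schwartz space. *)
Definition tempered (R : realType) (T : (R * R -> R[i]) -> R[i]) : Prop :=
  (forall (a : R[i]) (phi psi : R * R -> R[i]), schwartz phi -> schwartz psi ->
     T (fun x => a * phi x + psi x) = a * T phi + T psi) /\
  (forall eps : R, 0 < eps -> exists (N : nat) (delta : R), 0 < delta /\
     forall phi, schwartz phi ->
       (forall s m n, (size s <= N)%N -> (m <= N)%N -> (n <= N)%N ->
          seminorm_le s m n phi delta) ->
       cabs (T phi) <= eps).

Definition regular_distr (R : realType) (g : R * R -> R[i])
    (phi : R * R -> R[i]) : R[i] :=
  cint (fun x => g x * phi x).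

Definition distr_deriv (R : realType) (b : bool)
    (T : (R * R -> R[i]) -> R[i]) (phi : R * R -> R[i]) : R[i] :=
  - T (cpartial [:: b] phi).

Definition distr_conv (R : realType) (T : (R * R -> R[i]) -> R[i])
    (W : R * R -> R[i]) (x : R * R) : R[i] :=
  T (fun y => W (x.1 - y.1, x.2 - y.2)).

(* (F f)(xi) = \int f(x) exp(-i (x, xi)) dx *)
Definition fourier (R : realType) (f : R * R -> R[i]) (xi : R * R) : R[i] :=
  cint (fun x => let t := x.1 * xi.1 + x.2 * xi.2 in
                 f x * (cos t +i* - sin t)).

Definition cutoff (R : realType) (w : R -> R) : Prop :=
  [/\ forall n s, derivable (derive1n n w) s 1,
      forall s, 0 <= w s,
      closure [set s | w s != 0] `<=` `[2^-1, 2] &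
      forall s, 1 <= s <= 2 -> w s = 1 - w (s / 2)].

Definition besov_kernels (R : realType) (w : R -> R)
    (W : int -> R * R -> R[i]) : Prop :=
  forall n : int, schwartz (W n) /\
    forall xi : R * R, fourier (W n) xi =
      (w (Num.sqrt (xi.1 ^+ 2 + xi.2 ^+ 2) / 2 ^ n))%:C.

(* \sum_(n in Z) a_n = l, as the limit of \sum_(- M <= n <= N) a_n when
   M, N --> oo. *)
Definition bisum_cvg (R : realType) (a : int -> R[i]) (l : R[i]) : Prop :=
  (fun MN : nat * nat => \sum_(0 <= k < MN.1) a (- k.+1%:Z) +
                         \sum_(0 <= k < MN.2.+1) a k%:Z) @ (\oo, \oo)
  --> (l : R[i]^o).

(* The W_n are determined by w, by injectivity of the Fourier transform.
   The second condition is the norm condition; the third one is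
   dT/dx_i = \sum_(n in Z) dT_n/dx_i in the space of tempered distributions. *)
Definition besov (R : realType) (w : R -> R)
    (T : (R * R -> R[i]) -> R[i]) : Prop :=
  tempered T /\
  exists W : int -> R * R -> R[i],
    [/\ besov_kernels w W,
        (\esum_(n in [set: int])
           ((2 ^ n)%:E *
            'N[leb2 R]_+oo [(fun x => (cabs (distr_conv T (W n) x))%:E)])
         < +oo)%E &
        forall (b : bool) (phi : R * R -> R[i]), schwartz phi ->
          bisum_cvg
            (fun n => distr_deriv b (regular_distr (distr_conv T (W n))) phi)
            (distr_deriv b T phi)].

(* A function (the continuously differentiable representative) in the Besov
   class, identified with the tempered distribution it defines. *)
Definition besov_fun (R : realType) (w : R -> R) (f : R * R -> R[i]) : Prop :=
  [/\ contdiff f,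
      forall phi, schwartz phi -> cintegrable (fun x => f x * phi x) &
      besov w (regular_distr f)].

Definition divdiff1 (R : realType) (f : R * R -> R[i]) (x1 x2 y : R) : R[i] :=
  if x1 == x2 then cpartial [:: false] f (x1, y)
  else (f (x1, y) - f (x2, y)) / (x1 - x2)%:C.

(* The norm of V has values in R[i]; rnorm is the same norm with values in R. *)
Definition rnorm (R : realType) (V : normedModType R[i]) (v : V) : R :=
  complex.Re `|v|.

Lemma rnormE (R : realType) (V : normedModType R[i]) (v : V) :
  `|v| = (rnorm v)%:C.
Proof. by rewrite /rnorm RRe_real// ger0_real. Qed.

Lemma rnorm_ge0 (R : realType) (V : normedModType R[i]) (v : V) : 0 <= rnorm v.
Proof. by rewrite -(@lecR R) -rnormE; exact: (@normr_ge0 _ V v). Qed.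

Lemma rnorm_cvg (R : realType) (V : normedModType R[i]) (u : nat -> V) (l : V) :
  u @ \oo --> l -> rnorm (u n) @[n --> \oo] --> rnorm l.
Proof.
move=> /cvgrPdist_lt ul; apply/cvgrPdist_lt => e e0.
have e0' : (0 : R[i]) < e%:C by rewrite ltcR.
have := ul _ e0'; apply: filterS => n.
rewrite rnormE ltcR; apply: le_lt_trans.
have := lerB_dist l (u n); have := lerB_dist (u n) l.
rewrite (distrC (u n) l) !rnormE -!raddfB !lecR => h1 h2.
by rewrite ler_norml; apply/andP; split; lra.
Qed.

Record hilbertSpace (R : realType) := HilbertSpace {
  hs_sort :> completeNormedModType R[i];
  hs_dot : {dot hs_sort for Num.conj};
  hs_normE : forall x : hs_sort, `|x| ^+ 2 = hs_dot x x }.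

(* Projection-valued measures on the Borel subsets of R. *)
Record spectralMeasure (R : realType) (H : hilbertSpace R) := SpectralMeasure {
  spectral :> set (measurableTypeR R) -> H -> H;
  spectral_linear : forall A, measurable A -> linear (spectral A);
  spectral_idem : forall A, measurable A ->
    forall u, spectral A (spectral A u) = spectral A u;
  spectral_selfadj : forall A, measurable A ->
    forall u v, hs_dot H (spectral A u) v = hs_dot H u (spectral A v);
  spectral_setT : forall u, spectral setT u = u;
  spectral_set0 : forall u, spectral set0 u = 0;
  spectral_sigma_additive : forall F : nat -> set (measurableTypeR R),
    (forall n, measurable (F n)) -> trivIset setT F ->
    forall u, (\sum_(0 <= k < n) spectral (F k) u) @[n --> \oo]
              --> spectral (\bigcup_k F k) u }.

(* The scalar measure A |-> (E(A)u, u), which equals ||E(A)u||^2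
   (scalar_spectralE). *)
Definition scalar_spectral (R : realType) (H : hilbertSpace R)
    (E : spectralMeasure H) (u : H) (A : set (measurableTypeR R)) : \bar R :=
  (rnorm (E A u) ^+ 2)%:E.

Lemma scalar_spectralE (R : realType) (H : hilbertSpace R)
    (E : spectralMeasure H) (u : H) A : measurable A ->
  (rnorm (E A u) ^+ 2)%:C = hs_dot H (E A u) u.
Proof.
move=> mA; rewrite rmorphXn/= -rnormE hs_normE.
by rewrite spectral_selfadj// spectral_idem// -spectral_selfadj.
Qed.

Lemma scalar_polar (R : realType) (H : hilbertSpace R) (u v : H) (a : R) :
  hs_dot H v u = a%:C ->
  a = (rnorm (v + u) ^+ 2 - rnorm v ^+ 2 - rnorm u ^+ 2) / 2.
Proof.
move=> h.
have := dnormD (hs_dot H) v u.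
rewrite -!hs_normE /= h.
have -> : Num.conj (a%:C : R[i]) = a%:C by apply: conj_Creal; rewrite complex_real.
rewrite !rnormE.
by move=> /(congr1 (@complex.Re R)) /= e; lra.
Qed.

Lemma scalar_spectral_sigma_additive (R : realType) (H : hilbertSpace R)
    (E : spectralMeasure H) (u : H) : semi_sigma_additive (scalar_spectral E u).
Proof.
move=> F mF tF mUF.
rewrite /scalar_spectral.
under eq_fun do rewrite sumEFin.
apply: cvg_EFin; first by near=> n.
rewrite (_ : _ \o _ = fun n => \sum_(0 <= k < n) rnorm (E (F k) u) ^+ 2)//.
set S := fun n => \sum_(0 <= k < n) E (F k) u.
have cS : S @ \oo --> E (\bigcup_k F k) u by exact: spectral_sigma_additive.
have cS' : (S n + u) @[n --> \oo] --> E (\bigcup_k F k) u + u.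
  by apply: cvgD => //; exact: cvg_cst.
rewrite (scalar_polar (esym (scalar_spectralE E u mUF))).
rewrite (_ : (fun n => _) =
  fun n => (rnorm (S n + u) ^+ 2 - rnorm (S n) ^+ 2 - rnorm u ^+ 2) / 2); last first.
  apply/funext => n; apply: scalar_polar.
  rewrite /S rmorph_sum/=.
  under [RHS]eq_bigr => i _ do rewrite scalar_spectralE//.
  by elim/big_ind2 : _ => [|x a y b <- <-|//]; rewrite ?linear0l ?linearDl.
apply: cvgMl; apply: cvgB; last exact: cvg_cst.
by apply: cvgB; rewrite /GRing.exp/=; apply: cvgM; exact: rnorm_cvg.
Unshelve. all: by end_near.
Qed.

Lemma scalar_spectral0 (R : realType) (H : hilbertSpace R)
    (E : spectralMeasure H) (u : H) : scalar_spectral E u set0 = 0%E.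
Proof.
by rewrite /scalar_spectral spectral_set0 /rnorm normr0 expr2 mul0r.
Qed.

Lemma scalar_spectral_ge0 (R : realType) (H : hilbertSpace R)
    (E : spectralMeasure H) (u : H) A : (0 <= scalar_spectral E u A)%E.
Proof. by rewrite lee_fin sqr_ge0. Qed.

HB.instance Definition _ (R : realType) (H : hilbertSpace R)
    (E : spectralMeasure H) (u : H) :=
  isMeasure.Build _ (measurableTypeR R) R (scalar_spectral E u)
    (scalar_spectral0 E u) (scalar_spectral_ge0 E u)
    (@scalar_spectral_sigma_additive R H E u).

Lemma scalar_spectral_fin (R : realType) (H : hilbertSpace R)
    (E : spectralMeasure H) (u : H) : fin_num_fun (scalar_spectral E u).
Proof. by []. Qed.

HB.instance Definition _ (R : realType) (H : hilbertSpace R)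
    (E : spectralMeasure H) (u : H) :=
  Measure_isFinite.Build _ (measurableTypeR R) R (scalar_spectral E u)
    (scalar_spectral_fin E u).

Definition spectral_ae (R : realType) (H : hilbertSpace R)
    (E : spectralMeasure H) (P : R -> Prop) : Prop :=
  exists A : set (measurableTypeR R),
    [/\ measurable A, forall u, E A u = 0 & forall x, ~ A x -> P x].

(* Almost everywhere with respect to E1 x E2 x E3: a set is null when it is
   null for all the products of scalar measures of E1, E2, E3. *)
Definition spectral_ae3 (R : realType) (H : hilbertSpace R)
    (E1 E2 E3 : spectralMeasure H) (P : R -> R -> R -> Prop) : Prop :=
  forall u1 u2 u3 : H,
    {ae (scalar_spectral E1 u1 \x scalar_spectral E2 u2
         \x scalar_spectral E3 u3)%E,
     forall x : R * R * R, P x.1.1 x.1.2 x.2}.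

Definition l2normsq (R : realType) (a : nat -> R[i]) : \bar R :=
  (\sum_(0 <= k <oo) ((cabs (a k)) ^+ 2)%:E)%E.

(* The matrix b induces an operator on l^2 of norm at most |C|. *)
Definition matrix_opnorm_le (R : realType) (b : nat -> nat -> R[i]) (C : R) :
    Prop :=
  forall v : nat -> R[i], (l2normsq v < +oo)%E ->
    exists bv : nat -> R[i],
      (forall j, (\sum_(0 <= k < n) b j k * v k) @[n --> \oo]
                 --> (bv j : R[i]^o)) /\
      (l2normsq bv <= (C ^+ 2)%:E * l2normsq v)%E.

Definition Linfty_l2 (R : realType) (H : hilbertSpace R)
    (E : spectralMeasure H) (a : R -> nat -> R[i]) : Prop :=
  (forall j, cmeasurable (fun x : measurableTypeR R => a x j)) /\
  exists C : R, spectral_ae E (fun x => (l2normsq (a x) <= (C ^+ 2)%:E)%E).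

Definition Linfty_matrix (R : realType) (H : hilbertSpace R)
    (E : spectralMeasure H) (b : R -> nat -> nat -> R[i]) : Prop :=
  (forall j k, cmeasurable (fun x : measurableTypeR R => b x j k)) /\
  exists C : R, spectral_ae E (fun x => matrix_opnorm_le (b x) C).

(* As in L^infty, functions are identified when they coincide almost
   everywhere, so the series has to converge to Psi only (E1 x E2 x E3)-a.e. *)
Definition haagerup (R : realType) (H : hilbertSpace R)
    (E1 E2 E3 : spectralMeasure H) (Psi : R -> R -> R -> R[i]) : Prop :=
  exists (a : R -> nat -> R[i]) (b : R -> nat -> nat -> R[i])
         (c : R -> nat -> R[i]),
    [/\ Linfty_l2 E1 a, Linfty_matrix E2 b, Linfty_l2 E3 c &
        spectral_ae3 E1 E2 E3 (fun x1 x2 x3 =>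
          (fun NM : nat * nat =>
             \sum_(0 <= j < NM.1.+1) \sum_(0 <= k < NM.2.+1)
               a x1 j * b x2 j k * c x3 k) @ (\oo, \oo)
          --> (Psi x1 x2 x3 : R[i]^o))].

(* Main.v *)
From HB Require Import structures.
Require Import Defs.
From mathcomp Require Import all_boot all_order all_algebra.
From mathcomp Require Import complex sesquilinear ring lra zify.
From mathcomp Require Import all_classical all_reals all_analysis.
From mathcomp Require Import measurable_realfun ess_sup_inf.
Set Implicit Arguments.
Unset Strict Implicit.
Unset Printing Implicit Defensive.
Import Order.TTheory GRing.Theory Num.Theory.
Import numFieldNormedType.Exports.
Local Open Scope classical_set_scope.
Local Open Scope ring_scope.
Local Open Scope complex_scope.

(** Let [f(x, y) = g(x + y)] with [g(t) = \sum_j r^j e^(it) P_j(t)] and [r = 4/5], where [P_j] is a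
    product of [j] lacunary factors [2/5 + (3/5) i z + (2/5) z^2].  Each factor is at most [1] on the
    unit circle while its coefficients have modulus sum [7/5].  The frequencies of [P_j] are small,
    so the spectrum of [f] lies in the annulus [1 < |xi| < 2]: only [f_0] and [f_1] are nonzero,
    both are bounded by Fourier inversion for the kernels [W_n], and [f] is in the Besov class.

    The spectral measures have atoms at the points [pi n] of [l^2].  On this grid, with
    [x_1 = pi (x + 1)], [x_2 = pi x], [x_3 = pi y], the divided difference is a function
    [D(x + y)], whose exponentials have coefficients of modulus at least those of [g], over [pi].
    A Haagerup representation factors this matrix as [\sum_k u_k(x) v_k(y)] with bounded
    [l^2]-norms (absorb the matrix [beta(pi x)] in [alpha(pi (x + 1))]), so for characters [chi_e] of
    [{0, ..., M - 1}] Parseval bounds [\sum_e s_e (D, chi_e (x) chi_e)] by [S M^2] for all [|s_e| <= 1].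
    Taking the frequencies of the [n]-th block, the left side is about
    [M^2 r^n (7/5)^n / pi = M^2 (28/25)^n / pi], which is unbounded relative to [M^2]. *)

(** The Besov norm sees only the sup norms of [f_0] and [f_1], whereas the pairing on the grid sees
    the sum of the moduli of the Fourier coefficients of one block. The witness separates these two
    quantities at bounded frequency, since the dyadic scale [n] would cost a factor [2^n]. The ratio
    [4/5] lies between [5/7] and [1]: the sup norms [r^j] are summable while the coefficient sums
    [(7 r / 5)^j] grow. Coefficient sums multiply because exponents are read off base-3 digits, so
    that terms of the product never collide. The step [pi] suits frequencies between [1] and [11/9]:
    one step multiplies each exponential by a number of negative real part, so taking the difference
    diminishes no coefficient. It also makes the denominator the constant [pi]. Tying both [x_1] and
    [x_2] to [x] reduces three variables to two, where the factorization is that of a Schur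
    multiplier. Parseval wants all frequencies over one denominator, which only finitely many blocks
    have; the series is cut at [N], chosen after [n], and its tail is estimated by sup norms. *)

(** * The modulus of complex numbers and estimates for [exp (i t)] *)

Section complex_modulus.
Context {R : realType}.
Implicit Types (z : R[i]) (t : R).

Lemma cabsE z : cabs z = Num.sqrt (complex.Re z ^+ 2 + complex.Im z ^+ 2).
Proof. by rewrite /cabs normc_def. Qed.

Lemma cabs_norm z : `|z| = (cabs z)%:C.
Proof. by rewrite /cabs RRe_real// ger0_real. Qed.

Lemma cabs_ge0 z : 0 <= cabs z.
Proof. by rewrite cabsE sqrtr_ge0. Qed.

Lemma cabsM z1 z2 : cabs (z1 * z2) = cabs z1 * cabs z2.
Proof.
by apply: (@complexI R); rewrite rmorphM/= -!cabs_norm normrM.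
Qed.

Lemma cabsD z1 z2 : cabs (z1 + z2) <= cabs z1 + cabs z2.
Proof. by rewrite -lecR rmorphD/= -!cabs_norm ler_normD. Qed.

Lemma cabsN z : cabs (- z) = cabs z.
Proof. by apply: (@complexI R); rewrite -!cabs_norm normrN. Qed.

Lemma cabs0 : cabs (0 : R[i]) = 0.
Proof. by apply: (@complexI R); rewrite -!cabs_norm normr0. Qed.

Lemma cabs1 : cabs (1 : R[i]) = 1.
Proof. by apply: (@complexI R); rewrite -!cabs_norm normr1. Qed.

Lemma cabs_real t : cabs (t%:C) = `|t|.
Proof. by rewrite cabsE/= expr0n/= addr0 sqrtr_sqr. Qed.

Lemma cabs_Re z : `|complex.Re z| <= cabs z.
Proof.
by rewrite cabsE -sqrtr_sqr ler_sqrt ?lerDl ?addr_ge0 ?sqr_ge0.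
Qed.

Lemma cabs_Im z : `|complex.Im z| <= cabs z.
Proof.
by rewrite cabsE -sqrtr_sqr ler_sqrt ?lerDr ?addr_ge0 ?sqr_ge0.
Qed.

Lemma cabs_le z : cabs z <= `|complex.Re z| + `|complex.Im z|.
Proof.
rewrite cabsE -(@ler_pXn2r _ 2)// ?nnegrE ?sqrtr_ge0 ?addr_ge0//.
rewrite sqr_sqrtr ?addr_ge0 ?sqr_ge0// sqrrD !real_normK ?num_real//.
by rewrite addrAC lerDl mulrn_wge0// mulr_ge0.
Qed.

Lemma cabs_sqr z : cabs z ^+ 2 = complex.Re z ^+ 2 + complex.Im z ^+ 2.
Proof. by rewrite cabsE sqr_sqrtr ?addr_ge0 ?sqr_ge0. Qed.

Lemma cabsX z n : cabs (z ^+ n) = cabs z ^+ n.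
Proof. by elim: n => [|n IH]; rewrite ?expr0 ?cabs1// !exprS cabsM IH. Qed.

Lemma cabs_sum (I : Type) (s : seq I) (P : pred I) (F : I -> R[i]) :
  cabs (\sum_(i <- s | P i) F i) <= \sum_(i <- s | P i) cabs (F i).
Proof.
elim/big_ind2 : _ => [|x a y b xa yb|//]; first by rewrite cabs0.
by rewrite (le_trans (cabsD _ _))// lerD.
Qed.

Lemma cabs_dist z1 z2 : cabs (z1 - z2) = cabs (z2 - z1).
Proof. by rewrite -cabsN opprB. Qed.

Lemma cabs_eq0 z : cabs z = 0 -> z = 0.
Proof. by move=> h; apply/eqP; rewrite -normr_eq0 cabs_norm h. Qed.

Lemma ReD z1 z2 : complex.Re (z1 + z2) = complex.Re z1 + complex.Re z2.
Proof. by case: z1 z2 => [a b] [c d]. Qed.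
Lemma ImD z1 z2 : complex.Im (z1 + z2) = complex.Im z1 + complex.Im z2.
Proof. by case: z1 z2 => [a b] [c d]. Qed.
Lemma ReN z : complex.Re (- z) = - complex.Re z.
Proof. by case: z. Qed.
Lemma ImN z : complex.Im (- z) = - complex.Im z.
Proof. by case: z. Qed.
Lemma ReM z1 z2 : complex.Re (z1 * z2) =
  complex.Re z1 * complex.Re z2 - complex.Im z1 * complex.Im z2.
Proof. by case: z1 z2 => [a b] [c d]. Qed.
Lemma ImM z1 z2 : complex.Im (z1 * z2) =
  complex.Re z1 * complex.Im z2 + complex.Im z1 * complex.Re z2.
Proof. by case: z1 z2 => [a b] [c d]. Qed.
Lemma Re_sum (I : Type) (s : seq I) (P : pred I) (F : I -> R[i]) :
  complex.Re (\sum_(i <- s | P i) F i) = \sum_(i <- s | P i) complex.Re (F i).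
Proof. by elim/big_ind2 : _ => // x a y b <- <-; rewrite ReD. Qed.
Lemma Im_sum (I : Type) (s : seq I) (P : pred I) (F : I -> R[i]) :
  complex.Im (\sum_(i <- s | P i) F i) = \sum_(i <- s | P i) complex.Im (F i).
Proof. by elim/big_ind2 : _ => // x a y b <- <-; rewrite ImD. Qed.

Lemma complex_eq z1 z2 : complex.Re z1 = complex.Re z2 ->
  complex.Im z1 = complex.Im z2 -> z1 = z2.
Proof. by case: z1 z2 => [a b] [c d] /= -> ->. Qed.

Definition expi t : R[i] := cos t +i* sin t.

Lemma expi0 : expi 0 = 1.
Proof. by rewrite /expi cos0 sin0. Qed.

Lemma expiD t u : expi (t + u) = expi t * expi u.
Proof.
by apply: complex_eq; rewrite /= ?ReM ?ImM/= ?cosD// sinD addrC.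
Qed.

Lemma expiN t : expi (- t) = cos t +i* - sin t.
Proof. by rewrite /expi cosN sinN. Qed.

Lemma cabs_expi t : cabs (expi t) = 1.
Proof. by rewrite cabsE/= cos2Dsin2 sqrtr1. Qed.

Lemma expiMn t n : expi (t *+ n) = expi t ^+ n.
Proof. by elim: n => [|n IH]; rewrite ?expi0 ?expr0// mulrS expiD IH exprS. Qed.

Lemma expiK t : expi (- t) * expi t = 1.
Proof. by rewrite -expiD addNr expi0. Qed.

Lemma normr_sin_le t : `|sin t| <= `|t|.
Proof.
wlog t0 : t / 0 <= t.
  move=> h; have [/h//|t0] := leP 0 t.
  by rewrite -(normrN t) -(normrN (sin t)) -sinN h// oppr_ge0 ltW.
move: t0; rewrite le_eqVlt => /predU1P[<-|t0]; first by rewrite sin0.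
have [|c _] := @MVT R sin cos 0 t t0.
  by apply: continuous_in_subspaceT => x _; exact: continuous_sin.
rewrite sin0 !subr0 => ->; rewrite normrM ler_piMl//; exact: cos_max.
Qed.

Lemma cos1B_le t : `|cos t - 1| <= t ^+ 2 / 2.
Proof.
have -> : cos t - 1 = - (2 * sin (t / 2) ^+ 2).
  have -> : cos t = cos ((t / 2) *+ 2) by rewrite -mulr_natr divfK.
  rewrite cos_mulr2n mulr2n sin2cos2; lra.
rewrite normrN normrM normrX ger0_norm//.
have h : `|sin (t / 2)| ^+ 2 <= `|t / 2| ^+ 2 by rewrite lerXn2r ?nnegrE// normr_sin_le.
by move: h; rewrite (real_normK (num_real (t / 2))) expr_div_n; lra.
Qed.

Lemma expi_sub1_le t : cabs (expi t - 1) <= `|t|.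
Proof.
rewrite cabsE -sqrtr_sqr ler_sqrt ?sqr_ge0//= subr0.
have -> : (cos t - 1) ^+ 2 + sin t ^+ 2 = 2 - 2 * cos t.
  by rewrite sin2cos2; ring.
by have := cos1B_le t; rewrite ler_norml => /andP[+ _]; lra.
Qed.

Lemma cos1B_le_norm t : `|cos t - 1| <= `|t|.
Proof. by apply: le_trans (expi_sub1_le t); exact: cabs_Re (expi t - 1). Qed.

Lemma sinB_le t : `|sin t - t| <= t ^+ 2.
Proof.
wlog t0 : t / 0 <= t.
  move=> h; have [/h//|t0] := leP 0 t.
  have := h (- t); rewrite sinN sqrrN (_ : - sin t - - t = - (sin t - t)).
    by rewrite normrN; apply; rewrite oppr_ge0 ltW.
  by ring.
move: t0; rewrite le_eqVlt => /predU1P[<-|t0].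
  by rewrite sin0 subr0 normr0 expr0n.
have [|c] := @MVT R (fun x => sin x - x) (fun x => cos x - 1) 0 t t0.
  apply: continuous_in_subspaceT => x _; apply: continuousB; last exact: cvg_id.
  exact: continuous_sin.
rewrite in_itv/= => /andP[c0 ct]; rewrite sin0 !subr0 => ->.
rewrite normrM (gtr0_norm t0) expr2 ler_pM2r//.
by rewrite (le_trans (cos1B_le_norm _))// gtr0_norm// ltW.
Qed.

(** Second order Taylor bound. All derivatives of sums and integrals of exponentials below rest on
    it, through [is_derive_quad]; only the quadratic order matters, not the constant. *)
Lemma expi_sub1B_le t : cabs (expi t - 1 - 'i * t%:C) <= 2 * t ^+ 2.
Proof.
rewrite (le_trans (cabs_le _))//.
have -> : complex.Re (expi t - 1 - 'i * t%:C) = cos t - 1.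
  by rewrite ReD ReN ReM/=; ring.
have -> : complex.Im (expi t - 1 - 'i * t%:C) = sin t - t.
  by rewrite ImD ImN ImM/=; ring.
by have := cos1B_le t; have := sinB_le t; have := sqr_ge0 t; lra.
Qed.

End complex_modulus.

(** * Measurability of complex-valued functions *)

Section cmeasurable_theory.
Context d (T : measurableType d) {R : realType}.
Implicit Types f g : T -> R[i].

Lemma cmeasurableD f g : cmeasurable f -> cmeasurable g ->
  cmeasurable (fun x => f x + g x).
Proof.
move=> [f1 f2] [g1 g2]; split.
  by under eq_fun do rewrite ReD; exact: measurable_funD.
by under eq_fun do rewrite ImD; exact: measurable_funD.
Qed.

Lemma cmeasurableN f : cmeasurable f -> cmeasurable (fun x => - f x).
Proof.
move=> [f1 f2]; split.
  by under eq_fun do rewrite ReN; exact: measurableT_comp.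
by under eq_fun do rewrite ImN; exact: measurableT_comp.
Qed.

Lemma cmeasurableM f g : cmeasurable f -> cmeasurable g ->
  cmeasurable (fun x => f x * g x).
Proof.
move=> [f1 f2] [g1 g2]; split.
  by under eq_fun do rewrite ReM; apply: measurable_funB; exact: measurable_funM.
by under eq_fun do rewrite ImM; apply: measurable_funD; exact: measurable_funM.
Qed.

Lemma cmeasurable_cst (a : R[i]) : cmeasurable (fun _ : T => a).
Proof. by split; exact: measurable_cst. Qed.

Lemma cmeasurable_real (h : T -> R) : measurable_fun setT h ->
  cmeasurable (fun x => (h x)%:C).
Proof. by move=> mh; split => //=; exact: measurable_cst. Qed.

Lemma cmeasurable_expi (h : T -> R) : measurable_fun setT h ->
  cmeasurable (fun x => expi (h x)).
Proof.
move=> mh; split => /=.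
  by apply: measurableT_comp => //; apply: continuous_measurable_fun; exact: continuous_cos.
by apply: measurableT_comp => //; apply: continuous_measurable_fun; exact: continuous_sin.
Qed.

Lemma cmeasurable_sum (I : Type) (s : seq I) (F : I -> T -> R[i]) :
  (forall i, cmeasurable (F i)) -> cmeasurable (fun x => \sum_(i <- s) F i x).
Proof.
move=> mF; elim: s => [|i s IH].
  by under eq_fun do rewrite big_nil; exact: cmeasurable_cst.
by under eq_fun do rewrite big_cons; exact: cmeasurableD.
Qed.

Lemma measurable_cabs f : cmeasurable f -> measurable_fun setT (fun x => cabs (f x)).
Proof.
move=> [f1 f2]; under eq_fun do rewrite cabsE.
apply: (@measurableT_comp _ _ _ _ _ _ (@Num.sqrt R)).
  by apply: continuous_measurable_fun => x; exact: sqrt_continuous.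
by apply: measurable_funD; exact: measurable_funX.
Qed.

End cmeasurable_theory.

(** * Integration of complex-valued functions *)

Section complex_integral.
Context d (T : measurableType d) {R : realType} (mu : {measure set T -> \bar R}).
Implicit Types (f : T -> R[i]) (g h : T -> R).

(** With [cintg], the counterpart over an arbitrary measure of [cintegrable] and [cint], to which
    they reduce by conversion at [leb2 R]; the slices in Fubini's theorem call for this
    generality. *)
Definition cinteg f : Prop :=
  mu.-integrable setT (fun x => (complex.Re (f x))%:E) /\
  mu.-integrable setT (fun x => (complex.Im (f x))%:E).

Definition cintg f : R[i] :=
  (\int[mu]_x complex.Re (f x)) +i* (\int[mu]_x complex.Im (f x)).

Lemma integrable_dom g h : measurable_fun setT h ->
  mu.-integrable setT (fun x => (g x)%:E) -> (forall x, `|h x| <= g x) ->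
  mu.-integrable setT (fun x => (h x)%:E).
Proof.
move=> mh ig hg; apply: le_integrable ig => //; first exact/measurable_EFinP.
by move=> x _ /=; rewrite lee_fin (le_trans (hg x))// ler_norm.
Qed.

Lemma integrable_scale r h : mu.-integrable setT (fun x => (h x)%:E) ->
  mu.-integrable setT (fun x => (r * h x)%:E).
Proof. by move=> ih; under eq_fun do rewrite EFinM; exact: integrableZl. Qed.

Lemma cinteg_dom f g : cmeasurable f -> mu.-integrable setT (fun x => (g x)%:E) ->
  (forall x, cabs (f x) <= g x) -> cinteg f.
Proof.
move=> [f1 f2] ig fg; split; apply: integrable_dom ig _ => // x.
  exact: le_trans (cabs_Re _) (fg x).
exact: le_trans (cabs_Im _) (fg x).
Qed.

Lemma cinteg_meas f : cinteg f -> cmeasurable f.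
Proof.
by move=> [/measurable_int/measurable_EFinP f1 /measurable_int/measurable_EFinP f2].
Qed.

Lemma cinteg_cabs f : cinteg f -> mu.-integrable setT (fun x => (cabs (f x))%:E).
Proof.
move=> cf; have mf := cinteg_meas cf; case: cf => f1 f2.
apply: (@integrable_dom (fun x => `|complex.Re (f x)| + `|complex.Im (f x)|)).
- exact: measurable_cabs.
- under eq_fun do rewrite EFinD; apply: integrableD => //.
    exact: (integrable_abse f1).
  exact: (integrable_abse f2).
- by move=> x; rewrite ger0_norm ?cabs_ge0// cabs_le.
Qed.

Lemma eq_cintg f1 f2 : f1 =1 f2 -> cintg f1 = cintg f2.
Proof. by move=> /funext ->. Qed.

Lemma cintegD f1 f2 : cinteg f1 -> cinteg f2 -> cinteg (fun x => f1 x + f2 x).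
Proof.
move=> [a1 b1] [a2 b2]; split.
  by under eq_fun do rewrite ReD EFinD; exact: integrableD.
by under eq_fun do rewrite ImD EFinD; exact: integrableD.
Qed.

Lemma cintgD f1 f2 : cinteg f1 -> cinteg f2 ->
  cintg (fun x => f1 x + f2 x) = cintg f1 + cintg f2.
Proof.
move=> [a1 b1] [a2 b2]; rewrite /cintg; apply: complex_eq; rewrite ?ReD ?ImD/=.
  by under eq_Rintegral do rewrite ReD; rewrite RintegralD.
by under eq_Rintegral do rewrite ImD; rewrite RintegralD.
Qed.

Lemma cintegZ a f : cinteg f -> cinteg (fun x => a * f x).
Proof.
move=> [a1 b1]; split.
  under eq_fun do rewrite ReM EFinB !EFinM.
  by apply: integrableB => //; exact: integrableZl.
under eq_fun do rewrite ImM EFinD !EFinM.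
by apply: integrableD => //; exact: integrableZl.
Qed.

Lemma cintgZ a f : cinteg f -> cintg (fun x => a * f x) = a * cintg f.
Proof.
move=> [a1 b1]; rewrite /cintg; apply: complex_eq; rewrite ?ReM ?ImM/=.
  under eq_Rintegral do rewrite ReM.
  by rewrite RintegralB// ?RintegralZl//; exact: integrable_scale.
under eq_Rintegral do rewrite ImM.
by rewrite RintegralD// ?RintegralZl//; exact: integrable_scale.
Qed.

Lemma cintg0 : cintg (fun=> 0) = 0.
Proof. by rewrite /cintg /= /Rintegral integral0. Qed.

Lemma cinteg0 : cinteg (fun=> 0).
Proof. by split; exact: integrable0. Qed.

Lemma cinteg_sum (I : Type) (s : seq I) (F : I -> T -> R[i]) :
  (forall i, cinteg (F i)) -> cinteg (fun x => \sum_(i <- s) F i x).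
Proof.
move=> mF; elim: s => [|i s IH].
  by under eq_fun do rewrite big_nil; exact: cinteg0.
by under eq_fun do rewrite big_cons; exact: cintegD.
Qed.

Lemma cintg_sum (I : Type) (s : seq I) (F : I -> T -> R[i]) :
  (forall i, cinteg (F i)) ->
  cintg (fun x => \sum_(i <- s) F i x) = \sum_(i <- s) cintg (F i).
Proof.
move=> mF; elim: s => [|i s IH].
  by under eq_cintg do rewrite big_nil; rewrite cintg0 big_nil.
under eq_cintg do rewrite big_cons.
by rewrite cintgD ?IH ?big_cons//; exact: cinteg_sum.
Qed.

Lemma Rintegral_dom g h : mu.-integrable setT (fun x => (h x)%:E) ->
  mu.-integrable setT (fun x => (g x)%:E) -> (forall x, `|h x| <= g x) ->
  `|\int[mu]_x h x| <= \int[mu]_x g x.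
Proof.
move=> ih ig hg; apply: (le_trans (le_normr_Rintegral _ ih)) => //.
by apply: le_Rintegral => //; exact: (integrable_abse ih).
Qed.

(** The factor [2] comes from bounding real and imaginary parts separately. It is harmless, as every
    use is up to a constant. *)
Lemma cabs_cintg_le f g : cinteg f -> mu.-integrable setT (fun x => (g x)%:E) ->
  (forall x, cabs (f x) <= g x) -> cabs (cintg f) <= 2 * \int[mu]_x g x.
Proof.
move=> [f1 f2] ig fg; rewrite (le_trans (cabs_le _))//=.
rewrite mulr_natl mulr2n lerD//; apply: Rintegral_dom => // x.
  exact: le_trans (cabs_Re _) (fg x).
exact: le_trans (cabs_Im _) (fg x).
Qed.

Lemma Rintegral_cvg (h_ : nat -> T -> R) h g :
  (forall n, measurable_fun setT (h_ n)) -> measurable_fun setT h ->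
  (forall x, h_ n x @[n --> \oo] --> h x) ->
  mu.-integrable setT (fun x => (g x)%:E) -> (forall n x, `|h_ n x| <= g x) ->
  \int[mu]_x h_ n x @[n --> \oo] --> \int[mu]_x h x.
Proof.
move=> mh_ mh hh ig hg.
have hE x : (h_ n x)%:E @[n --> \oo] --> (h x)%:E.
  by apply: cvg_EFin; [exact: nearW|exact: hh].
have [ih _] := @dominated_convergence _ T R mu setT measurableT
  (fun n x => (h_ n x)%:E) (fun x => (h x)%:E) (fun x => (g x)%:E)
  (fun n => (measurable_EFinP _ _).2 (mh_ n)) ((measurable_EFinP _ _).2 mh)
  (aeW _ (fun x _ => hE x)) ig
  (aeW _ (fun x n _ => hg n x)).
move=> cvgi; rewrite /Rintegral.
have fi : (\int[mu]_x (h x)%:E)%E \is a fin_num by exact: integrable_fin_num.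
by apply: fine_cvg; rewrite fineK.
Qed.

(** Dominated convergence on real and imaginary parts; convergence is expressed by real moduli, so
    that all limits are taken in [R]. *)
Lemma cintg_cvg (f_ : nat -> T -> R[i]) f g :
  (forall n, cmeasurable (f_ n)) -> cmeasurable f ->
  (forall x, cabs (f_ n x - f x) @[n --> \oo] --> (0 : R)) ->
  mu.-integrable setT (fun x => (g x)%:E) -> (forall n x, cabs (f_ n x) <= g x) ->
  cabs (cintg (f_ n) - cintg f) @[n --> \oo] --> (0 : R).
Proof.
move=> mf_ mf ff ig fg.
have cr : \int[mu]_x complex.Re (f_ n x) @[n --> \oo] --> \int[mu]_x complex.Re (f x).
  apply: Rintegral_cvg ig _; first by move=> n; exact: (mf_ n).1.
  - exact: mf.1.
  - move=> x; apply/cvgrPdist_le => e e0; have /cvgrPdist_le/(_ _ e0) := ff x.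
    apply: filterS => n; rewrite sub0r normrN (ger0_norm (cabs_ge0 _)) cabs_dist.
    by apply: le_trans; rewrite -ReN -ReD; exact: cabs_Re.
  - by move=> n x; exact: le_trans (cabs_Re _) (fg n x).
have ci : \int[mu]_x complex.Im (f_ n x) @[n --> \oo] --> \int[mu]_x complex.Im (f x).
  apply: Rintegral_cvg ig _; first by move=> n; exact: (mf_ n).2.
  - exact: mf.2.
  - move=> x; apply/cvgrPdist_le => e e0; have /cvgrPdist_le/(_ _ e0) := ff x.
    apply: filterS => n; rewrite sub0r normrN (ger0_norm (cabs_ge0 _)) cabs_dist.
    by apply: le_trans; rewrite -ImN -ImD; exact: cabs_Im.
  - by move=> n x; exact: le_trans (cabs_Im _) (fg n x).
apply/cvgrPdist_le => e e0; have e20 : 0 < e / 2 by rewrite divr_gt0.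
have /cvgrPdist_le/(_ _ e20) cr' := cr; have /cvgrPdist_le/(_ _ e20) ci' := ci.
near=> n; rewrite sub0r normrN (ger0_norm (cabs_ge0 _)) cabs_dist.
rewrite (le_trans (cabs_le _))// ReD ImD ReN ImN /= (splitr e) lerD//.
  by near: n.
by near: n.
Unshelve. all: by end_near. Qed.

End complex_integral.

(** * Fubini's theorem with a product majorant *)

Section Fubini.
Context d1 d2 (T1 : measurableType d1) (T2 : measurableType d2) {R : realType}.
Variables (m1 : {sigma_finite_measure set T1 -> \bar R})
          (m2 : {sigma_finite_measure set T2 -> \bar R}).
Implicit Types (h : T1 * T2 -> R) (f : T1 * T2 -> R[i]) (g : T1 -> R) (k : T2 -> R).

Lemma integrable_tensor (g1 : T1 -> R) (g2 : T2 -> R) :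
  m1.-integrable setT (fun x => (g1 x)%:E) -> m2.-integrable setT (fun x => (g2 x)%:E) ->
  (m1 \x m2)%E.-integrable setT (fun x => (g1 x.1 * g2 x.2)%:E).
Proof.
move=> i1 i2.
have mg1 : measurable_fun setT g1 by exact/measurable_EFinP/(measurable_int _ i1).
have mg2 : measurable_fun setT g2 by exact/measurable_EFinP/(measurable_int _ i2).
apply/integrable12ltyP.
  by apply/measurable_EFinP; apply: measurable_funM; apply: measurableT_comp.
have j1 := integrable_abse i1; have j2 := integrable_abse i2.
have -> : (\int[m1]_x \int[m2]_y `|(g1 (x, y).1 * g2 (x, y).2)%:E| =
   \int[m1]_x ((fine (\int[m2]_y `|(g2 y)%:E|))%:E * `|(g1 x)%:E|))%E.
  apply: eq_integral => x _ /=.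
  rewrite fineK; last exact: integrable_fin_num.
  under eq_integral do rewrite normrM EFinM.
  by rewrite ge0_integralZl_EFin//= 1?muleC//;
    apply/measurable_EFinP; apply: measurableT_comp.
rewrite integralZl//.
by have /fineK <- := integrable_fin_num measurableT j1; rewrite -EFinM ltry.
Qed.

(** The product majorant makes every slice integrable, and not just almost every one, so the
    iterated real integrals are equal without exceptional sets. *)
Lemma Rfubini h (g1 : T1 -> R) (g2 : T2 -> R) : measurable_fun setT h ->
  m1.-integrable setT (fun x => (g1 x)%:E) -> m2.-integrable setT (fun x => (g2 x)%:E) ->
  (forall x y, `|h (x, y)| <= g1 x * g2 y) ->
  \int[(m1 \x m2)%E]_z h z = \int[m1]_x \int[m2]_y h (x, y) /\
  \int[(m1 \x m2)%E]_z h z = \int[m2]_y \int[m1]_x h (x, y).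
Proof.
move=> mh i1 i2 hg.
have ih : (m1 \x m2)%E.-integrable setT (fun x => (h x)%:E).
  by apply: integrable_dom (integrable_tensor i1 i2) _ => // -[x y]; exact: hg.
split; rewrite /Rintegral.
- rewrite -(integral12_prod_meas1 ih); congr fine; apply: eq_integral => x _.
  rewrite /fubini_F fineK//; apply: integrable_fin_num => //.
  apply: integrable_dom (integrable_scale (g1 x) i2) _ => //.
  exact: measurable_fun_pair2.
- rewrite -(integral21_prod_meas1 ih); congr fine; apply: eq_integral => y _.
  rewrite /fubini_G fineK//; apply: integrable_fin_num => //.
  apply: integrable_dom (integrable_scale (g2 y) i1) _ => //.
    exact: measurable_fun_pair1.
  by move=> x; rewrite mulrC.
Qed.

Lemma cfubini f (g1 : T1 -> R) (g2 : T2 -> R) : cmeasurable f ->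
  m1.-integrable setT (fun x => (g1 x)%:E) -> m2.-integrable setT (fun x => (g2 x)%:E) ->
  (forall x y, cabs (f (x, y)) <= g1 x * g2 y) ->
  cintg (m1 \x m2)%E f = cintg m1 (fun x => cintg m2 (fun y => f (x, y))) /\
  cintg (m1 \x m2)%E f = cintg m2 (fun y => cintg m1 (fun x => f (x, y))).
Proof.
move=> [mr mi] i1 i2 fg.
have [r1 r2] := Rfubini mr i1 i2 (fun x y => le_trans (cabs_Re _) (fg x y)).
have [s1 s2] := Rfubini mi i1 i2 (fun x y => le_trans (cabs_Im _) (fg x y)).
by rewrite /cintg/=; split; [rewrite r1 s1|rewrite r2 s2].
Qed.

End Fubini.

(** * Changes of variable on the line and the Poisson kernel *)

Section line_integrals.
Context {R : realType}.
Local Notation mu := (@lebesgue_measure R).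

Lemma integral_affine (G : R -> R) (a b : R) : 0 < a -> continuous G ->
  (forall x, 0 <= G x) ->
  (\int[mu]_x (G x)%:E = \int[mu]_x (G (a * x + b) * a)%:E)%E.
Proof.
move=> a0 cG G0.
have dF x : is_derive (x : R) 1 (fun x : R => a * x + b) a.
  by apply: is_derive_eq; rewrite addr0 /GRing.scale/= mulr1.
have dFE : derive1 (fun x : R => a * x + b) = cst a.
  by apply/funext => x; rewrite derive1E; exact: derive_val.
rewrite (@increasing_ge0_integration_by_substitutionT _ (fun x => a * x + b) G)//.
- by apply: eq_integral => x _; rewrite dFE.
- by move=> x y xy; rewrite ltrD2r ltr_pM2l.
- by rewrite dFE => x; exact: cvg_cst.
- by rewrite dFE; exact: is_cvg_cst.
- by rewrite dFE; exact: is_cvg_cst.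
- apply/cvgrNyPle => A; have := nbhs_ninfty_le (num_real ((A - b) / a)).
  by apply: filterS => x; rewrite ler_pdivlMr// mulrC lerBrDr.
- apply/cvgryPge => A; have := nbhs_pinfty_ge (num_real ((A - b) / a)).
  by apply: filterS => x; rewrite ler_pdivrMr// mulrC lerBlDr.
Qed.

Lemma integral_oneDsqr : (\int[mu]_x ((1 + x ^+ 2)^-1)%:E = (pi : R)%:E)%E.
Proof.
rewrite ge0_symfun_integralT.
- have -> : [set x : R | 0 <= x] = `[0, +oo[%classic by rewrite set_itvcy.
  by rewrite integral0y_oneDsqr -EFinM mulrC divfK.
- by move=> x; rewrite invr_ge0; exact: le_trans ler01 (oneDsqr_ge1 x).
- exact: continuous_oneDsqrV.
- by move=> x /=; rewrite sqrrN.
Qed.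

(** The Poisson kernel of the half-plane without the factor [1 / pi]: its mass is [pi] for every
    width [e]. *)
Definition poisson (e t : R) : R := e / (e ^+ 2 + t ^+ 2).

Lemma poisson_ge0 e t : 0 < e -> 0 <= poisson e t.
Proof.
by move=> e0; rewrite divr_ge0 ?(ltW e0)// addr_ge0 ?sqr_ge0.
Qed.

Lemma measurable_poisson (e c : R) : 0 < e -> measurable_fun setT (fun t : R => poisson e (t - c)).
Proof.
move=> e0; apply: continuous_measurable_fun => t.
apply: cvgM; first exact: cvg_cst.
apply: cvgV; first by rewrite gt_eqF// ltr_wpDr ?sqr_ge0// exprn_gt0.
apply: cvgD; first exact: cvg_cst.
have h : (t0 - c) @[t0 --> t] --> t - c by apply: cvgB; [exact: cvg_id|exact: cvg_cst].
by rewrite expr2; under eq_fun do rewrite expr2; exact: cvgM.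
Qed.

Lemma integral_poisson (e c : R) : 0 < e ->
  (\int[mu]_t (poisson e (t - c))%:E = (pi : R)%:E)%E.
Proof.
move=> e0; rewrite -integral_oneDsqr (@integral_affine (fun x => (1 + x ^+ 2)^-1) e^-1 (- (c / e)))//.
- apply: eq_integral => x _; congr EFin; rewrite /poisson.
  rewrite (_ : e^-1 * x - c / e = (x - c) / e); last by rewrite mulrBl mulrC.
  have en : e != 0 by rewrite gt_eqF.
  field; rewrite en/=.
  by rewrite gt_eqF// ltr_wpDr ?sqr_ge0// exprn_gt0.
- by rewrite invr_gt0.
- exact: continuous_oneDsqrV.
- by move=> x; rewrite invr_ge0; exact: le_trans ler01 (oneDsqr_ge1 x).
Qed.

Lemma integrable_ge0 d (T : measurableType d) (m : {measure set T -> \bar R})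
    (g : T -> R) (c : R) : measurable_fun setT g ->
  (forall x, 0 <= g x) -> (\int[m]_x (g x)%:E = c%:E)%E ->
  m.-integrable setT (fun x => (g x)%:E).
Proof.
move=> mg g0 gc; apply/integrableP; split; first exact/measurable_EFinP.
rewrite (eq_integral (fun x => (g x)%:E)); first by rewrite gc ltry.
by move=> x _; rewrite /= ger0_norm.
Qed.

Lemma integrable_poisson (e c : R) : 0 < e ->
  mu.-integrable setT (fun t => (poisson e (t - c))%:E).
Proof.
move=> e0; apply: integrable_ge0 (integral_poisson c e0).
  exact: measurable_poisson.
by move=> x; exact: poisson_ge0.
Qed.

Lemma ge0_integral_fold (G : R -> R) : continuous G -> (forall x, 0 <= G x) ->
  (\int[mu]_x (G x)%:E =
   \int[mu]_(x in `[0%R, +oo[) (G x + G (- x))%:E)%E.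
Proof.
move=> cG G0.
have mG : measurable_fun setT G by exact: continuous_measurable_fun.
have mGN : measurable_fun setT (fun x : R => G (- x)) by exact: measurableT_comp.
rewrite -(setUv (`[0, +oo[%classic : set R)) ge0_integral_setU//=; last 4 first.
- exact: measurableC.
- by rewrite setUv; exact/measurable_EFinP.
- by move=> x _; rewrite lee_fin.
- by apply/disj_setPCl.
under [RHS]eq_integral do rewrite EFinD.
rewrite ge0_integralD//=; last 4 first.
- by move=> x _; rewrite lee_fin.
- by apply/measurable_EFinP; exact: measurable_funTS.
- by move=> x _; rewrite lee_fin.
- by apply/measurable_EFinP; exact: measurable_funTS.
congr (_ + _)%E; rewrite setCitvr.
have := @ge0_integration_by_substitutionNy R G 0; rewrite oppr0 => <-//.
- rewrite integral_itv_bndo_bndc//; apply/measurable_EFinP; exact: measurable_funTS.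
- exact: continuous_subspaceT.
Qed.

End line_integrals.

(** * The Fourier transform of [exp (- e |x|)] *)

Section poisson_transform.
Context {R : realType}.
Local Notation mu := (@lebesgue_measure R).

Definition lap (e x : R) : R := expR (- (e * `|x|)).

Lemma lap_ge0 e x : 0 <= lap e x.
Proof. exact: expR_ge0. Qed.

Lemma continuous_lap e : continuous (lap e).
Proof.
move=> x; apply: continuous_comp; last exact: continuous_expR.
apply: cvgN; apply: cvgM; first exact: cvg_cst.
exact: norm_continuous.
Qed.

Lemma continuous_cos_affine (t s : R) : continuous (fun x : R => cos (t * x + s)).
Proof.
move=> x; apply: (continuous_comp (f := fun x => t * x + s)); last exact: continuous_cos.
apply: cvgD; last exact: cvg_cst.
by apply: cvgM; [exact: cvg_cst|exact: cvg_id].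
Qed.

(** A primitive of the integrand of [integral_laplace0] after folding onto the half-line, where the
    two signs of [x] combine to [2 + 2 c cos (t x)] with [c = cos s]. *)
Let prim (e t c x : R) : R := expR (- (e * x)) *
  (- 2 / e + 2 * c * (t * sin (t * x) - e * cos (t * x)) / (e ^+ 2 + t ^+ 2)).

Let prim_derive e t c x : 0 < e -> is_derive (x : R) 1 (prim e t c)
  (expR (- (e * x)) * (2 + 2 * c * cos (t * x))).
Proof.
move=> e0; have d2 : e ^+ 2 + t ^+ 2 != 0.
  by rewrite gt_eqF// ltr_wpDr ?sqr_ge0// exprn_gt0.
have dl (k : R) : is_derive (x : R) 1 (fun x : R => k * x) k.
  by apply: is_derive_eq; rewrite /GRing.scale/= mulr1.
have de : is_derive (x : R) 1 (fun x : R => expR (- (e * x))) (expR (- (e * x)) * - e).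
  have -> : (fun x : R => expR (- (e * x))) = expR \o (fun x => - e * x).
    by apply/funext => y /=; rewrite mulNr.
  by apply: is_derive_eq; rewrite /= mulNr mulrC.
have ds : is_derive (x : R) 1 (fun x : R => sin (t * x)) (cos (t * x) * t).
  have -> : (fun x : R => sin (t * x)) = sin \o (fun x => t * x) by [].
  by apply: is_derive_eq; rewrite mulrC.
have dc : is_derive (x : R) 1 (fun x : R => cos (t * x)) (- sin (t * x) * t).
  have -> : (fun x : R => cos (t * x)) = cos \o (fun x => t * x) by [].
  by apply: is_derive_eq; rewrite mulrC.
rewrite /prim; apply: is_derive_eq; rewrite /GRing.scale/=; field.
by rewrite d2 gt_eqF.
Qed.

Let prim_cvg e t c : 0 < e -> prim e t c x @[x --> +oo] --> (0 : R).
Proof.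
move=> e0; pose K := `|- 2 / e| + `|2 * c| * (`|t| + `|e|) / `|e ^+ 2 + t ^+ 2|.
have hb x : `|prim e t c x| <= expR (- (e * x)) * K.
  rewrite normrM ger0_norm ?expR_ge0// ler_wpM2l ?expR_ge0//.
  rewrite (le_trans (ler_normD _ _))// lerD// !normrM normfV ler_wpM2r//.
  rewrite ler_wpM2l// (le_trans (ler_normB _ _))// !normrM lerD// ler_piMr//.
    exact: sin_max.
  exact: cos_max.
have h0 : expR (- (e * x)) * K @[x --> +oo] --> (0 : R).
  rewrite -[X in _ --> X](mul0r K); apply: cvgM; last exact: cvg_cst.
  apply: (@cvg_comp _ _ _ (fun x => e * x) (fun y => expR (- y)) _ (pinfty_nbhs R)).
    exact: gt0_cvgMry.
  exact: cvgr_expR.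
have h0N : - (expR (- (e * x)) * K) @[x --> +oo] --> (0 : R).
  by rewrite -oppr0; exact: cvgN.
apply: (squeeze_cvgr _ h0N h0); apply: nearW => x.
by rewrite -ler_norml.
Qed.

Let laplace_cont e t c :
  continuous (fun x : R => expR (- (e * x)) * (2 + 2 * c * cos (t * x))).
Proof.
move=> x; apply: cvgM.
  apply: (continuous_comp (f := fun x => - (e * x))); last exact: continuous_expR.
  by apply: cvgN; apply: cvgM; [exact: cvg_cst|exact: cvg_id].
apply: cvgD; first exact: cvg_cst.
apply: cvgM; first exact: cvg_cst.
apply: (continuous_comp (f := fun x => t * x)); last exact: continuous_cos.
by apply: cvgM; [exact: cvg_cst|exact: cvg_id].
Qed.

(** Adding [1] to the cosine makes the integrand nonnegative, as the fundamental theorem on the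
    half-line requires; [Rintegral_lap_cos] subtracts the contribution of the [1]. *)
Let integral_laplace0 e t s : 0 < e ->
  (\int[mu]_x (lap e x * (1 + cos (t * x + s)))%:E =
   (2 / e + 2 * cos s * poisson e t)%:E)%E.
Proof.
move=> e0; rewrite ge0_integral_fold.
- rewrite -integral_itv_obnd_cbnd; last first.
    apply/measurable_EFinP; apply: measurable_funTS; apply: continuous_measurable_fun.
    have c1 t' : continuous (fun x : R => lap e x * (1 + cos (t' * x + s))).
      move=> x; apply: cvgM; first exact: continuous_lap.
      by apply: cvgD; [exact: cvg_cst|exact: continuous_cos_affine].
    rewrite (_ : (fun _ => _) = (fun x : R => lap e x * (1 + cos (t * x + s)) +
        lap e x * (1 + cos (- t * x + s)))); last first.
      by apply/funext => x; rewrite /lap normrN mulrN mulNr.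
    by move=> x; apply: cvgD; exact: c1.
  transitivity (\int[mu]_(x in `]0%R, +oo[)
     (expR (- (e * x)) * (2 + 2 * cos s * cos (t * x)))%:E)%E.
    apply: eq_integral => x; rewrite inE/= in_itv/= andbT => x0.
    rewrite /lap normrN (gtr0_norm x0) mulrN [- (t * x) + s]addrC cosB cosD.
    by congr EFin; ring.
  rewrite integral_itv_obnd_cbnd; last first.
    apply/measurable_EFinP; apply: measurable_funTS; apply: continuous_measurable_fun.
    exact: laplace_cont.
  rewrite (@ge0_continuous_FTC2y _ _ (prim e t (cos s)) 0 0).
  + rewrite /prim !mulr0 oppr0 expR0 sin0 cos0 /poisson -EFinN -EFinD; congr EFin.
    by rewrite add0r; field; rewrite ?gt_eqF// ltr_wpDr ?sqr_ge0// exprn_gt0.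
  + by move=> x _; rewrite mulr_ge0 ?expR_ge0.
  + apply: continuous_subspaceT; exact: laplace_cont.
  + exact: prim_cvg.
  + by move=> x _; have [] := prim_derive t (cos s) x e0.
  + have [d0 _] := prim_derive t (cos s) 0 e0.
    by apply: cvg_at_right_filter; apply: differentiable_continuous; exact/derivable1_diffP.
  + move=> x _; rewrite derive1E; have hd := prim_derive t (cos s) x e0.
    exact: derive_val.
- move=> x; apply: cvgM; first exact: continuous_lap.
  by apply: cvgD; [exact: cvg_cst|exact: continuous_cos_affine].
- by move=> x; rewrite mulr_ge0 ?lap_ge0.
Qed.

Lemma integral_lap e : 0 < e -> (\int[mu]_x (lap e x)%:E = (2 / e)%:E)%E.
Proof.
(* With [t = 0] and [s = pi / 2] the cosine vanishes and [lap] remains alone. *)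
move=> e0; have := @integral_laplace0 e 0 (pi / 2) e0.
rewrite cos_pihalf mulr0 mul0r addr0 => <-; apply: eq_integral => x _.
by rewrite mul0r add0r cos_pihalf addr0 mulr1.
Qed.

Lemma integrable_lap e : 0 < e -> mu.-integrable setT (fun x => (lap e x)%:E).
Proof.
move=> e0; apply: integrable_ge0 (integral_lap e0); last exact: lap_ge0.
by apply: continuous_measurable_fun; exact: continuous_lap.
Qed.

Lemma measurable_lap e : measurable_fun setT (lap e).
Proof. by apply: continuous_measurable_fun; exact: continuous_lap. Qed.

(** The phase [s] lets one formula give both parts of the transform: [s = 0] is the real part and
    [s = - pi / 2] the imaginary part. *)
Lemma Rintegral_lap_cos e t s : 0 < e ->
  \int[mu]_x (lap e x * cos (t * x + s)) = 2 * cos s * poisson e t.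
Proof.
move=> e0.
have il := integrable_lap e0.
have ic : mu.-integrable setT (fun x => (lap e x * cos (t * x + s))%:E).
  apply: integrable_dom il _.
    apply: measurable_funM; first exact: measurable_lap.
    by apply: continuous_measurable_fun; exact: continuous_cos_affine.
  by move=> x; rewrite normrM (ger0_norm (lap_ge0 _ _)) ler_piMr ?lap_ge0// cos_max.
have := integral_laplace0 t s e0 => /(congr1 fine) /=.
rewrite -/(Rintegral _ _ _).
under eq_Rintegral do rewrite mulrDr mulr1.
rewrite RintegralD// {1}/Rintegral integral_lap//= => /addrI //.
Qed.

Lemma cintg_lap e t : 0 < e ->
  cintg mu (fun x => (lap e x)%:C * expi (t * x)) = (2 * poisson e t)%:C.
Proof.
move=> e0; apply: complex_eq => /=.
  under eq_Rintegral do rewrite mul0r subr0 -[t * _]addr0.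
  by rewrite Rintegral_lap_cos// cos0 mulr1.
under eq_Rintegral do rewrite mul0r addr0 -cosBpihalf.
by rewrite Rintegral_lap_cos// cosN cos_pihalf mulr0 mul0r.
Qed.

End poisson_transform.

(** * Integrals of tensor products *)

Section tensor.
Context d1 d2 (T1 : measurableType d1) (T2 : measurableType d2) {R : realType}.
Variables (m1 : {sigma_finite_measure set T1 -> \bar R})
          (m2 : {sigma_finite_measure set T2 -> \bar R}).

Lemma Rintegral_tensor (g1 : T1 -> R) (g2 : T2 -> R) :
  m1.-integrable setT (fun x => (g1 x)%:E) -> m2.-integrable setT (fun x => (g2 x)%:E) ->
  \int[(m1 \x m2)%E]_z (g1 z.1 * g2 z.2) = (\int[m1]_x g1 x) * (\int[m2]_x g2 x).
Proof.
move=> i1 i2.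
have mg1 : measurable_fun setT g1 by exact/measurable_EFinP/(measurable_int _ i1).
have mg2 : measurable_fun setT g2 by exact/measurable_EFinP/(measurable_int _ i2).
have mh : measurable_fun setT (fun z : T1 * T2 => g1 z.1 * g2 z.2).
  by apply: measurable_funM; apply: measurableT_comp.
have := Rfubini mh (integrable_abse i1) (integrable_abse i2).
case=> [x y|-> _]; first by rewrite normrM.
under eq_Rintegral do rewrite /= RintegralZl//.
by rewrite RintegralZr.
Qed.

Lemma cintg_tensor (f1 : T1 -> R[i]) (f2 : T2 -> R[i]) :
  cinteg m1 f1 -> cinteg m2 f2 ->
  cintg (m1 \x m2)%E (fun z => f1 z.1 * f2 z.2) = cintg m1 f1 * cintg m2 f2.
Proof.
move=> i1 i2.
have mg1 := cinteg_meas i1; have mg2 := cinteg_meas i2.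
have mh : cmeasurable (fun z : T1 * T2 => f1 z.1 * f2 z.2).
  apply: cmeasurableM; split.
  - by case: mg1 => h _; exact: (measurableT_comp h).
  - by case: mg1 => _ h; exact: (measurableT_comp h).
  - by case: mg2 => h _; exact: (measurableT_comp h).
  - by case: mg2 => _ h; exact: (measurableT_comp h).
have := cfubini mh (cinteg_cabs i1) (cinteg_cabs i2).
case=> [x y|-> _]; first by rewrite cabsM.
under eq_cintg do rewrite /= cintgZ// mulrC.
by rewrite cintgZ// mulrC.
Qed.

End tensor.

(** * Sigma-finiteness of the plane Lebesgue measure *)

Section product_lebesgue.
Variable R : realType.
Local Notation mu := (@lebesgue_measure R).

(* A named copy of the product measure, on which sigma-finiteness can be declared. *)
Definition plebesgue : set (measurableTypeR R * measurableTypeR R)%type -> \bar R := leb2 R.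
HB.instance Definition _ := Measure.copy plebesgue (leb2 R).

Lemma plebesgue_sigma_finite : sigma_finite setT plebesgue.
Proof.
have /sigma_finiteP[F [TF ndF Foo]] := sigma_finiteT mu.
exists (fun n => F n `*` F n).
 rewrite -setXTT TF predeqE => -[x y]; split.
    move=> [/= [n _ Fnx] [k _ Gky]]; exists (maxn n k) => //; split.
    - by move: x Fnx; exact/subsetPset/ndF/leq_maxl.
    - by move: y Gky; exact/subsetPset/ndF/leq_maxr.
  by move=> [n _ []/= ? ?]; split; exists n.
move=> k; have [? ?] := Foo k.
split; first exact: measurableX.
have -> : plebesgue (F k `*` F k) = (mu (F k) * mu (F k))%E by exact: product_measure1E.
by rewrite lte_mul_pinfty// ge0_fin_numE.
Qed.

HB.instance Definition _ := Measure_isSigmaFinite.Build _ _ _ plebesgue plebesgue_sigma_finite.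

End product_lebesgue.
Arguments plebesgue R : clear implicits.

(** * Fourier inversion in the plane *)

Section fourier_inversion.
Context {R : realType}.
Local Notation mu := (@lebesgue_measure R).
Local Notation leb := (leb2 R).

Definition dotp (x y : R * R) : R := x.1 * y.1 + x.2 * y.2.

Definition lapD (e : R) (x : R * R) : R := lap e x.1 * lap e x.2.

Lemma measurable_dotp (y : R * R) (s : R) :
  measurable_fun setT (fun x : R * R => s * dotp x y).
Proof.
apply: measurable_funM => //; apply: measurable_funD; apply: measurable_funM => //.
Qed.

Lemma poisson_sgn (s e t : R) : s ^+ 2 = 1 -> poisson e (s * t) = poisson e t.
Proof. by move=> s2; rewrite /poisson exprMn s2 mul1r. Qed.

(** The condition [s ^+ 2 = 1] encodes a sign. Both are used: [s = 1] for the transform of a kernel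
    and [s = -1] for convolution with it. The Poisson kernel is even and does not see the sign. *)
Let kernel_lap (s e : R) (t : R * R) : s ^+ 2 = 1 -> 0 < e ->
  cint (fun x => (lapD e x)%:C * expi (s * dotp x t)) =
  (4 * (poisson e t.1 * poisson e t.2))%:C.
Proof.
move=> s2 e0.
have -> : (fun x => (lapD e x)%:C * expi (s * dotp x t)) =
  (fun x : R * R => ((lap e x.1)%:C * expi (s * t.1 * x.1)) *
                    ((lap e x.2)%:C * expi (s * t.2 * x.2))).
  apply/funext => x; rewrite mulrACA -expiD -rmorphM/=; congr (_ * expi _).
  by rewrite /dotp; ring.
have il u : cinteg mu (fun x => (lap e x)%:C * expi (u * x)).
  apply: cinteg_dom (integrable_lap e0) _.
    apply: cmeasurableM; first by apply: cmeasurable_real; exact: measurable_lap.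
    by apply: cmeasurable_expi; exact: measurable_funM.
  by move=> x; rewrite cabsM cabs_expi mulr1 cabs_real ger0_norm// lap_ge0.
rewrite [LHS](cintg_tensor (il _) (il _)) !cintg_lap// -rmorphM/=.
by rewrite !poisson_sgn//; congr (_%:C); ring.
Qed.

Lemma integrable_poisson2 (e : R) (y : R * R) : 0 < e ->
  leb.-integrable setT
    (fun x : R * R => (poisson e (x.1 - y.1) * poisson e (x.2 - y.2))%:E).
Proof.
move=> e0; exact: (integrable_tensor (integrable_poisson y.1 e0) (integrable_poisson y.2 e0)).
Qed.

Lemma Rintegral_poisson (e c : R) : 0 < e -> \int[mu]_x poisson e (x - c) = pi.
Proof. by move=> e0; rewrite /Rintegral integral_poisson. Qed.

Lemma Rintegral_poisson2 (e : R) (y : R * R) : 0 < e ->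
  \int[leb]_x (poisson e (x.1 - y.1) * poisson e (x.2 - y.2)) = pi ^+ 2.
Proof.
move=> e0; rewrite (Rintegral_tensor (integrable_poisson y.1 e0) (integrable_poisson y.2 e0)).
by rewrite !Rintegral_poisson// expr2.
Qed.

(** Away from [0], the kernel of width [e] is a small multiple of the kernel of width [1]: if
    [dl <= |t|], then [1 + t ^+ 2 <= (1 + dl ^- 2) * t ^+ 2]. *)
Lemma poisson_tail (e dl t : R) : 0 < e -> 0 < dl -> dl <= `|t| ->
  poisson e t <= e * (1 + dl ^- 2) * poisson 1 t.
Proof.
move=> e0 dl0 dt; rewrite /poisson expr1n mul1r -mulrA ler_pM2l//.
have d2 : dl ^+ 2 <= t ^+ 2.
  by rewrite -(real_normK (num_real t)) lerXn2r// ?nnegrE// ltW.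
have d20 : 0 < dl ^+ 2 by rewrite exprn_gt0.
have t0 : 0 < t ^+ 2 by exact: lt_le_trans d2.
have e20 : 0 < e ^+ 2 by rewrite exprn_gt0.
rewrite ler_pdivlMr; last by lra.
rewrite ler_pdivrMl; last by lra.
rewrite mulrDr mulr1; apply: (@le_trans _ _ (t ^+ 2 + t ^+ 2 / dl ^+ 2)).
  by rewrite addrC lerD2l ler_pdivlMr// mul1r.
by rewrite lerD ?lerDr ?(ltW e20)// ler_pM2r ?invr_gt0// lerDr ltW.
Qed.

(** Abel regularization: [lapD e] supplies the integrability in [x] that Fubini requires, and
    integrating in [x] first turns the exponentials into Poisson kernels centred at [eta]. *)
Lemma kernel_expand (psi : R * R -> R[i]) (g : R * R -> R) (s e : R) (eta : R * R) :
  s ^+ 2 = 1 -> 0 < e -> cmeasurable psi ->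
  leb.-integrable setT (fun x => (g x)%:E) -> (forall x, cabs (psi x) <= g x) ->
  cint (fun x => (lapD e x)%:C *
    (cint (fun xi => psi xi * expi (s * dotp x xi)) * expi (- s * dotp x eta))) =
  cint (fun xi => psi xi *
    (4 * (poisson e (xi.1 - eta.1) * poisson e (xi.2 - eta.2)))%:C).
Proof.
move=> s2 e0 mpsi ig psig.
have mlapD : measurable_fun setT (lapD e).
  by apply: measurable_funM; apply: measurableT_comp => //; exact: measurable_lap.
have ilapD : leb.-integrable setT (fun x => (lapD e x)%:E).
  exact: integrable_tensor (integrable_lap e0) (integrable_lap e0).
have lapD0 x : 0 <= lapD e x by rewrite mulr_ge0// lap_ge0.
pose F (z : (R * R) * (R * R)) : R[i] :=
  (lapD e z.1)%:C * (psi z.2 * expi (s * dotp z.1 z.2) * expi (- s * dotp z.1 eta)).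
have mF : cmeasurable F.
  apply: cmeasurableM.
    by apply: cmeasurable_real; exact: (measurableT_comp mlapD).
  apply: cmeasurableM; first apply: cmeasurableM.
  - by case: mpsi => m1 m2; split; [exact: (measurableT_comp m1)|exact: (measurableT_comp m2)].
  - apply: cmeasurable_expi; apply: measurable_funM => //.
    by apply: measurable_funD; apply: measurable_funM;
      apply: measurableT_comp => //; exact: measurableT_comp.
  - apply: cmeasurable_expi.
    exact: (measurableT_comp (measurable_dotp eta (- s))).
have [] := @cfubini _ _ _ _ R (plebesgue R) (plebesgue R) F (lapD e) g mF ilapD ig.
  move=> x xi; rewrite !cabsM !cabs_expi !mulr1 cabs_real ger0_norm//.
  by rewrite ler_wpM2l.
move=> -> Fub.
have ipsi (x : R * R) : cinteg leb (fun xi => psi xi * expi (s * dotp x xi)).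
  apply: cinteg_dom ig _.
    apply: cmeasurableM; first exact: mpsi.
    apply: cmeasurable_expi.
    have <- : (fun xi => s * dotp xi x) = (fun xi => s * dotp x xi).
      by apply/funext => xi; rewrite /dotp; ring.
    exact: measurable_dotp.
  by move=> xi; rewrite cabsM cabs_expi mulr1.
transitivity (cintg leb (fun x => cintg leb (fun y => F (x, y)))).
  apply: eq_cintg => x.
  transitivity (cintg leb (fun xi => ((lapD e x)%:C * expi (- s * dotp x eta)) *
      (psi xi * expi (s * dotp x xi)))); last first.
    by apply: eq_cintg => xi; rewrite /F/=; ring.
  rewrite (cintgZ _ (ipsi x)) [in LHS]mulrC -mulrA mulrC.
  by congr (_ * _); rewrite mulrC.
rewrite Fub; apply: eq_cintg => xi.
rewrite -(kernel_lap (xi.1 - eta.1, xi.2 - eta.2) s2 e0)/= -[RHS]cintgZ.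
  apply: eq_cintg => x; rewrite /F/=.
  rewrite -mulrA -expiD mulrCA; congr (_ * (_ * expi _)).
  by rewrite /dotp/=; ring.
apply: cinteg_dom ilapD _.
  apply: cmeasurableM; first exact: cmeasurable_real.
  by apply: cmeasurable_expi; exact: measurable_dotp.
by move=> x; rewrite cabsM cabs_expi mulr1 cabs_real ger0_norm.
Qed.

End fourier_inversion.

Section fourier_inversion_theorem.
Context {R : realType}.
Local Notation mu := (@lebesgue_measure R).
Local Notation leb := (leb2 R).

(** Continuity at [eta] tested on squares, to match the splitting of the Poisson kernels into tails
    coordinate by coordinate. *)
Definition cnear (psi : R * R -> R[i]) (eta : R * R) : Prop :=
  forall om : R, 0 < om -> exists2 dl : R, 0 < dl & forall xi : R * R,
    `|xi.1 - eta.1| < dl -> `|xi.2 - eta.2| < dl -> cabs (psi xi - psi eta) <= om.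

Let eps (n : nat) : R := n.+1%:R^-1.

Let eps_gt0 n : 0 < eps n.
Proof. by rewrite invr_gt0. Qed.

Let eps_cvg : eps n @[n --> \oo] --> (0 : R).
Proof. exact: cvg_harmonic. Qed.

Let lap_cvg (x : R) : lap (eps n) x @[n --> \oo] --> (1 : R).
Proof.
have h : - (eps n * `|x|) @[n --> \oo] --> (0 : R).
  rewrite -oppr0 -(mul0r `|x|).
  by apply: cvgN; apply: cvgM; [exact: eps_cvg|exact: cvg_cst].
by rewrite -(@expR0 R); exact: (cvg_comp _ _ h (@continuous_expR R 0)).
Qed.

(* The average of [psi] against a product of Poisson kernels concentrates at [eta]:
   away from [eta] the kernel is dominated by [e * C] times a fixed one. *)
Lemma poisson_concentration (psi : R * R -> R[i]) (B : R) (eta : R * R) :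
  cmeasurable psi -> (forall x, cabs (psi x) <= B) -> cnear psi eta ->
  cabs (cint (fun xi => psi xi * (4 * (poisson (eps n) (xi.1 - eta.1) *
                                       poisson (eps n) (xi.2 - eta.2)))%:C)
        - (4 * pi ^+ 2)%:C * psi eta) @[n --> \oo] --> (0 : R).
Proof.
move=> mpsi psiB psic; apply/cvgrPdist_le => om om0.
(* With the factor [2] of [cabs_cintg_le], the part near [eta] costs
   [2 * (4 * om' * pi ^+ 2) = om / 2]; the two tails cost [32 * B * C * pi ^+ 2 * e], the other
   half. *)
pose om' := om / (16 * pi ^+ 2).
have pi20 : 0 < (pi : R) ^+ 2 by rewrite exprn_gt0// pi_gt0.
have om'0 : 0 < om' by rewrite divr_gt0// mulr_gt0.
have [dl dl0 dlP] := psic _ om'0.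
have B0 : 0 <= B by exact: le_trans (cabs_ge0 _) (psiB 0).
pose C := 1 + dl ^- 2.
have C0 : 0 <= C by rewrite addr_ge0// invr_ge0 exprn_ge0// ltW.
have : 32 * B * C * pi ^+ 2 * eps n @[n --> \oo] --> (0 : R).
  by rewrite -[X in _ --> X](mulr0 (32 * B * C * pi ^+ 2)); apply: cvgM; [exact: cvg_cst|exact: eps_cvg].
have om20 : 0 < om / 2 by rewrite divr_gt0.
move=> /cvgrPdist_le/(_ _ om20); apply: filterS => n.
rewrite !sub0r !normrN (ger0_norm (cabs_ge0 _)) => hn.
set e := eps n in hn *; have e0 : 0 < e by exact: eps_gt0.
have {hn} hn : 32 * B * C * pi ^+ 2 * e <= om / 2.
  by apply: le_trans hn; exact: ler_norm.
pose pp x := poisson e (x.1 - eta.1) * poisson e (x.2 - eta.2).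
have ipp : leb.-integrable setT (fun x => (pp x)%:E) by exact: integrable_poisson2.
have pp0 x : 0 <= pp x by rewrite mulr_ge0// poisson_ge0.
have mpp : measurable_fun setT pp.
  by apply: measurable_funM; [apply: (measurableT_comp (measurable_poisson eta.1 e0))|
    apply: (measurableT_comp (measurable_poisson eta.2 e0))].
have m4 : cmeasurable (fun x : R * R => (4 * pp x)%:C).
  by apply: cmeasurable_real; apply: measurable_funM; [exact: measurable_cst|exact: mpp].
have pp40 x : 0 <= 4 * pp x by rewrite mulr_ge0.
have icst : cinteg leb (fun x => psi eta * (4 * pp x)%:C).
  apply: cintegZ; apply: cinteg_dom (integrable_scale 4 ipp) _.
    exact: m4.
  by move=> x; rewrite cabs_real (ger0_norm (pp40 x)).
have ipsi : cinteg leb (fun x => psi x * (4 * pp x)%:C).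
  apply: cinteg_dom (integrable_scale (B * 4) ipp) _.
    exact: cmeasurableM.
  move=> x; rewrite cabsM cabs_real (ger0_norm (pp40 x)) -mulrA.
  by rewrite ler_wpM2r.
rewrite [X in _ - X](_ : _ = cint (fun x => psi eta * (4 * pp x)%:C)); last first.
  rewrite [RHS]cintgZ; last first.
    apply: cinteg_dom (integrable_scale 4 ipp) _.
      exact: m4.
    by move=> x; rewrite cabs_real (ger0_norm (pp40 x)).
  rewrite mulrC; congr (_ * _); rewrite /cintg; apply: complex_eq => /=.
    by rewrite RintegralZl// Rintegral_poisson2.
  by rewrite /Rintegral integral0.
have -> : cint (fun x => psi x * (4 * pp x)%:C) - cint (fun x => psi eta * (4 * pp x)%:C)
    = cint (fun x => (psi x - psi eta) * (4 * pp x)%:C).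
  rewrite -mulN1r -[-1 * _]cintgZ// -[LHS]cintgD//; last exact: cintegZ.
  by apply: eq_cintg => x; ring.
(* [q1] and [q2] keep one kernel at width [1]: they majorize the tails in the first and in the
   second coordinate. *)
pose q1 x := poisson 1 (x.1 - eta.1) * poisson e (x.2 - eta.2).
pose q2 x := poisson e (x.1 - eta.1) * poisson 1 (x.2 - eta.2).
have iq1 : leb.-integrable setT (fun x => (q1 x)%:E).
  exact: (integrable_tensor (integrable_poisson _ ltr01) (integrable_poisson _ e0)).
have iq2 : leb.-integrable setT (fun x => (q2 x)%:E).
  exact: (integrable_tensor (integrable_poisson _ e0) (integrable_poisson _ ltr01)).
have hq1 : \int[leb]_x q1 x = pi ^+ 2.
  rewrite (Rintegral_tensor (integrable_poisson eta.1 ltr01) (integrable_poisson eta.2 e0)).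
  by rewrite !Rintegral_poisson// expr2.
have hq2 : \int[leb]_x q2 x = pi ^+ 2.
  rewrite (Rintegral_tensor (integrable_poisson eta.1 e0) (integrable_poisson eta.2 ltr01)).
  by rewrite !Rintegral_poisson// expr2.
pose G x := 4 * om' * pp x + (8 * B * (e * C) * q1 x + 8 * B * (e * C) * q2 x).
have iq12 : leb.-integrable setT
    (fun x => (8 * B * (e * C) * q1 x + 8 * B * (e * C) * q2 x)%:E).
  under eq_fun do rewrite EFinD.
  by apply: integrableD => //; exact: integrable_scale.
have iG : leb.-integrable setT (fun x => (G x)%:E).
  under eq_fun do rewrite /G EFinD.
  by apply: integrableD => //; exact: integrable_scale.
have Gb x : cabs ((psi x - psi eta) * (4 * pp x)%:C) <= G x.
  rewrite cabsM cabs_real (ger0_norm (pp40 x)).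
  have k0 : 0 <= 8 * B * (e * C) by rewrite !mulr_ge0// ltW.
  have q10 : 0 <= 8 * B * (e * C) * q1 x.
    exact: mulr_ge0 k0 (mulr_ge0 (poisson_ge0 _ ltr01) (poisson_ge0 _ e0)).
  have q20 : 0 <= 8 * B * (e * C) * q2 x.
    exact: mulr_ge0 k0 (mulr_ge0 (poisson_ge0 _ e0) (poisson_ge0 _ ltr01)).
  have p0 : 0 <= 4 * om' * pp x by apply: mulr_ge0 => //; rewrite mulr_ge0// ltW.
  have psi2 : cabs (psi x - psi eta) <= 2 * B.
    by rewrite (le_trans (cabsD _ _))// cabsN mulr_natl mulr2n lerD.
  have [d1|d1] := ltP `|x.1 - eta.1| dl; last first.
    rewrite /G addrCA (@le_trans _ _ (8 * B * (e * C) * q1 x))//; last first.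
      by rewrite lerDl addr_ge0.
    have := poisson_tail e0 dl0 d1; rewrite -/C => pt.
    rewrite (@le_trans _ _ (2 * B * (4 * (e * C * poisson 1 (x.1 - eta.1) * poisson e (x.2 - eta.2)))))//.
      by rewrite ler_pM ?cabs_ge0// ler_wpM2l// ler_wpM2r// poisson_ge0.
    by rewrite /q1 le_eqVlt; apply/orP; left; apply/eqP; ring.
  have [d2|d2] := ltP `|x.2 - eta.2| dl; last first.
    rewrite /G addrA addrC (@le_trans _ _ (8 * B * (e * C) * q2 x))//; last first.
      by rewrite lerDl addr_ge0.
    have := poisson_tail e0 dl0 d2; rewrite -/C => pt.
    rewrite (@le_trans _ _ (2 * B * (4 * (poisson e (x.1 - eta.1) * (e * C * poisson 1 (x.2 - eta.2))))))//.
      by rewrite ler_pM ?cabs_ge0// ler_wpM2l// ler_wpM2l// poisson_ge0.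
    by rewrite /q2 le_eqVlt; apply/orP; left; apply/eqP; ring.
  rewrite (@le_trans _ _ (om' * (4 * pp x)))//.
    by rewrite ler_wpM2r// dlP.
  have -> : om' * (4 * pp x) = 4 * om' * pp x by ring.
  by rewrite /G lerDl addr_ge0.
apply: (le_trans (cabs_cintg_le _ iG Gb)).
  apply: cinteg_dom iG Gb; apply: cmeasurableM.
    by apply: cmeasurableD; [exact: mpsi|exact: cmeasurable_cst].
  exact: m4.
rewrite /G RintegralD//; last exact: integrable_scale.
rewrite RintegralD//; [|exact: integrable_scale|exact: integrable_scale].
rewrite !RintegralZl// Rintegral_poisson2//.
rewrite hq1 hq2.
have -> : 4 * om' * pi ^+ 2 = om / 4.
  have pn : (pi : R) != 0 by rewrite gt_eqF// pi_gt0.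
  have key (P : R) : P != 0 -> 4 * (om / (16 * P ^+ 2)) * P ^+ 2 = om / 4.
    by move=> P0; field; rewrite P0.
  exact: key.
by move: hn; move: (pi ^+ 2) => P hn; rewrite -/C in hn *; move: (C) hn => Q; nra.
Qed.

(** Both sides are limits of the two sides of [kernel_expand] as [e] tends to [0]: the transform
    side by dominated convergence under [gJ], the Poisson side by concentration at [eta]. *)
Theorem fourier_inversion (psi : R * R -> R[i]) (B : R) (g gJ : R * R -> R) (s : R)
    (eta : R * R) : s ^+ 2 = 1 -> cmeasurable psi -> (forall x, cabs (psi x) <= B) ->
  leb.-integrable setT (fun x => (g x)%:E) -> (forall x, cabs (psi x) <= g x) ->
  cnear psi eta ->
  cmeasurable (fun x => cint (fun xi => psi xi * expi (s * dotp x xi))) ->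
  leb.-integrable setT (fun x => (gJ x)%:E) ->
  (forall x, cabs (cint (fun xi => psi xi * expi (s * dotp x xi))) <= gJ x) ->
  cint (fun x => cint (fun xi => psi xi * expi (s * dotp x xi)) * expi (- s * dotp x eta))
  = (4 * pi ^+ 2)%:C * psi eta.
Proof.
move=> s2 mpsi psiB ig psig psic; set J := fun x => cint _ => mJ igJ JgJ.
set L := cint _.
have cB := poisson_concentration mpsi psiB psic.
pose f_ n x : R[i] := (lapD (eps n) x)%:C * (J x * expi (- s * dotp x eta)).
have mJe : cmeasurable (fun x => J x * expi (- s * dotp x eta)).
  apply: cmeasurableM; first exact: mJ.
  by apply: cmeasurable_expi; exact: measurable_dotp.
have mf n : cmeasurable (f_ n).
  apply: cmeasurableM; last exact: mJe.
  apply: cmeasurable_real; apply: measurable_funM; apply: measurableT_comp => //.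
    exact: measurable_lap.
  exact: measurable_lap.
have lapD_cvg (x : R * R) : lapD (eps n) x @[n --> \oo] --> (1 : R).
  by rewrite -(mulr1 1); apply: cvgM; exact: lap_cvg.
have lapD1 n (x : R * R) : 0 <= lapD (eps n) x <= 1.
  rewrite mulr_ge0 ?lap_ge0//= mulr_ile1 ?lap_ge0//.
    by rewrite /lap -[leRHS]expR0 ler_expR oppr_le0 mulr_ge0// ltW.
  by rewrite /lap -[leRHS]expR0 ler_expR oppr_le0 mulr_ge0// ltW.
have cA : cabs (cintg leb (f_ n) - cintg leb (fun x => J x * expi (- s * dotp x eta)))
    @[n --> \oo] --> (0 : R).
  apply: (@cintg_cvg _ _ R leb f_ _ gJ mf mJe _ igJ _).
  - move=> x; set K := cabs (J x * expi (- s * dotp x eta)).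
    have h : `|lapD (eps n) x - 1| * K @[n --> \oo] --> (0 : R).
      rewrite -(mul0r K) -(normr0 R) -(subrr (1 : R)).
      apply: cvgM; last exact: cvg_cst.
      by apply: cvg_norm; apply: cvgB; [exact: lapD_cvg|exact: cvg_cst].
    apply: cvg_trans h; apply: near_eq_cvg; apply: nearW => n.
    rewrite /f_ -{2}[J x * _]mul1r -mulrBl cabsM; congr (_ * _).
    by rewrite -(rmorph1 (real_complex R)) -rmorphB/= cabs_real.
  - move=> n x; have /andP[h0 h1] := lapD1 n x.
    rewrite !cabsM cabs_expi mulr1 cabs_real ger0_norm//.
    by rewrite (le_trans _ (JgJ x))// ler_piMl ?cabs_ge0.
apply/eqP; rewrite -subr_eq0; apply/eqP/cabs_eq0/eqP; rewrite eq_le cabs_ge0 andbT.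
apply/ler_addgt0Pr => om om0; rewrite add0r.
have om20 : 0 < om / 2 by rewrite divr_gt0.
have [n [hA hB]] : exists n : nat,
   cabs (cintg leb (f_ n) - cintg leb (fun x => J x * expi (- s * dotp x eta))) <= om / 2 /\
   cabs (cint (fun xi => psi xi * (4 * (poisson (eps n) (xi.1 - eta.1) *
                                       poisson (eps n) (xi.2 - eta.2)))%:C)
        - (4 * pi ^+ 2)%:C * psi eta) <= om / 2.
  have /cvgrPdist_le/(_ _ om20) h1 := cA; have /cvgrPdist_le/(_ _ om20) h2 := cB.
  have [n _ /(_ n (leqnn n)) [i1 i2]] := filterI h1 h2; exists n.
  by move: i1 i2; rewrite !sub0r !normrN !ger0_norm ?cabs_ge0.
have eA : cintg leb (f_ n) = cint (fun xi => psi xi *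
   (4 * (poisson (eps n) (xi.1 - eta.1) * poisson (eps n) (xi.2 - eta.2)))%:C).
  exact: kernel_expand s2 (eps_gt0 n) mpsi ig psig.
rewrite eA in hA.
rewrite (splitr om) (le_trans _ (lerD hA hB))// -[leLHS]cabsN.
set A := cint _ in hA hB *.
have -> : - (L - (4 * pi ^+ 2)%:C * psi eta) = (A - L) + - (A - (4 * pi ^+ 2)%:C * psi eta).
  by ring.
by rewrite (le_trans (cabsD _ _))// cabsN.
Qed.

End fourier_inversion_theorem.

(** * Borel measurability in the plane *)

Section continuous_measurable_plane.
Context {R : realType}.

(** An open set is the union of the countably many rational boxes that it contains, and boxes belong
    to the product sigma-algebra. A box that is not contained in [U] is replaced by the empty
    set. *)
Lemma open_measurable_plane (U : set (R * R)) : open U -> measurable U.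
Proof.
move=> oU.
pose box (q1 q2 : rat) (n : nat) : set (R * R) :=
  ball (ratr q1 : R) n.+1%:R^-1 `*` ball (ratr q2 : R) n.+1%:R^-1.
pose bx q1 q2 n := if `[< box q1 q2 n `<=` U >] then box q1 q2 n else set0.
have -> : U = \bigcup_(q1 : rat) \bigcup_(q2 : rat) \bigcup_n bx q1 q2 n.
  apply/seteqP; split=> [x Ux|x [q1 _ [q2 _ [n _]]]]; last first.
    by rewrite /bx; case: asboolP => // h /h.
  have /nbhs_ballP[e /= e0 eU] : nbhs x U by exact: open_nbhs_nbhs.
  have [n ne] : exists n, 2 * n.+1%:R^-1 < e.
    have e20 : 0 < e / 2 by rewrite divr_gt0.
    have [n _ /(_ n (leqnn n)) /= h] := near_infty_natSinv_lt (PosNum e20).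
    by exists n; rewrite mulrC -ltr_pdivlMr.
  have n0 : 0 < (n.+1%:R^-1 : R) by rewrite invr_gt0.
  have lt1 (u : R) : u - n.+1%:R^-1 < u + n.+1%:R^-1.
    by rewrite ltrBlDr -addrA ltrDl addr_gt0.
  have [q1] := rat_in_itvoo (lt1 x.1).
  rewrite in_itv/= => q1x.
  have [q2] := rat_in_itvoo (lt1 x.2).
  rewrite in_itv/= => q2x.
  have b1 : ball (ratr q1 : R) n.+1%:R^-1 x.1.
    by rewrite /ball/= ltr_distl.
  have b2 : ball (ratr q2 : R) n.+1%:R^-1 x.2.
    by rewrite /ball/= ltr_distl.
  exists q1 => //; exists q2 => //; exists n => //.
  rewrite /bx; case: asboolP => [_//|]; case.
  move=> y [/= y1 y2]; apply: eU; move: y1 y2 b1 b2; rewrite /ball/= => y1 y2 b1 b2.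
  split; apply: le_lt_trans ne; rewrite mulr_natl mulr2n.
    rewrite -(subrKA (ratr q1)) (le_trans (ler_normD _ _))// lerD// ltW//.
    by rewrite distrC.
  rewrite -(subrKA (ratr q2)) (le_trans (ler_normD _ _))// lerD// ltW//.
  by rewrite distrC.
apply: bigcupT_measurable_rat => q1; apply: bigcupT_measurable_rat => q2.
apply: bigcupT_measurable => n; rewrite /bx; case: asboolP => // _.
by apply: measurableX; exact: measurable_ball.
Qed.

Lemma continuous_measurable_plane (f : R * R -> R) : continuous f ->
  measurable_fun setT f.
Proof.
move=> /continuousP cf; apply: (measurability _ (RGenOpens.measurableE R)).
move=> _ [_ [a [b ->] <-]]; rewrite setTI; apply: open_measurable_plane.
exact/cf/interval_open.
Qed.

End continuous_measurable_plane.

(** * Criteria for directional derivatives and continuity *)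

Section partial_derivatives.
Context {R : realType}.
Implicit Types g h : R * R -> R.

(** Replaces differentiation under an integral or a series: a quadratic remainder passes through
    integrals and sums by norm estimates alone. *)
Lemma is_derive_quad g (x v : R * R) (d C : R) :
  (forall t : R, `|g (t *: v + x) - g x - t * d| <= C * t ^+ 2) -> is_derive x v g d.
Proof.
move=> gq; have C0 : 0 <= C by have := le_trans (normr_ge0 _) (gq 1); rewrite expr1n mulr1.
have cvgd : (t^-1 *: (g (t *: v + x) - g x)) @[t --> (0 : R)^'] --> d.
  apply/cvgrPdist_le => e e0; near=> t.
  have t0 : t != 0 by near: t; exact: nbhs_dnbhs_neq.
  have -> : d - t^-1 *: (g (t *: v + x) - g x) = - t^-1 * (g (t *: v + x) - g x - t * d).
    by rewrite /GRing.scale/=; field.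
  rewrite normrM normrN normfV ler_pdivrMl ?normr_gt0//.
  apply: le_trans (gq t) _; rewrite -(real_normK (num_real t)) expr2 mulrA.
  rewrite [leRHS]mulrC ler_wpM2r//.
  have te : `|t| <= e / (C + 1).
    by near: t; apply: dnbhs0_le; rewrite divr_gt0// ltr_wpDl.
  rewrite (le_trans (ler_wpM2l C0 te))// mulrCA -ler_pdivlMl// mulVf ?gt_eqF//.
  by rewrite ler_pdivrMr ?mul1r ?lerDl// ltr_wpDl.
have dv : derivable g x v by apply/cvg_ex; exists d.
by apply: DeriveDef => //; exact/cvg_lim.
Unshelve. all: by end_near. Qed.

Lemma lipschitz_continuous g (C : R) :
  (forall x y, `|g x - g y| <= C * (`|x.1 - y.1| + `|x.2 - y.2|)) -> continuous g.
Proof.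
move=> gl x; apply/cvgrPdist_le => e e0.
have C0 : 0 <= C.
  have := gl (1, 0) (0, 0).
  by rewrite /= subr0 subrr normr0 addr0 normr1 mulr1; apply: le_trans.
have e'0 : 0 < e / (2 * (C + 1)) by rewrite divr_gt0// mulr_gt0// ltr_wpDl.
have : nbhs x (ball x (e / (2 * (C + 1)))) by exact: nbhsx_ballx.
apply: filterS => y [/= b1 b2]; apply: le_trans (gl x y) _.
rewrite (@le_trans _ _ (C * (e / (2 * (C + 1)) + e / (2 * (C + 1)))))//.
  by rewrite ler_wpM2l// lerD// ltW.
have -> : C * (e / (2 * (C + 1)) + e / (2 * (C + 1))) = e * (C / (C + 1)).
  by field; rewrite gt_eqF// ltr_wpDl.
by rewrite -[leRHS]mulr1 ler_wpM2l ?(ltW e0)// ler_pdivrMr ?mul1r ?lerDl// ltr_wpDl.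
Qed.

End partial_derivatives.

(** * The Littlewood-Paley kernels *)

Section cutoff_derivatives.
Context {R : realType}.
Variables (w : R -> R) (hw : cutoff w).

Lemma cutoff_is_derive k (s : R) : is_derive s 1 (derive1n k w) (derive1n k.+1 w s).
Proof.
case: hw => dw _ _ _; apply: DeriveDef; first exact: dw.
by rewrite derive1nS derive1E.
Qed.

Lemma cutoff_cont k : continuous (derive1n k w).
Proof.
by case: hw => dw _ _ _ s; apply: differentiable_continuous; apply/derivable1_diffP; exact: dw.
Qed.

Lemma cutoff_out k (s : R) : s < 2^-1 \/ 2 < s -> derive1n k w s = 0.
Proof.
elim: k s => [|k IH] s sout.
  case: hw => _ _ supp _; apply: contrapT => /eqP ws0.
  have : `[2^-1, 2]%classic s by apply: supp; exact: subset_closure.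
  by rewrite /= in_itv/= => /andP[h1 h2]; case: sout; lra.
have : \forall t \near s, derive1n k w t = 0.
  case: sout => sout.
    have : \forall t \near s, t < 2^-1 by exact: lt_nbhsl.
    by apply: filterS => t ?; apply: IH; left.
  have : \forall t \near s, 2 < t by exact: lt_nbhsr.
  by apply: filterS => t ?; apply: IH; right.
move=> h; rewrite derive1nS derive1E.
rewrite (@near_eq_derive _ _ _ _ (cst 0)) ?derive_cst//.
Qed.

Lemma cutoff_bound k : exists2 M : R, 0 <= M & forall s, `|derive1n k w s| <= M.
Proof.
have c2 : {within `[2^-1, 2], continuous (fun s => `|derive1n k w s|)}.
  apply: continuous_subspaceT => s; apply: cvg_norm; exact: cutoff_cont.
have [|c _ cP] := EVT_max _ c2; first by lra.
exists (`|derive1n k w c|) => // s; have [/andP[h1 h2]|] := boolP (2^-1 <= s <= 2).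
  by apply: cP; rewrite in_itv/= h1 h2.
rewrite negb_and -!ltNge => /orP h; rewrite cutoff_out ?normr0//.
Qed.

End cutoff_derivatives.

(** * Radial cutoffs multiplied by monomials, and their derivatives *)

Section test_class.
Context {R : realType}.
Variables (w : R -> R) (hw : cutoff w) (a : R) (a0 : 0 < a).
Implicit Types (x xi : R * R).

Definition rho xi : R := Num.sqrt (xi.1 ^+ 2 + xi.2 ^+ 2).

(* The span of [xi_1^i xi_2^j |xi|^(-l) w^(k)(a |xi|)]: it contains [w(a |xi|)] and is
   stable under multiplication by the coordinates and under partial derivatives. *)
Inductive tclass : (R * R -> R) -> Prop :=
| tclass_base i j l k : tclass (fun xi => xi.1 ^+ i * xi.2 ^+ j * (rho xi)^-1 ^+ l *
                                          derive1n k w (rho xi * a))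
| tclass_add g h : tclass g -> tclass h -> tclass (fun xi => g xi + h xi)
| tclass_scale c g : tclass g -> tclass (fun xi => c * g xi).

Definition coord (b : bool) xi := if b then xi.2 else xi.1.

Lemma tclass_ext g h : tclass g -> g =1 h -> tclass h.
Proof. by move=> tg /funext <-. Qed.

Lemma tclass_coord b g : tclass g -> tclass (fun xi => coord b xi * g xi).
Proof.
elim=> [i j l k|g1 g2 _ IH1 _ IH2|c g1 _ IH].
- case: b.
    by apply: (tclass_ext (tclass_base i j.+1 l k)) => xi; rewrite /= exprS; ring.
  by apply: (tclass_ext (tclass_base i.+1 j l k)) => xi; rewrite /= exprS; ring.
- by apply: (tclass_ext (tclass_add IH1 IH2)) => xi; rewrite mulrDr.
- by apply: (tclass_ext (tclass_scale c IH)) => xi; rewrite mulrCA.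
Qed.

Lemma rho_ge0 xi : 0 <= rho xi. Proof. exact: sqrtr_ge0. Qed.

Lemma rho_coord b xi : `|coord b xi| <= rho xi.
Proof.
by case: b; rewrite /= -sqrtr_sqr ler_sqrt ?addr_ge0 ?sqr_ge0// ?lerDr ?lerDl sqr_ge0.
Qed.

Lemma tclass_supp g : tclass g -> forall xi, 2 / a < rho xi -> g xi = 0.
Proof.
elim=> [i j l k|g1 g2 _ IH1 _ IH2|c g1 _ IH] xi h.
- by rewrite (cutoff_out hw) ?mulr0//; right; rewrite -ltr_pdivrMr.
- by rewrite IH1// IH2// addr0.
- by rewrite IH// mulr0.
Qed.

Lemma tclass_supp0 g : tclass g -> forall xi, rho xi * a < 2^-1 -> g xi = 0.
Proof.
elim=> [i j l k|g1 g2 _ IH1 _ IH2|c g1 _ IH] xi h.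
- by rewrite (cutoff_out hw) ?mulr0//; left.
- by rewrite IH1// IH2// addr0.
- by rewrite IH// mulr0.
Qed.

(** On the support, [1 / (2 a) <= rho <= 2 / a]; the upper bound controls the monomials, the lower
    one the negative power of [rho]. *)
Lemma tclass_bounded g : tclass g -> exists2 C : R, 0 <= C & forall xi, `|g xi| <= C.
Proof.
elim=> [i j l k|g1 g2 _ [C1 C10 IH1] _ [C2 C20 IH2]|c g1 _ [C C0 IH]].
- have [M M0 wM] := cutoff_bound hw k.
  have K0 : 0 <= 2 / a by rewrite divr_ge0// ltW.
  have a20 : 0 <= 2 * a by rewrite mulr_ge0// ltW.
  exists ((2 / a) ^+ i * (2 / a) ^+ j * (2 * a) ^+ l * M).
    by rewrite !mulr_ge0// exprn_ge0.
  move=> xi; have [h|h] := ltP (2 / a) (rho xi).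
    by rewrite (tclass_supp (tclass_base i j l k))// normr0 !mulr_ge0// exprn_ge0.
  have [h'|h'] := ltP (rho xi * a) 2^-1.
    by rewrite (tclass_supp0 (tclass_base i j l k))// normr0 !mulr_ge0// exprn_ge0.
  have r0 : 0 < rho xi.
    by rewrite -(pmulr_lgt0 _ a0); apply: lt_le_trans h'; rewrite invr_gt0.
  rewrite !normrM !normrX ler_pM ?mulr_ge0 ?exprn_ge0//.
  rewrite ler_pM ?mulr_ge0 ?exprn_ge0//.
    rewrite ler_pM ?exprn_ge0// lerXn2r ?nnegrE//.
      exact: le_trans (rho_coord false xi) h.
    exact: le_trans (rho_coord true xi) h.
  rewrite lerXn2r ?nnegrE// ger0_norm ?invr_ge0 ?(ltW r0)//.
  by rewrite -[leLHS]mul1r ler_pdivrMr// -mulrA [a * _]mulrC; lra.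
- by exists (C1 + C2) => [|xi]; rewrite ?addr_ge0// (le_trans (ler_normD _ _))// lerD.
- by exists (`|c| * C) => [|xi]; rewrite ?mulr_ge0// normrM ler_wpM2l.
Qed.

(** A partial derivative as the derivative of a function of one variable, the form taken by the
    chain rule, the mean value theorem and integration by parts on lines. *)
Definition dslice (b : bool) (g : R * R -> R) xi (d : R) : Prop :=
  is_derive (coord b xi) 1 (fun t => g (if b then (xi.1, t) else (t, xi.2))) d.

Lemma rho_dslice b xi : 0 < rho xi -> dslice b rho xi (coord b xi / rho xi).
Proof.
move=> r0.
have s0 : 0 < xi.1 ^+ 2 + xi.2 ^+ 2 by rewrite -sqrtr_gt0.
have dn (u v : R) : 0 < u ^+ 2 + v ^+ 2 ->
    is_derive u 1 (fun t => Num.sqrt (t ^+ 2 + v ^+ 2)) (u / Num.sqrt (u ^+ 2 + v ^+ 2)).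
  move=> uv.
  have h1 : is_derive u 1 (fun t : R => t ^+ 2 + v ^+ 2) (2 * u).
    by apply: is_derive_eq; rewrite /GRing.scale/=; ring.
  have h2 := is_derive1_sqrt uv.
  have -> : (fun t => Num.sqrt (t ^+ 2 + v ^+ 2)) = Num.sqrt \o (fun t => t ^+ 2 + v ^+ 2) by [].
  apply: is_derive_eq => /=; field.
  by rewrite gt_eqF// sqrtr_gt0.
rewrite /dslice /rho; case: b => /=; last exact: dn.
have -> : (fun t => Num.sqrt (xi.1 ^+ 2 + t ^+ 2)) = (fun t => Num.sqrt (t ^+ 2 + xi.1 ^+ 2)).
  by apply/funext => t; rewrite addrC.
by rewrite [X in _ / Num.sqrt X]addrC; apply: dn; rewrite addrC.
Qed.

Lemma rho_slice_cvg b xi :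
  rho (if b then (xi.1, t) else (t, xi.2)) @[t --> coord b xi] --> rho xi.
Proof.
have h (u v : R) : Num.sqrt (t ^+ 2 + v ^+ 2) @[t --> u] --> Num.sqrt (u ^+ 2 + v ^+ 2).
  apply: (@cvg_comp _ _ _ (fun t => t ^+ 2 + v ^+ 2) Num.sqrt); last exact: sqrt_continuous.
  by apply: cvgD; [exact: exprn_continuous|exact: cvg_cst].
rewrite /rho; case: b => /=; last exact: h.
rewrite [in X in _ --> X]addrC.
have -> : (fun t => Num.sqrt (xi.1 ^+ 2 + t ^+ 2)) = (fun t => Num.sqrt (t ^+ 2 + xi.1 ^+ 2)).
  by apply/funext => t; rewrite addrC.
exact: h.
Qed.

Lemma base_derive (A W r : R -> R) (l : nat) (u A1 r1 W1 : R) :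
  is_derive u 1 A A1 -> is_derive u 1 r r1 -> r u != 0 ->
  is_derive (r u * a) 1 W W1 ->
  is_derive u 1 (fun t => A t * (r t)^-1 ^+ l * W (r t * a))
   (A1 * (r u)^-1 ^+ l * W (r u * a) +
    (- l%:R) * (A u * r1 * (r u)^-1 ^+ l.+1 * W (r u * a)) +
    a * (A u * r1 * (r u)^-1 ^+ l * W1)).
Proof.
move=> dA dr ru dW.
have dV : is_derive u 1 (fun t => (r t)^-1) (- (r u) ^- 2 * r1).
  exact: is_deriveV.
have dVX : is_derive u 1 (fun t => (r t)^-1 ^+ l) (- l%:R * (r1 * (r u)^-1 ^+ l.+1)).
  case: l => [|l].
    by rewrite mulr0n oppr0 mul0r; under eq_fun do rewrite expr0; exact: is_derive_cst.
  have h := @is_deriveX _ _ (fun t => (r t)^-1) l.+1 u 1 _ dV.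
  rewrite (_ : (fun t => _) = (fun t => (r t)^-1) ^+ l.+1); last by rewrite exprfctE.
  have Eh : (l.+1%:R * (r u)^-1 ^+ l.+1.-1) *: (- (r u) ^- 2 * r1) =
      - l.+1%:R * (r1 * (r u)^-1 ^+ l.+2).
    by rewrite /GRing.scale/= -[r u ^- 2]exprVn !exprS !expr0; ring.
  by rewrite -Eh.
have dra : is_derive u 1 (fun t => r t * a) (r1 * a).
  by apply: is_derive_eq; rewrite /GRing.scale/=; ring.
have dWc : is_derive u 1 (fun t => W (r t * a)) (W1 * (r1 * a)).
  have -> : (fun t => W (r t * a)) = W \o (fun t => r t * a) by [].
  by apply: is_derive_eq; rewrite mulrC.
by apply: is_derive_eq; rewrite /GRing.scale/=; ring.
Qed.

Lemma monomial_derive (i : nat) (u v : R) :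
  is_derive u 1 (fun t => t ^+ i * v) (i%:R * (u ^+ i.-1 * v)).
Proof.
have h := @is_deriveX _ _ (@id R) i u 1 1 (is_derive_id _ _).
have hX : is_derive u 1 (fun t : R => t ^+ i) (i%:R * u ^+ i.-1).
  rewrite (_ : (fun t => _) = (@id R) ^+ i); last by rewrite exprfctE.
  by have -> : i%:R * u ^+ i.-1 = (i%:R * id u ^+ i.-1) *: (1 : R)
    by rewrite /GRing.scale/= mulr1.
by apply: is_derive_eq; rewrite /GRing.scale/=; ring.
Qed.

(** Away from the origin, the derivative [coord b / rho] of [rho] keeps each term in the span. At
    the origin [rho] is not differentiable, but the function vanishes in a neighbourhood. *)
Lemma tclass_dslice b g : tclass g ->
  exists2 g', tclass g' & forall xi, dslice b g xi (g' xi).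
Proof.
elim=> [i j l k|g1 g2 _ [h1 t1 d1] _ [h2 t2 d2]|c g1 _ [h1 t1 d1]]; last 2 first.
- exists (fun xi => h1 xi + h2 xi); first exact: tclass_add.
  by move=> xi; have := d1 xi; have := d2 xi; rewrite /dslice => e2 e1; exact: is_deriveD.
- exists (fun xi => c * h1 xi); first exact: tclass_scale.
  move=> xi; have := d1 xi; rewrite /dslice => e1.
  by apply: is_derive_eq; rewrite /GRing.scale.
(* The three terms differentiate the monomial, the power of [rho] and the cutoff. For exponent [0]
   the truncated predecessor is harmless, as its coefficient is [0]. *)
pose g' xi := (if b then j else i)%:R * (xi.1 ^+ (if b then i else i.-1) *
      xi.2 ^+ (if b then j.-1 else j) * (rho xi)^-1 ^+ l * derive1n k w (rho xi * a)) +
    (- l%:R) * (xi.1 ^+ (if b then i else i.+1) * xi.2 ^+ (if b then j.+1 else j) *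
      (rho xi)^-1 ^+ l.+2 * derive1n k w (rho xi * a)) +
    a * (xi.1 ^+ (if b then i else i.+1) * xi.2 ^+ (if b then j.+1 else j) *
      (rho xi)^-1 ^+ l.+1 * derive1n k.+1 w (rho xi * a)).
have tg' : tclass g'.
  apply: tclass_add; first apply: tclass_add; apply: tclass_scale; exact: tclass_base.
exists g' => // xi.
have := rho_ge0 xi; rewrite le_eqVlt => /predU1P[/esym r0|r0]; last first.
  have dr := rho_dslice b r0.
  have dA : is_derive (coord b xi) 1
     (fun t => if b then xi.1 ^+ i * t ^+ j else t ^+ i * xi.2 ^+ j)
     ((if b then j else i)%:R * (xi.1 ^+ (if b then i else i.-1) *
      xi.2 ^+ (if b then j.-1 else j))).
    case: (b); last by have := monomial_derive i xi.1 (xi.2 ^+ j).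
    have := monomial_derive j xi.2 (xi.1 ^+ i).
    rewrite mulrC -mulrA [_ ^+ i * _]mulrC mulrA [_ * j%:R]mulrC.
    by have -> : (fun t => t ^+ j * xi.1 ^+ i) = (fun t => xi.1 ^+ i * t ^+ j)
      by apply/funext => t; rewrite mulrC.
  have rn : rho xi != 0 by rewrite gt_eqF.
  have Ec : (if b then (xi.1, coord b xi) else (coord b xi, xi.2)) = xi.
    by case: (b); case: (xi).
  have := @base_derive _ (derive1n k w) _ l _ _ _ _ dA dr; rewrite Ec => /(_ _ rn (cutoff_is_derive hw k _)).
  rewrite /dslice; set F1 := (fun t => _); set F2 := (fun t => _).
  have -> : F1 = F2 by apply/funext => t; rewrite /F1/F2; case: (b).
  move=> h; apply: (@is_derive_eq _ _ _ _ _ _ _ _ h); rewrite /g'.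
  by case: (b) => /=; rewrite !exprS; ring.
have z0 : g' xi = 0 by apply: (tclass_supp0 tg'); rewrite r0 mul0r invr_gt0.
rewrite z0 /dslice.
have hn : \forall t \near coord b xi, rho (if b then (xi.1, t) else (t, xi.2)) < 2^-1 / a.
  have := @rho_slice_cvg b xi; rewrite r0 => /cvgrPdist_lt/(_ (2^-1 / a)).
  have e0 : 0 < 2^-1 / a by rewrite divr_gt0// invr_gt0.
  move=> /(_ e0); apply: filterS => t; rewrite sub0r normrN ger0_norm//; exact: rho_ge0.
have hc : is_derive (coord b xi) 1 (cst (0 : R)) (0 : R) by apply: is_derive_cst.
apply: (near_eq_is_derive _ hc).
apply: filterS hn => t ht; apply/esym; apply: (tclass_supp0 (tclass_base i j l k)).
by rewrite -ltr_pdivlMr.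
Qed.

End test_class.

(** * An integrable weight on the plane and calculus on lines *)

Section plane_weight.
Context {R : realType}.

(** This is [((1 + x_1^2) (1 + x_2^2))^-1], the common majorant of rapidly decreasing functions; as
    a product of Poisson kernels it has translates of known integral. *)
Definition pweight (x : R * R) : R := poisson 1 x.1 * poisson 1 x.2.

Lemma pweight_ge0 x : 0 <= pweight x.
Proof. by rewrite mulr_ge0// poisson_ge0. Qed.

Lemma integrable_pweight : (leb2 R).-integrable setT (fun x => (pweight x)%:E).
Proof.
have := @integrable_poisson2 R 1 (0, 0) ltr01.
by under eq_fun do rewrite /= !subr0.
Qed.

(** Expanding [(1 + x_1^2) (1 + x_2^2)] gives four terms, each at most [C] after multiplication by
    [A]. *)
Lemma pweight_dom (A C : R) (x : R * R) : 0 <= A ->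
  A <= C -> `|x.1| ^+ 2 * A <= C -> `|x.2| ^+ 2 * A <= C ->
  `|x.1| ^+ 2 * `|x.2| ^+ 2 * A <= C -> A <= 4 * C * pweight x.
Proof.
move=> A0; rewrite !real_normK ?num_real// => h0 h1 h2 h3.
have p1 (t : R) : poisson 1 t = (1 + t ^+ 2)^-1 by rewrite /poisson expr1n mul1r.
have t0 (t : R) : 0 < 1 + t ^+ 2 by rewrite ltr_wpDr ?sqr_ge0.
rewrite /pweight !p1 -invfM ler_pdivlMr ?mulr_gt0//.
have -> : A * ((1 + x.1 ^+ 2) * (1 + x.2 ^+ 2)) =
  A + x.1 ^+ 2 * A + x.2 ^+ 2 * A + x.1 ^+ 2 * x.2 ^+ 2 * A by ring.
by lra.
Qed.

Lemma lipschitz_1d (G G' : R -> R) (L : R) :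
  (forall t : R, is_derive t 1 G (G' t)) -> (forall t, `|G' t| <= L) ->
  forall s t, `|G s - G t| <= L * `|s - t|.
Proof.
move=> dG GL s t; wlog st : s t / t <= s.
  move=> h; have [/h//|/ltW/h] := leP t s.
  by rewrite distrC [`|t - s|]distrC.
have cG : {within `[t, s], continuous G}.
  apply: continuous_subspaceT => u; apply: differentiable_continuous.
  by apply/derivable1_diffP; have [] := dG u.
have [c _ ->] := MVT_segment st (fun u _ => dG u) cG.
by rewrite normrM ler_wpM2r.
Qed.

(** Integration by parts for compact support: the boundary terms vanish at [K + 1] and
    [- (K + 1)]. *)
Lemma integral_derivative0 (G G' : R -> R) (K : R) : 0 <= K ->
  (forall t : R, is_derive t 1 G (G' t)) -> continuous G' ->
  (forall t : R, K < `|t| -> G t = 0) -> (forall t : R, K < `|t| -> G' t = 0) ->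
  \int[@lebesgue_measure R]_t G' t = 0.
Proof.
move=> K0 dG cG' G0 G'0.
have KK : - (K + 1) < K + 1 by lra.
have -> : \int[@lebesgue_measure R]_t G' t =
    \int[@lebesgue_measure R]_(t in `[- (K + 1), K + 1]) G' t.
  rewrite [RHS]Rintegral_mkcond; apply: eq_Rintegral => t _.
  rewrite patchE; case: ifPn => // tn; apply: G'0.
  rewrite ltNge; apply: contra tn => tK; rewrite inE/= in_itv/= -ler_norml.
  by rewrite (le_trans tK)// lerDl.
rewrite /Rintegral (continuous_FTC2 KK _ _ (F := G)).
- rewrite !G0 ?subee// ?normrN gtr0_norm ?ltrDl//; lra.
- exact: continuous_subspaceT.
- have cG t : {for t, continuous G}.
    by apply: differentiable_continuous; apply/derivable1_diffP; have [] := dG t.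
  split; first by move=> t _; have [] := dG t.
    by apply: cvg_at_right_filter; exact: cG.
  by apply: cvg_at_left_filter; exact: cG.
- by move=> t _; rewrite derive1E; have [_ ->] := dG t.
Qed.

End plane_weight.

(** * Decay and continuity of the test class *)

Section test_transform.
Context {R : realType}.
Variables (w : R -> R) (hw : cutoff w) (a : R) (a0 : 0 < a).
Local Notation tclass := (tclass w a).
Local Notation leb := (leb2 R).
Implicit Types (g psi : R * R -> R) (x xi : R * R).

(** Stability under the coordinates upgrades boundedness to decay: it is applied to the products
    with [1], [xi_1^2], [xi_2^2] and [xi_1^2 xi_2^2]. *)
Lemma tclass_weight g : tclass g -> exists2 C : R, 0 <= C & forall xi, `|g xi| <= C * pweight xi.
Proof.
move=> tg.
have [C0 C00 h0] := tclass_bounded hw a0 tg.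
have t1 := tclass_coord false (tclass_coord false tg).
have t2 := tclass_coord true (tclass_coord true tg).
have t3 := tclass_coord false (tclass_coord false t2).
have [C1 C10 h1] := tclass_bounded hw a0 t1.
have [C2 C20 h2] := tclass_bounded hw a0 t2.
have [C3 C30 h3] := tclass_bounded hw a0 t3.
exists (4 * (C0 + C1 + C2 + C3)); first by rewrite mulr_ge0// !addr_ge0.
move=> xi; apply: pweight_dom => //.
- by apply: le_trans (h0 xi) _; lra.
- have := h1 xi; rewrite /= !normrM mulrA -expr2 => h; apply: le_trans h _; lra.
- have := h2 xi; rewrite /= !normrM mulrA -expr2 => h; apply: le_trans h _; lra.
- have -> : `|xi.1| ^+ 2 * `|xi.2| ^+ 2 * `|g xi| =
      `|xi.1| * (`|xi.1| * (`|xi.2| * (`|xi.2| * `|g xi|))) by ring.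
  by have := h3 xi; rewrite /= !normrM => h; apply: le_trans h _; lra.
Qed.

Lemma tclass_lipschitz g : tclass g ->
  exists C : R, forall x y, `|g x - g y| <= C * (`|x.1 - y.1| + `|x.2 - y.2|).
Proof.
move=> tg.
have [g1 tg1 d1] := tclass_dslice hw a0 false tg.
have [g2 tg2 d2] := tclass_dslice hw a0 true tg.
have [C1 C10 h1] := tclass_bounded hw a0 tg1.
have [C2 C20 h2] := tclass_bounded hw a0 tg2.
exists (C1 + C2) => x y.
have l1 := @lipschitz_1d R (fun t => g (t, x.2)) (fun t => g1 (t, x.2)) C1
  (fun t => d1 (t, x.2)) (fun t => h1 _) x.1 y.1.
have l2 := @lipschitz_1d R (fun t => g (y.1, t)) (fun t => g2 (y.1, t)) C2
  (fun t => d2 (y.1, t)) (fun t => h2 _) x.2 y.2.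
have -> : g x - g y = (g (x.1, x.2) - g (y.1, x.2)) + (g (y.1, x.2) - g (y.1, y.2)).
  by case: (x) (y) => [? ?] [? ?] /=; ring.
apply: le_trans (ler_normD _ _) _; apply: le_trans (lerD l1 l2) _.
have := normr_ge0 (x.1 - y.1); have := normr_ge0 (x.2 - y.2); nra.
Qed.

Lemma tclass_continuous g : tclass g -> continuous g.
Proof. by move=> /tclass_lipschitz [C]; exact: lipschitz_continuous. Qed.

Lemma tclass_measurable g : tclass g -> measurable_fun setT g.
Proof. by move=> /tclass_continuous; exact: continuous_measurable_plane. Qed.

End test_transform.

Section cosine_estimates.
Context {R : realType}.

Lemma cos_quad (u h : R) : `|cos (u + h) - cos u - h * cos (u + pi / 2)| <= 2 * h ^+ 2.
Proof.
have -> : cos (u + h) - cos u - h * cos (u + pi / 2) =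
    complex.Re (expi u * (expi h - 1 - 'i * h%:C)).
  by rewrite cosDpihalf cosD ReM !ReD !ImD !ReN !ImN ReM ImM /=; ring.
apply: le_trans (cabs_Re _) _; rewrite cabsM cabs_expi mul1r; exact: expi_sub1B_le.
Qed.

Lemma expi_lip (u v : R) : cabs (expi u - expi v) <= `|u - v|.
Proof.
have -> : expi u - expi v = expi v * (expi (u - v) - 1).
  by rewrite mulrBr mulr1 -expiD [v + _]addrC subrK.
by rewrite cabsM cabs_expi mul1r expi_sub1_le.
Qed.

Lemma cos_lip (u v : R) : `|cos u - cos v| <= `|u - v|.
Proof.
apply: le_trans (expi_lip u v).
by have := cabs_Re (expi u - expi v); rewrite ReD ReN.
Qed.

End cosine_estimates.

(** * Cosine transforms of the test class *)

Section cosine_transform.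
Context {R : realType}.
Variables (w : R -> R) (hw : cutoff w) (a : R) (a0 : 0 < a).
Local Notation tclass := (tclass w a).
Local Notation leb := (leb2 R).
Implicit Types (g psi : R * R -> R) (x xi : R * R).

(** Real form of the Fourier integral. The phases [0] and [- pi / 2] give real and imaginary parts,
    and both differentiation and multiplication by a coordinate shift the phase by [pi / 2], so one
    family is stable under all operations. *)
Definition ctrans psi (tau : R) x : R := \int[leb]_xi (psi xi * cos (dotp x xi + tau)).

Lemma measurable_cos_dotp x (tau : R) :
  measurable_fun setT (fun xi : R * R => cos (dotp x xi + tau)).
Proof.
apply: measurableT_comp; first by apply: continuous_measurable_fun; exact: continuous_cos.
apply: measurable_funD => //; apply: measurable_funD; exact: measurable_funM.
Qed.

Lemma continuous_cos_dotp x (tau : R) :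
  continuous (fun xi : R * R => cos (dotp x xi + tau)).
Proof.
apply: (@lipschitz_continuous _ _ (`|x.1| + `|x.2|)) => xi eta.
apply: le_trans (cos_lip _ _) _.
have -> : dotp x xi + tau - (dotp x eta + tau) = x.1 * (xi.1 - eta.1) + x.2 * (xi.2 - eta.2).
  by rewrite /dotp; ring.
apply: le_trans (ler_normD _ _) _; rewrite !normrM.
have := normr_ge0 x.1; have := normr_ge0 x.2.
by have := normr_ge0 (xi.1 - eta.1); have := normr_ge0 (xi.2 - eta.2); nra.
Qed.

Lemma slice_continuous (b : bool) (v : R) g : continuous g ->
  continuous (fun u : R => g (if b then (v, u) else (u, v))).
Proof.
move=> cg u; apply/cvgrPdist_le => e e0.
have /cvgrPdist_le/(_ e e0) := cg (if b then (v, u) else (u, v)).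
move=> /nbhs_ballP[d /= d0 dP].
have : nbhs u (ball u d) by exact: nbhsx_ballx.
apply: filterS => t ut; apply: dP; case: b => /=.
  by split => //=; exact: ballxx.
by split => //=; exact: ballxx.
Qed.

Lemma ctrans_integrable psi (tau : R) x : tclass psi ->
  leb.-integrable setT (fun xi => (psi xi * cos (dotp x xi + tau))%:E).
Proof.
move=> tg; have [C C0 gC] := tclass_weight hw a0 tg.
apply: integrable_dom (integrable_scale C integrable_pweight) _.
  by apply: measurable_funM; [exact: tclass_measurable tg|exact: measurable_cos_dotp].
by move=> xi; apply: le_trans (gC xi); rewrite normrM ler_piMr// cos_max.
Qed.

Lemma ctrans_bounded psi : tclass psi ->
  exists2 C : R, 0 <= C & forall tau x, `|ctrans psi tau x| <= C.
Proof.
move=> tg; have [C C0 gC] := tclass_weight hw a0 tg.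
exists (\int[leb]_xi (C * pweight xi)).
  by apply: Rintegral_ge0 => x _; rewrite mulr_ge0// pweight_ge0.
move=> tau x; apply: Rintegral_dom; first exact: ctrans_integrable.
  exact: (integrable_scale C integrable_pweight).
by move=> xi; apply: le_trans (gC xi); rewrite normrM ler_piMr// cos_max.
Qed.

Lemma dotp_axis b x xi (t : R) : dotp (t *: axis R b + x) xi = dotp x xi + t * coord b xi.
Proof.
have E : t *: axis R b + x = (t * (axis R b).1 + x.1, t * (axis R b).2 + x.2) by [].
by rewrite E /dotp; case: b {E} => /=; ring.
Qed.

(** By [cos_quad] the remainder at step [t] is at most [2 t^2 |psi|] times the square of [coord b],
    integrable because two multiplications by [coord b] stay in the class. *)
Lemma ctrans_derive psi tau b x : tclass psi ->
  is_derive x (axis R b) (ctrans psi tau) (ctrans (fun xi => coord b xi * psi xi) (tau + pi / 2) x).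
Proof.
move=> tg.
have t1 := tclass_coord b tg; have t2 := tclass_coord b t1.
have [C C0 gC] := tclass_weight hw a0 t2.
apply: (@is_derive_quad _ _ _ _ _ (2 * \int[leb]_xi (C * pweight xi))) => t.
rewrite /ctrans -RintegralZl//; last exact: ctrans_integrable.
have i1 := ctrans_integrable tau (t *: axis R b + x) tg.
have i2 := ctrans_integrable tau x tg.
have i3 := integrable_scale t (ctrans_integrable (tau + pi / 2) x t1).
rewrite -RintegralB// -RintegralB//; last first.
  by apply: (integrableB _ i1 i2).
have iW := integrable_scale (2 * t ^+ 2) (integrable_scale C integrable_pweight).
have -> : 2 * \int[leb]_xi (C * pweight xi) * t ^+ 2 =
   \int[leb]_xi (2 * t ^+ 2 * (C * pweight xi)).
  by rewrite [RHS]RintegralZl//; [ring|exact: (integrable_scale C integrable_pweight)].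
apply: Rintegral_dom => //.
  have := integrableB measurableT (integrableB measurableT i1 i2) i3.
  by [].
move=> xi; rewrite dotp_axis.
have -> : psi xi * cos (dotp x xi + t * coord b xi + tau) - psi xi * cos (dotp x xi + tau) -
   t * (coord b xi * psi xi * cos (dotp x xi + (tau + pi / 2))) =
  psi xi * (cos ((dotp x xi + tau) + t * coord b xi) - cos (dotp x xi + tau) -
   (t * coord b xi) * cos ((dotp x xi + tau) + pi / 2)).
  rewrite [dotp x xi + (tau + _)]addrA [dotp x xi + _ + tau]addrAC; ring.
rewrite normrM; apply: le_trans (ler_wpM2l (normr_ge0 _) (cos_quad _ _)) _.
have -> : `|psi xi| * (2 * (t * coord b xi) ^+ 2) =
   2 * t ^+ 2 * `|coord b xi * (coord b xi * psi xi)|.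
  by rewrite !normrM exprMn -(real_normK (num_real (coord b xi))); ring.
by rewrite ler_wpM2l// mulr_ge0// sqr_ge0.
Qed.

Lemma ctrans_continuous psi tau : tclass psi -> continuous (ctrans psi tau).
Proof.
move=> tg.
have [C1 C10 g1] := tclass_weight hw a0 (tclass_coord false tg).
have [C2 C20 g2] := tclass_weight hw a0 (tclass_coord true tg).
pose C := \int[leb]_xi ((C1 + C2) * pweight xi).
apply: (@lipschitz_continuous _ _ C) => x y.
have ix := ctrans_integrable tau x tg; have iy := ctrans_integrable tau y tg.
rewrite /ctrans -RintegralB// mulrC.
rewrite /C -RintegralZl//; last exact: (integrable_scale _ integrable_pweight).
apply: Rintegral_dom.
- exact: (integrableB measurableT ix iy).
- exact: (integrable_scale _ (integrable_scale _ integrable_pweight)).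
move=> xi; rewrite -mulrBr normrM.
apply: le_trans (ler_wpM2l (normr_ge0 _) (cos_lip _ _)) _.
have -> : dotp x xi + tau - (dotp y xi + tau) = (x.1 - y.1) * xi.1 + (x.2 - y.2) * xi.2.
  by rewrite /dotp; ring.
apply: le_trans (ler_wpM2l (normr_ge0 _) (ler_normD _ _)) _.
have h1 := g1 xi; have h2 := g2 xi; move: h1 h2; rewrite /= !normrM => h1 h2.
have -> : `|psi xi| * (`|x.1 - y.1| * `|xi.1| + `|x.2 - y.2| * `|xi.2|) =
   `|x.1 - y.1| * (`|xi.1| * `|psi xi|) + `|x.2 - y.2| * (`|xi.2| * `|psi xi|) by ring.
have p0 := pweight_ge0 xi.
rewrite mulrDl lerD// ler_wpM2l// mulrDl; apply: le_trans _ (_ : _ <= _); [exact: h1| |exact: h2|].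
  by rewrite lerDl mulr_ge0.
by rewrite lerDr mulr_ge0.
Qed.

Lemma tclass_rpartial psi tau s : tclass psi ->
  exists psi' tau', tclass psi' /\ rpartial s (ctrans psi tau) = ctrans psi' tau'.
Proof.
move=> tg; elim: s => [|b s [psi' [tau' [t' e']]]]; first by exists psi, tau.
exists (fun xi => coord b xi * psi' xi), (tau' + pi / 2); split.
  exact: tclass_coord.
rewrite /= e'; apply/funext => x.
by have [_ ->] := ctrans_derive tau' b x t'.
Qed.

Lemma ctrans_smooth psi tau : tclass psi -> smooth2 (ctrans psi tau).
Proof.
move=> tg s; have [psi' [tau' [t' ->]]] := tclass_rpartial tau s tg.
split; first exact: ctrans_continuous.
by move=> b x; have [] := ctrans_derive tau' b x t'.
Qed.

(** Integration by parts along axis [b]: the slice derivative of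
    [psi xi * cos (dotp x xi + tau + pi / 2)] has integral zero. It trades a factor [x_b] for a
    derivative of [psi], with the same [psi'] for all phases. *)
Lemma ctrans_mul psi b : tclass psi -> exists2 psi', tclass psi' &
  forall tau x, coord b x * ctrans psi tau x = ctrans psi' (tau + pi / 2) x.
Proof.
move=> tg; have [psi' t' d'] := tclass_dslice hw a0 b tg.
exists psi' => // tau x.
pose G xi := psi xi * cos (dotp x xi + (tau + pi / 2)).
pose G' xi := psi' xi * cos (dotp x xi + (tau + pi / 2)) -
   coord b x * (psi xi * cos (dotp x xi + tau)).
have i1 := ctrans_integrable (tau + pi / 2) x t'.
have i2 := integrable_scale (coord b x) (ctrans_integrable tau x tg).
have dG xi : dslice b G xi (G' xi).
  have h1 := d' xi; move: h1; rewrite /dslice => h1.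
  have h2 : is_derive (coord b xi) 1
     (fun t => dotp x (if b then (xi.1, t) else (t, xi.2)) + (tau + pi / 2)) (coord b x).
    by case: (b); rewrite /dotp /=; apply: is_derive_eq; rewrite /GRing.scale/=; ring.
  have h3 : is_derive (coord b xi) 1
     (fun t => cos (dotp x (if b then (xi.1, t) else (t, xi.2)) + (tau + pi / 2)))
     (- cos (dotp x xi + tau) * coord b x).
    have -> : (fun t => cos (dotp x (if b then (xi.1, t) else (t, xi.2)) + (tau + pi / 2))) =
      cos \o (fun t => dotp x (if b then (xi.1, t) else (t, xi.2)) + (tau + pi / 2)) by [].
    apply: is_derive_eq; rewrite /=.
    have -> : (if b then (xi.1, coord b xi) else (coord b xi, xi.2)) = xi.
      by case: (b); case: (xi).
    by rewrite addrA sinDpihalf mulrC.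
  rewrite /G; apply: is_derive_eq; rewrite /GRing.scale/= /G'.
  have -> : (if b then (xi.1, coord b xi) else (coord b xi, xi.2)) = xi.
    by case: (b); case: (xi).
  ring.
have I0 : \int[leb]_xi G' xi = 0.
  have [C1 C10 gC1] := tclass_weight hw a0 t'.
  have [C2 C20 gC2] := tclass_weight hw a0 tg.
  have mG' : measurable_fun setT G'.
    apply: measurable_funB; first apply: measurable_funM.
    - exact: tclass_measurable t'.
    - exact: measurable_cos_dotp.
    apply: measurable_funM; first exact: measurable_cst.
    by apply: measurable_funM; [exact: tclass_measurable tg|exact: measurable_cos_dotp].
  have cG' : continuous G'.
    move=> xi; apply: cvgB; apply: cvgM.
    - exact: tclass_continuous t' xi.
    - exact: continuous_cos_dotp.
    - exact: cvg_cst.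
    - by apply: cvgM; [exact: tclass_continuous tg xi|exact: continuous_cos_dotp].
  have supp xi : 2 / a < rho xi -> G xi = 0 /\ G' xi = 0.
    move=> h; rewrite /G /G' (tclass_supp hw a0 tg h) (tclass_supp hw a0 t' h).
    by rewrite !mul0r mulr0 subr0.
  have K0 : 0 <= 2 / a by rewrite divr_ge0// ltW.
  have dom u v : `|G' (u, v)| <= (C1 + `|coord b x| * C2) * poisson 1 u * poisson 1 v.
    rewrite -mulrA -[_ * poisson 1 v]/(pweight (u, v)) mulrDl.
    apply: le_trans (ler_normB _ _) _; apply: lerD.
      by apply: le_trans (gC1 _); rewrite normrM ler_piMr// cos_max.
    rewrite normrM -mulrA ler_wpM2l//.
    by apply: le_trans (gC2 _); rewrite normrM ler_piMr// cos_max.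
  have ip : (@lebesgue_measure R).-integrable setT (fun t => (poisson 1 t)%:E).
    by have := @integrable_poisson R 1 0 ltr01; under eq_fun do rewrite subr0.
  have [F1 F2] := @Rfubini _ _ _ _ R (@lebesgue_measure R) (@lebesgue_measure R) G' _ _ mG'
    (integrable_scale (C1 + `|coord b x| * C2) ip) ip dom.
  (* Each line parallel to axis [b] contributes zero; [b] then decides which of the two iterated
     integrals is taken. *)
  have inner0 (v : R) : \int[@lebesgue_measure R]_u G' (if b then (v, u) else (u, v)) = 0.
    apply: (@integral_derivative0 R (fun u => G (if b then (v, u) else (u, v)))
      (fun u => G' (if b then (v, u) else (u, v))) (2 / a) K0).
    - move=> u; have := dG (if b then (v, u) else (u, v)); rewrite /dslice.
      by case: (b).
    - exact: slice_continuous.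
    - move=> u hu; apply: (supp _ _).1; apply: lt_le_trans hu _.
      by have := rho_coord b (if b then (v, u) else (u, v)); case: (b).
    - move=> u hu; apply: (supp _ _).2; apply: lt_le_trans hu _.
      by have := rho_coord b (if b then (v, u) else (u, v)); case: (b).
  move: F1 F2 inner0; move: (G') => H; case: (b) => F1 F2 inner0.
    rewrite [LHS]F1; under eq_Rintegral do rewrite inner0.
    by rewrite /Rintegral integral0.
  rewrite [LHS]F2; under eq_Rintegral do rewrite inner0.
  by rewrite /Rintegral integral0.
move: I0; rewrite /G' RintegralB; [|by []|exact: i1|exact: i2].
rewrite RintegralZl//; last exact: ctrans_integrable.
by move/eqP; rewrite subr_eq0 => /eqP <-.
Qed.

End cosine_transform.

(** * Majorants of Schwartz functions *)

Section schwartz_weight.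
Context {R : realType}.
Implicit Types phi : R * R -> R[i].

Lemma cpartial_nil phi x : cpartial [::] phi x = phi x.
Proof. by rewrite /cpartial /=; case: (phi x). Qed.

(** The seminorms that enter have no derivative and exponents at most [2]; this fixes the order [2]
    of the distributions in [regular_distr_tempered]. *)
Lemma seminorm_weight phi (C : R) :
  (forall m n, (m <= 2)%N -> (n <= 2)%N -> seminorm_le [::] m n phi C) ->
  forall x, cabs (phi x) <= 4 * C * pweight x.
Proof.
move=> h x; have h' m n : (m <= 2)%N -> (n <= 2)%N ->
    `|x.1| ^+ m * `|x.2| ^+ n * cabs (phi x) <= C.
  by move=> m2 n2; have := h m n m2 n2 x; rewrite cpartial_nil.
apply: pweight_dom; first exact: cabs_ge0.
- by have := h' 0 0 isT isT; rewrite !expr0 !mul1r.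
- by have := h' 2 0 isT isT; rewrite expr0 mulr1.
- by have := h' 0 2 isT isT; rewrite expr0 mul1r.
- exact: h' 2 2 isT isT.
Qed.

Lemma schwartz_weight phi : schwartz phi ->
  exists2 C : R, 0 <= C & forall x, cabs (phi x) <= C * pweight x.
Proof.
move=> [_ _ sp].
have [C00 h00] := sp [::] 0%N 0%N; have [C20 h20] := sp [::] 2%N 0%N.
have [C02 h02] := sp [::] 0%N 2%N; have [C22 h22] := sp [::] 2%N 2%N.
pose C := `|C00| + `|C20| + `|C02| + `|C22|.
have c0 := normr_ge0 C00; have c1 := normr_ge0 C20.
have c2 := normr_ge0 C02; have c3 := normr_ge0 C22.
exists (4 * C); first by rewrite /C; lra.
move=> x; apply: pweight_dom; first exact: cabs_ge0.
- have := h00 x; rewrite cpartial_nil !expr0 !mul1r => h.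
  by apply: le_trans h _; have := ler_norm C00; rewrite /C; lra.
- have := h20 x; rewrite cpartial_nil expr0 mulr1 => h.
  by apply: le_trans h _; have := ler_norm C20; rewrite /C; lra.
- have := h02 x; rewrite cpartial_nil expr0 mul1r => h.
  by apply: le_trans h _; have := ler_norm C02; rewrite /C; lra.
- have := h22 x; rewrite cpartial_nil => h.
  by apply: le_trans h _; have := ler_norm C22; rewrite /C; lra.
Qed.

Lemma schwartz_measurable phi : schwartz phi -> cmeasurable phi.
Proof.
move=> [s1 s2 _]; split; apply: continuous_measurable_plane.
  exact: (s1 [::]).1.
exact: (s2 [::]).1.
Qed.

End schwartz_weight.

(** * The kernels, their decay and their Fourier transform *)

Section kernel.
Context {R : realType}.
Variables (w : R -> R) (hw : cutoff w) (a : R) (a0 : 0 < a).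
Local Notation tclass := (tclass w a).
Local Notation leb := (leb2 R).
Implicit Types (g psi : R * R -> R) (x y xi : R * R).

(** Each factor [x_1] or [x_2] is absorbed by [ctrans_mul]. The bound is uniform in [tau] because
    the induction shifts the phase. *)
Lemma ctrans_decay psi m n : tclass psi ->
  exists C : R, forall tau x, `|x.1| ^+ m * `|x.2| ^+ n * `|ctrans psi tau x| <= C.
Proof.
elim: m psi => [|m IH] psi tg.
  elim: n psi tg => [|n IH] psi tg.
    have [C _ h] := ctrans_bounded hw a0 tg; exists C => tau x.
    by rewrite !expr0 !mul1r.
  have [psi' t' h'] := ctrans_mul hw a0 true tg.
  have [C hC] := IH _ t'; exists C => tau x.
  rewrite (_ : _ * _ = `|x.1| ^+ 0 * `|x.2| ^+ n * (`|coord true x| * `|ctrans psi tau x|)).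
    by rewrite -normrM h'; exact: hC.
  by rewrite exprS /=; ring.
have [psi' t' h'] := ctrans_mul hw a0 false tg.
have [C hC] := IH _ t'; exists C => tau x.
rewrite (_ : _ * _ = `|x.1| ^+ m * `|x.2| ^+ n * (`|coord false x| * `|ctrans psi tau x|)).
  by rewrite -normrM h'; exact: hC.
by rewrite exprS /=; ring.
Qed.

(** [4 * pi ^+ 2] is the inversion constant of the unnormalized transform in the plane; dividing by
    it makes [w (rho xi * a)] the exact transform of [Wker]. The parameter [a] will be [2^(-n)]. *)
Definition annulus xi : R := (4 * pi ^+ 2)^-1 * w (rho xi * a).

Lemma annulus_tclass : tclass annulus.
Proof.
apply: (tclass_ext (tclass_scale (4 * pi ^+ 2)^-1 (tclass_base w a 0 0 0 0))) => xi.
by rewrite !expr0 !mul1r.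
Qed.

Definition Wker x : R[i] := cint (fun xi => (annulus xi)%:C * expi (1 * dotp x xi)).

Lemma Wker_Re : (fun x => complex.Re (Wker x)) = ctrans annulus 0.
Proof.
apply/funext => x; rewrite /= /ctrans; apply: eq_Rintegral => xi _.
by rewrite mul0r subr0 mul1r addr0.
Qed.

Lemma Wker_Im : (fun x => complex.Im (Wker x)) = ctrans annulus (- (pi / 2)).
Proof.
apply/funext => x; rewrite /= /ctrans; apply: eq_Rintegral => xi _.
by rewrite mul0r addr0 mul1r cosBpihalf.
Qed.

Lemma Wker_schwartz : schwartz Wker.
Proof.
have tA := annulus_tclass.
split.
- by rewrite Wker_Re; apply: (ctrans_smooth hw a0 0 tA).
- by rewrite Wker_Im; apply: (ctrans_smooth hw a0 _ tA).
move=> s m n.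
have [psi1 [tau1 [t1 e1]]] := tclass_rpartial hw a0 0 s tA.
have [psi2 [tau2 [t2 e2]]] := tclass_rpartial hw a0 (- (pi / 2)) s tA.
have [C1 h1] := ctrans_decay m n t1; have [C2 h2] := ctrans_decay m n t2.
exists (C1 + C2) => x.
rewrite /cpartial Wker_Re Wker_Im e1 e2.
have k0 : 0 <= `|x.1| ^+ m * `|x.2| ^+ n by rewrite mulr_ge0// exprn_ge0.
apply: le_trans (ler_wpM2l k0 (cabs_le _)) _ => /=.
by rewrite mulrDr lerD.
Qed.

Lemma cnear_continuous (psi : R * R -> R[i]) (eta : R * R) :
  continuous (fun x => complex.Re (psi x)) -> continuous (fun x => complex.Im (psi x)) ->
  cnear psi eta.
Proof.
move=> c1 c2 om om0; have om20 : 0 < om / 2 by rewrite divr_gt0.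
have /cvgrPdist_le/(_ _ om20) h1 := c1 eta; have /cvgrPdist_le/(_ _ om20) h2 := c2 eta.
have h : \forall x \near eta, `|complex.Re (psi eta) - complex.Re (psi x)| <= om / 2 /\
    `|complex.Im (psi eta) - complex.Im (psi x)| <= om / 2 by exact: filterI h1 h2.
move: h => /nbhs_ballP[d /= d0 dP]; exists d => // xi b1 b2.
have [|i1 i2] := dP xi; first by split; rewrite /ball/= distrC.
rewrite cabs_dist (splitr om) (le_trans (cabs_le _))// ReD ImD ReN ImN.
exact: lerD.
Qed.

Lemma kernel_wave_cnear x eta :
  cnear (fun xi => (annulus xi)%:C * expi (dotp x xi)) eta.
Proof.
apply: cnear_continuous => xi.
  under eq_fun do rewrite ReM/= mul0r subr0 -[dotp _ _]addr0.
  by apply: cvgM; [exact: (@tclass_continuous _ _ hw _ a0 _ annulus_tclass)|exact: continuous_cos_dotp].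
under eq_fun do rewrite ImM/= mul0r addr0 -cosBpihalf.
by apply: cvgM; [exact: (@tclass_continuous _ _ hw _ a0 _ annulus_tclass)|exact: continuous_cos_dotp].
Qed.

Lemma Wker_continuous : continuous (fun x => complex.Re (Wker x)) /\
  continuous (fun x => complex.Im (Wker x)).
Proof.
by rewrite Wker_Re Wker_Im; split; apply: (@ctrans_continuous R w hw a a0 annulus _ annulus_tclass).
Qed.

Lemma measurable_dotpr x (s : R) :
  measurable_fun setT (fun xi : R * R => s * dotp x xi).
Proof.
have -> : (fun xi => s * dotp x xi) = (fun xi => s * dotp xi x).
  by apply/funext => xi; rewrite /dotp; ring.
exact: measurable_dotp.
Qed.

(* Inversion applied to [annulus xi * exp (i x.xi)]. *)
Lemma Wker_inversion (s : R) x lam : s ^+ 2 = 1 ->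
  cint (fun y => Wker (x.1 + s * y.1, x.2 + s * y.2) * expi (- s * dotp y lam)) =
  (w (rho lam * a))%:C * expi (dotp x lam).
Proof.
move=> s2.
have tA := annulus_tclass.
have [C C0 hC] := tclass_weight hw a0 tA.
have [B B0 hB] := tclass_bounded hw a0 tA.
have [D D0 hD] := schwartz_weight Wker_schwartz.
pose psi xi := (annulus xi)%:C * expi (dotp x xi).
have WE y : cint (fun xi => psi xi * expi (s * dotp y xi)) = Wker (x.1 + s * y.1, x.2 + s * y.2).
  apply: eq_cintg => xi; rewrite /psi -mulrA -expiD; congr (_ * expi _).
  by rewrite /dotp/=; ring.
have mpsi : cmeasurable psi.
  apply: cmeasurableM; first by apply: cmeasurable_real; exact: (tclass_measurable hw a0 tA).
  by apply: cmeasurable_expi; have := measurable_dotpr x 1; under eq_fun do rewrite mul1r.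
have psiE xi : cabs (psi xi) = `|annulus xi| by rewrite cabsM cabs_expi mulr1 cabs_real.
(* The argument [x + s y] of the kernel vanishes at [y = - s x], where the translated majorant is
   centred. *)
pose z : R * R := (- (s * x.1), - (s * x.2)).
pose gJ y := D * (poisson 1 (y.1 - z.1) * poisson 1 (y.2 - z.2)).
have EW : (fun y => cint (fun xi => psi xi * expi (s * dotp y xi))) =
   (fun y => Wker (x.1 + s * y.1, x.2 + s * y.2)) by apply/funext => y; exact: WE.
have s1 : `|s| = 1.
  by apply/eqP; rewrite -(@eqrXn2 _ 2)// real_normK ?num_real// s2 expr1n.
have cs : continuous (fun y : R * R => (x.1 + s * y.1, x.2 + s * y.2)).
  move=> y; apply/cvg_ballP => e e0; have : nbhs y (ball y e) by exact: nbhsx_ballx.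
  apply: filterS => y' [/= b1 b2]; split; rewrite /ball/=.
    rewrite [X in `|X|](_ : _ = s * (y.1 - y'.1)); last by ring.
    by rewrite normrM s1 mul1r.
  rewrite [X in `|X|](_ : _ = s * (y.2 - y'.2)); last by ring.
  by rewrite normrM s1 mul1r.
have mJ : cmeasurable (fun y => cint (fun xi => psi xi * expi (s * dotp y xi))).
  rewrite EW; have [c1 c2] := Wker_continuous.
  split; apply: continuous_measurable_plane => y.
    exact: (continuous_comp (cs y) (c1 _)).
  exact: (continuous_comp (cs y) (c2 _)).
have ps (u v : R) : poisson 1 (u + s * v) = poisson 1 (v - - (s * u)).
  rewrite opprK -(poisson_sgn 1 (v + s * u) s2); congr poisson.
  by rewrite mulrDr mulrA -expr2 s2 mul1r addrC.
have hJ y : cabs (cint (fun xi => psi xi * expi (s * dotp y xi))) <= gJ y.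
  rewrite WE; apply: le_trans (hD _) _; rewrite /gJ /pweight/=.
  by rewrite !ps.
have <- : cint (fun y => cint (fun xi => psi xi * expi (s * dotp y xi)) * expi (- s * dotp y lam))
    = cint (fun y => Wker (x.1 + s * y.1, x.2 + s * y.2) * expi (- s * dotp y lam)).
  by apply: eq_cintg => y; rewrite WE.
rewrite (@fourier_inversion R psi B (fun xi => C * pweight xi) gJ s lam s2 mpsi _
  (integrable_scale C integrable_pweight) _ (@kernel_wave_cnear x lam) mJ
  (integrable_scale D (integrable_poisson2 z ltr01)) hJ); last 2 first.
- by move=> xi; rewrite psiE.
- by move=> xi; rewrite psiE.
rewrite /psi mulrA -rmorphM/= /annulus mulrA mulfV ?mul1r//.
by rewrite mulf_neq0// expf_neq0// gt_eqF// pi_gt0.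
Qed.

(** Plane waves are eigenfunctions of convolution, the eigenvalue being the transform of the kernel
    at the frequency of the wave. *)
Lemma Wker_conv x lam :
  cint (fun y => expi (dotp y lam) * Wker (x.1 - y.1, x.2 - y.2)) =
  (w (rho lam * a))%:C * expi (dotp x lam).
Proof.
rewrite -(Wker_inversion (s := -1)) ?sqrrN ?expr1n//.
by apply: eq_cintg => y; rewrite opprK mul1r !mulN1r mulrC.
Qed.

Lemma Wker_fourier xi : fourier Wker xi = (w (rho xi * a))%:C.
Proof.
have := @Wker_inversion 1 (0, 0) xi (expr1n _ _).
rewrite {2}/dotp /= !mul0r addr0 expi0 mulr1 => <-.
apply: eq_cintg => x /=; rewrite mulN1r expiN /dotp !mul1r !add0r.
by case: x.
Qed.

End kernel.

(** * The witness and its Besov norm *)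

Section dominated_series.
Context {R : realType}.
Local Notation r := (4 / 5 : R).
Implicit Types u v : nat -> R[i].

Lemma cvg0_le (h k : nat -> R) : (forall n, 0 <= h n <= k n) ->
  k n @[n --> \oo] --> (0 : R) -> h n @[n --> \oo] --> (0 : R).
Proof.
move=> hk /cvgrPdist_le k0; apply/cvgrPdist_le => e e0; have := k0 e e0.
apply: filterS => n; rewrite !sub0r !normrN; have /andP[h0 hn] := hk n.
by rewrite !ger0_norm// ?(le_trans h0)//; exact: le_trans.
Qed.

Lemma cvg0D (h k : nat -> R) : h n @[n --> \oo] --> (0 : R) -> k n @[n --> \oo] --> (0 : R) ->
  (h n + k n) @[n --> \oo] --> (0 : R).
Proof. by move=> h0 k0; rewrite -(addr0 (0 : R)); exact: cvgD. Qed.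

Definition csum u : R[i] :=
  limn (series (fun j => complex.Re (u j))) +i* limn (series (fun j => complex.Im (u j))).

Definition csummable u :=
  cvgn (series (fun j => complex.Re (u j))) /\ cvgn (series (fun j => complex.Im (u j))).

Definition gdom (M : R) u := forall j, cabs (u j) <= M * r ^+ j.

Lemma cvg_geometric_dom (M : R) (h : nat -> R) : (forall j, `|h j| <= M * r ^+ j) ->
  cvgn (series h).
Proof.
move=> hM; apply: normed_cvg; apply: (series_le_cvg (v_ := geometric M r)).
- by move=> n; exact: normr_ge0.
- by move=> n; apply: le_trans (hM n).
- exact: hM.
- by apply: is_cvg_geometric_series; rewrite ger0_norm; lra.
Qed.

Lemma gdom_csummable M u : gdom M u -> csummable u.
Proof.
by move=> h; split; apply: (@cvg_geometric_dom M) => j;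
  [exact: le_trans (cabs_Re _) (h j)|exact: le_trans (cabs_Im _) (h j)].
Qed.

Lemma csum_cvg u : csummable u ->
  cabs (csum u - \sum_(0 <= j < n) u j) @[n --> \oo] --> (0 : R).
Proof.
move=> [c1 c2].
have l1 : `|limn (series (fun j => complex.Re (u j))) -
    series (fun j => complex.Re (u j)) n| @[n --> \oo] --> (0 : R).
  rewrite -(normr0 R); apply: cvg_norm; rewrite -(subrr (limn (series (fun j => complex.Re (u j))))).
  by apply: cvgB; [exact: cvg_cst|exact: c1].
have l2 : `|limn (series (fun j => complex.Im (u j))) -
    series (fun j => complex.Im (u j)) n| @[n --> \oo] --> (0 : R).
  rewrite -(normr0 R); apply: cvg_norm; rewrite -(subrr (limn (series (fun j => complex.Im (u j))))).
  by apply: cvgB; [exact: cvg_cst|exact: c2].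
apply: cvg0_le (cvg0D l1 l2) => n; rewrite cabs_ge0/=; apply: le_trans (cabs_le _) _.
by rewrite ReD ImD ReN ImN Re_sum Im_sum.
Qed.

(** [5] is [1 / (1 - r)]; it is the source of the factors [5], [10], [20] and [25] in the bounds for
    the witness. *)
Lemma geometric_tail (N n : nat) : \sum_(N <= j < N + n) r ^+ j <= 5 * r ^+ N.
Proof.
have -> : \sum_(N <= j < N + n) r ^+ j = 5 * (r ^+ N - r ^+ (N + n)).
  elim: n => [|n IH]; first by rewrite addn0 big_geq// subrr mulr0.
  rewrite addnS big_nat_recr ?leq_addr//= IH exprS; lra.
by rewrite ler_wpM2l// gerBl exprn_ge0//; lra.
Qed.

Lemma csum_tail M u N : gdom M u ->
  cabs (csum u - \sum_(0 <= j < N) u j) <= 5 * M * r ^+ N.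
Proof.
move=> h; have M0 : 0 <= M by have := le_trans (cabs_ge0 _) (h 0%N); rewrite expr0 mulr1.
apply/ler_addgt0Pr => e e0.
have /cvgrPdist_le/(_ e e0) [K _ hK] := csum_cvg (gdom_csummable h).
have := hK (N + K)%N (leq_addl _ _).
rewrite sub0r normrN ger0_norm ?cabs_ge0// => hNK.
have -> : csum u - \sum_(0 <= j < N) u j =
   \sum_(N <= j < N + K) u j + (csum u - \sum_(0 <= j < N + K) u j).
  by rewrite (@big_cat_nat _ _ _ N 0 (N + K))//= ?leq_addr//; ring.
apply: le_trans (cabsD _ _) _; apply: lerD => //.
apply: le_trans (cabs_sum _ _ _) _.
apply: (@le_trans _ _ (\sum_(N <= j < N + K) M * r ^+ j)).
  by apply: ler_sum => j _; exact: h.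
rewrite -mulr_sumr; apply: le_trans (ler_wpM2l M0 (geometric_tail _ _)) _.
by rewrite mulrCA mulrA.
Qed.

Lemma csum_bound M u : gdom M u -> cabs (csum u) <= 5 * M.
Proof.
by move=> h; have := csum_tail 0 h; rewrite big_geq// subr0 expr0 mulr1.
Qed.

Lemma csum_unique u (l : R[i]) : csummable u ->
  cabs (l - \sum_(0 <= j < n) u j) @[n --> \oo] --> (0 : R) -> l = csum u.
Proof.
move=> h hl; have hc := csum_cvg h.
apply/eqP; rewrite -subr_eq0; apply/eqP/cabs_eq0/eqP; rewrite eq_le cabs_ge0 andbT.
apply: (cvgr_to_ge (cvg0D hl hc)); apply: nearW => n.
rewrite [X in _ <= _ + X]cabs_dist.
by have := cabsD (l - \sum_(0 <= j < n) u j) (\sum_(0 <= j < n) u j - csum u);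
  rewrite addrA subrK.
Qed.

Lemma csummableD u v : csummable u -> csummable v -> csummable (fun j => u j + v j).
Proof.
move=> [u1 u2] [v1 v2]; split.
  have -> : series (fun j => complex.Re (u j + v j)) =
      series (fun j => complex.Re (u j)) + series (fun j => complex.Re (v j)).
    by apply/funext => n; rewrite /series/= !fctE -big_split; apply: eq_bigr => j _; rewrite ReD.
  exact: is_cvgD.
have -> : series (fun j => complex.Im (u j + v j)) =
    series (fun j => complex.Im (u j)) + series (fun j => complex.Im (v j)).
  by apply/funext => n; rewrite /series/= !fctE -big_split; apply: eq_bigr => j _; rewrite ImD.
exact: is_cvgD.
Qed.

Lemma csummableZ a u : csummable u -> csummable (fun j => a * u j).
Proof.
move=> [u1 u2].
have sZ (c : R) (h : nat -> R) : cvgn (series h) -> cvgn (fun n => c * series h n).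
  by move=> ch; apply: is_cvgM => //; exact: is_cvg_cst.
split.
  have -> : series (fun j => complex.Re (a * u j)) =
      (fun n => complex.Re a * series (fun j => complex.Re (u j)) n) -
      (fun n => complex.Im a * series (fun j => complex.Im (u j)) n).
    apply/funext => n; rewrite /series/= !fctE !mulr_sumr -sumrB.
    by apply: eq_bigr => j _; rewrite ReM.
  by apply: is_cvgB; exact: sZ.
have -> : series (fun j => complex.Im (a * u j)) =
    (fun n => complex.Re a * series (fun j => complex.Im (u j)) n) +
    (fun n => complex.Im a * series (fun j => complex.Re (u j)) n).
  apply/funext => n; rewrite /series/= !fctE !mulr_sumr -big_split.
  by apply: eq_bigr => j _; rewrite ImM.
by apply: is_cvgD; exact: sZ.
Qed.

Lemma csumD u v : csummable u -> csummable v ->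
  csum (fun j => u j + v j) = csum u + csum v.
Proof.
move=> h h'; apply/esym; apply: (csum_unique (csummableD h h')).
apply: cvg0_le (cvg0D (csum_cvg h) (csum_cvg h')) => n.
rewrite cabs_ge0/= big_split/=; apply: le_trans _ (cabsD _ _).
by rewrite le_eqVlt; apply/orP; left; apply/eqP; congr cabs; ring.
Qed.

Lemma csumZ a u : csummable u -> csum (fun j => a * u j) = a * csum u.
Proof.
move=> h; apply/esym; apply: (csum_unique (csummableZ a h)).
have -> : (fun n => cabs (a * csum u - \sum_(0 <= j < n) a * u j)) =
  (fun n => cabs a * cabs (csum u - \sum_(0 <= j < n) u j)).
  by apply/funext => n; rewrite -mulr_sumr -mulrBr cabsM.
by rewrite -(mulr0 (cabs a)); apply: cvgM; [exact: cvg_cst|exact: csum_cvg h].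
Qed.

Lemma csumB (U V : nat -> R[i]) : csummable U -> csummable V ->
  csum U - csum V = csum (fun j => U j - V j).
Proof.
move=> sU sV; rewrite -mulN1r -(csumZ _ sV) -(csumD sU (csummableZ _ sV)).
by congr csum; apply/funext => j; rewrite mulN1r.
Qed.

Lemma abs_csummable u M : (forall n, \sum_(0 <= k < n) cabs (u k) <= M) -> csummable u.
Proof.
move=> hM; suff h (v : nat -> R) : (forall k, `|v k| <= cabs (u k)) -> cvgn (series v).
  by split; apply: h => k; [exact: cabs_Re|exact: cabs_Im].
move=> vu; apply: normed_cvg; apply: nondecreasing_is_cvgn.
  apply/nondecreasing_seqP => n; rewrite -[leRHS]/(series (fun k => `|v k|) n.+1).
  by rewrite -[leLHS]/(series (fun k => `|v k|) n) !seriesEnat/= big_nat_recr//= lerDl.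
exists M => _ [n _ <-]; apply: le_trans (hM n).
by apply: ler_sum => k _; exact: vu.
Qed.

End dominated_series.

(** * Blocks with small sup norm and large coefficient sum *)

Section blocks.

Context {R : realType}.
Local Notation r := (4 / 5 : R).

Lemma cabs_i : cabs ('i : R[i]) = 1.
Proof. by rewrite cabsE /= expr0n/= add0r expr1n sqrtr1. Qed.

(* [|2/5 + (3/5) i z + (2/5) z^2| = |(4/5) cos t + (3/5) i| <= 1] for [z = exp (i t)]. *)
Definition digit (d : nat) : R[i] := if d == 1%N then 'i * (3 / 5)%:C else (2 / 5)%:C.

(** The product of [digit d] over the [j] ternary digits [d] of [k], that is, the coefficient of
    [z^k] in the product over [i < j] of the trinomials in [z^(3^i)]. Ternary expansions are unique,
    so the product has no cancellation. *)
Fixpoint qc (j k : nat) : R[i] :=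
  if j is j'.+1 then digit (k %% 3) * qc j' (k %/ 3) else 1.

Lemma big_nat3 (V : nmodType) (F : nat -> V) n :
  \sum_(0 <= k < 3 * n) F k =
  \sum_(0 <= k < n) (F (3 * k)%N + F (3 * k + 1)%N + F (3 * k + 2)%N).
Proof.
elim: n => [|n IH]; first by rewrite muln0 !big_nil.
rewrite mulnS addnC addn3 3?big_nat_recr// IH big_nat_recr//= addn1 addn2.
by rewrite !addrA.
Qed.

Lemma qcS j k d : (d < 3)%N -> qc j.+1 (3 * k + d) = digit d * qc j k.
Proof.
by move=> d3; rewrite /= mulnC modnMDl modn_small// divnMDl// divn_small// addn0.
Qed.

Lemma qcS0 j k : qc j.+1 (3 * k) = digit 0 * qc j k.
Proof. by rewrite -[(3 * k)%N]addn0 qcS. Qed.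

Definition Qp j (z : R[i]) : R[i] := \sum_(0 <= k < 3 ^ j) qc j k * z ^+ k.

Lemma QpS j z : Qp j.+1 z = (digit 0 + digit 1 * z + digit 2 * z ^+ 2) * Qp j (z ^+ 3).
Proof.
rewrite /Qp expnS big_nat3 mulr_sumr; apply: eq_bigr => k _.
rewrite qcS0 !qcS// -exprM addn1 addn2 !exprSr; move: (z ^+ (3 * k)) => Z; rewrite expr0; ring.
Qed.

Lemma Qp_bound j z : cabs z = 1 -> cabs (Qp j z) <= 1.
Proof.
elim: j z => [|j IH] z z1.
  by rewrite /Qp expn0 big_nat1 mul1r expr0 cabs1.
rewrite QpS cabsM mulr_ile1 ?cabs_ge0//; last by apply: IH; rewrite cabsX z1 expr1n.
rewrite -(@ler_pXn2r _ 2) ?nnegrE ?cabs_ge0// expr1n cabs_sqr.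
have := cabs_sqr z; rewrite z1 expr1n; case: z {z1} => x y s1; rewrite /= in s1.
set s : R := x ^+ 2 + y ^+ 2 in s1.
have -> : complex.Re (digit 0 + digit 1 * (x +i* y) + digit 2 * (x +i* y) ^+ 2) =
    2 / 5 - 3 / 5 * y + 2 / 5 * (x ^+ 2 - y ^+ 2).
  by rewrite /digit !ReD expr2 !ReM !ImM /=; field.
have -> : complex.Im (digit 0 + digit 1 * (x +i* y) + digit 2 * (x +i* y) ^+ 2) =
    3 / 5 * x + 4 / 5 * (x * y).
  by rewrite /digit !ImD expr2 !ImM !ReM /=; field.
(* The squared modulus is [(16 x^2 + 9) / 25] plus multiples of [s - 1], which vanish on the unit
   circle. *)
have -> : (2 / 5 - 3 / 5 * y + 2 / 5 * (x ^+ 2 - y ^+ 2)) ^+ 2 +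
    (3 / 5 * x + 4 / 5 * (x * y)) ^+ 2 =
  (16 * x ^+ 2 + 9) / 25 + 4 / 25 * (s - 1) ^+ 2 + 9 / 25 * (s - 1) + 12 / 25 * y * (s - 1).
  by rewrite /s; field.
rewrite -s1 subrr expr0n/= !mulr0 !addr0.
have : x ^+ 2 <= 1 by rewrite s1 /s lerDl sqr_ge0.
by lra.
Qed.

Lemma qc_l1 j : \sum_(0 <= k < 3 ^ j) cabs (qc j k) = (7 / 5) ^+ j.
Proof.
elim: j => [|j IH]; first by rewrite expn0 big_nat1 cabs1 expr0.
rewrite expnS big_nat3 exprS -IH mulr_sumr; apply: eq_bigr => k _.
rewrite qcS0 !qcS// (cabsM (digit 0)) (cabsM (digit 1)) -!mulrDl; congr (_ * _).
have d0 : cabs (digit 0) = 2 / 5 by rewrite cabs_real ger0_norm ?divr_ge0.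
have d1 : cabs (digit 1) = 3 / 5.
  have -> : digit 1 = 'i * (3 / 5)%:C :> R[i] by [].
  by rewrite cabsM cabs_i mul1r cabs_real ger0_norm ?divr_ge0.
rewrite d0 d1; lra.
Qed.

(** The indices of block [j] stay below [3^j], so the exponent [3 j + 3] leaves frequencies of order
    [9^(-j)], while the coefficient sums grow like [(7/5)^j] only. *)
Definition lam (j : nat) : R := 2 / 3 ^+ (3 * j + 3).
(** The offset in [3 k + 1] keeps the fraction in lowest terms over [3^(3 j + 3)]; the denominator
    then identifies the block, and distinct blocks have disjoint spectra. *)
Definition freq (j k : nat) : R := (3 * k + 1)%:R * lam j.
Definition coef (j k : nat) : R[i] := (r ^+ j)%:C * qc j k.

Lemma lam_gt0 j : 0 < lam j.
Proof. by rewrite divr_gt0// exprn_gt0. Qed.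

Lemma freq_bound j k : (k < 3 ^ j)%N -> 0 < freq j k <= 2 / 9 * (9^-1) ^+ j.
Proof.
move=> kj; rewrite /freq mulr_gt0 ?lam_gt0 ?ltr0n ?addn1//=.
have k3 : (3 * k).+1%:R <= (3 : R) * 3 ^+ j.
  by rewrite -natrX -natrM ler_nat; move: (3 ^ j)%N kj => m; lia.
apply: (@le_trans _ _ (3 * 3 ^+ j * lam j)); first by rewrite ler_wpM2r// ltW// lam_gt0.
have p3 : (3 : R) ^+ j != 0 by rewrite expf_neq0.
have e1 : (3 : R) ^+ (3 * j + 3) = (3 ^+ j) ^+ 3 * 27.
  by rewrite exprD mulnC exprM; congr (_ * _); rewrite !exprS expr0; lra.
have e2 : (9 : R)^-1 ^+ j = (3 ^+ j) ^- 2.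
  rewrite exprVn -exprM mulnC exprM; congr (_ ^+ _)^-1; rewrite expr2; lra.
rewrite /lam e1 e2 le_eqVlt; apply/orP; left; apply/eqP; field.
by rewrite p3.
Qed.

(** Since [(7/5) / 9 < 1], the small frequencies absorb the coefficient sum. The derivative of a
    block is thus of order [r^j] by absolute values alone, although the block itself owes this order
    to cancellation. *)
Lemma coef_freq j : \sum_(0 <= k < 3 ^ j) cabs (coef j k) * freq j k <= r ^+ j.
Proof.
have c1 : forall k, (0 <= k < 3 ^ j)%N ->
   cabs (coef j k) * freq j k <= (r ^+ j * (2 / 9 * (9^-1) ^+ j)) * cabs (qc j k).
  move=> k /andP[_ kj]; have /andP[f0 f1] := freq_bound kj.
  rewrite cabsM cabs_real ger0_norm ?exprn_ge0 ?divr_ge0// -mulrA [leRHS]mulrAC -mulrA.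
  by rewrite ler_wpM2l ?exprn_ge0 ?divr_ge0// ler_wpM2l ?cabs_ge0.
apply: le_trans (ler_sum_nat c1) _.
rewrite -mulr_sumr qc_l1 -[leRHS]mulr1 -[leLHS]mulrA; apply: ler_wpM2l.
  by rewrite exprn_ge0 ?divr_ge0.
have h : (9^-1 * (7 / 5) : R) ^+ j <= 1 by rewrite exprn_ile1//; lra.
by move: h; rewrite exprMn; lra.
Qed.

Lemma coef_freq2 j : \sum_(0 <= k < 3 ^ j) cabs (coef j k) * freq j k ^+ 2 <= r ^+ j.
Proof.
apply: le_trans (coef_freq j); apply: ler_sum_nat => k /andP[_ kj].
have /andP[f0 f1] := freq_bound kj.
rewrite ler_wpM2l ?cabs_ge0// expr2 ler_piMr ?(ltW f0)//.
apply: le_trans f1 _; rewrite mulr_ile1 ?exprn_ile1 ?exprn_ge0 ?invr_ge0//; lra.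
Qed.

Definition blk (j : nat) (t : R) : R[i] :=
  \sum_(0 <= k < 3 ^ j) coef j k * expi (freq j k * t).

Definition dblk (j : nat) (t : R) : R[i] :=
  \sum_(0 <= k < 3 ^ j) coef j k * ('i * (freq j k)%:C * expi (freq j k * t)).

Lemma blk_bound j t : cabs (blk j t) <= r ^+ j.
Proof.
(* The offset in [3 k + 1] splits off as a unimodular factor, leaving [Qp] at the point
   [expi (3 lam t)] of the unit circle. *)
have -> : blk j t = (r ^+ j)%:C * (expi (lam j * t) * Qp j (expi (lam j * t *+ 3))).
  rewrite /blk /Qp !mulr_sumr; apply: eq_bigr => k _.
  have -> : expi (freq j k * t) = expi (lam j * t) * expi (lam j * t *+ 3) ^+ k.
    rewrite -expiMn -expiD; congr expi; rewrite /freq -mulrnA -mulr_natr.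
    by rewrite natrD natrM; ring.
  by rewrite /coef; ring.
rewrite !cabsM cabs_expi mul1r cabs_real ger0_norm ?exprn_ge0 ?divr_ge0//.
by rewrite ler_piMr ?exprn_ge0 ?divr_ge0// Qp_bound// cabs_expi.
Qed.

Lemma blk_quad j (t h : R) :
  cabs (blk j (t + h) - blk j t - h%:C * dblk j t) <= 2 * r ^+ j * h ^+ 2.
Proof.
rewrite /blk /dblk mulr_sumr -!sumrB.
apply: le_trans (cabs_sum _ _ _) _.
apply: (@le_trans _ _ (\sum_(0 <= k < 3 ^ j) (2 * h ^+ 2) * (cabs (coef j k) * freq j k ^+ 2))).
  apply: ler_sum => k _.
  have -> : coef j k * expi (freq j k * (t + h)) - coef j k * expi (freq j k * t) -
     h%:C * (coef j k * ('i * (freq j k)%:C * expi (freq j k * t))) =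
    coef j k * expi (freq j k * t) * (expi (freq j k * h) - 1 - 'i * (freq j k * h)%:C).
    have -> : (freq j k * h)%:C = (freq j k)%:C * h%:C by rewrite -rmorphM.
    have -> : expi (freq j k * (t + h)) = expi (freq j k * t) * expi (freq j k * h).
      by rewrite -expiD mulrDr.
    ring.
  rewrite (cabsM (coef j k * _)) (cabsM (coef j k)) cabs_expi mulr1 [leRHS]mulrCA ler_wpM2l ?cabs_ge0//.
  by apply: le_trans (expi_sub1B_le _) _; rewrite exprMn; lra.
by rewrite -mulr_sumr [leRHS]mulrAC; apply: ler_wpM2l (coef_freq2 j); rewrite mulr_ge0 ?sqr_ge0.
Qed.

Lemma dblk_bound j t : cabs (dblk j t) <= r ^+ j.
Proof.
apply: le_trans (cabs_sum _ _ _) _; apply: le_trans (coef_freq j).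
apply: ler_sum_nat => k /andP[_ kj]; have /andP[f0 _] := freq_bound kj.
rewrite (cabsM (coef j k)) (cabsM ('i * _)) (cabsM 'i) cabs_expi cabs_i cabs_real.
by rewrite (gtr0_norm f0) mulr1 mul1r.
Qed.

Lemma blk_lip j (t u : R) : cabs (blk j t - blk j u) <= r ^+ j * `|t - u|.
Proof.
rewrite /blk -sumrB; apply: le_trans (cabs_sum _ _ _) _.
apply: (@le_trans _ _ (\sum_(0 <= k < 3 ^ j) `|t - u| * (cabs (coef j k) * freq j k))).
  apply: ler_sum_nat => k /andP[_ kj]; have /andP[f0 _] := freq_bound kj.
  rewrite -mulrBr (cabsM (coef j k)) [leRHS]mulrCA ler_wpM2l ?cabs_ge0//.
  by apply: le_trans (expi_lip _ _) _; rewrite -mulrBr normrM (gtr0_norm f0) mulrC.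
by rewrite -mulr_sumr mulrC; apply: ler_wpM2r (coef_freq j).
Qed.

Lemma dblk_lip j (t u : R) : cabs (dblk j t - dblk j u) <= r ^+ j * `|t - u|.
Proof.
rewrite /dblk -sumrB; apply: le_trans (cabs_sum _ _ _) _.
apply: (@le_trans _ _ (\sum_(0 <= k < 3 ^ j) `|t - u| * (cabs (coef j k) * freq j k ^+ 2))).
  apply: ler_sum_nat => k /andP[_ kj]; have /andP[f0 _] := freq_bound kj.
  rewrite -mulrBr -mulrBr (cabsM (coef j k)) [leRHS]mulrCA ler_wpM2l ?cabs_ge0//.
  rewrite !cabsM cabs_i mul1r cabs_real (gtr0_norm f0) mulrC.
  apply: le_trans (ler_wpM2r (ltW f0) (expi_lip _ _)) _.
  by rewrite -mulrBr normrM (gtr0_norm f0) expr2; lra.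
by rewrite -mulr_sumr mulrC; apply: ler_wpM2r (coef_freq2 j).
Qed.

End blocks.

(** * The witness function and its smoothness *)

Section witness.
Context {R : realType}.
Local Notation r := (4 / 5 : R).
Implicit Types (t h u : R) (x : R * R).

(** The modulation moves the small positive frequencies of the block to just above [1], away from
    the origin, where infinitely many dyadic annuli accumulate. *)
Definition wv (j : nat) t : R[i] := expi t * blk j t.
Definition dwv (j : nat) t : R[i] := expi t * ('i * blk j t + dblk j t).

Lemma r_ge0 j : 0 <= r ^+ j.
Proof. by rewrite exprn_ge0 ?divr_ge0. Qed.

Lemma wv_gdom t : gdom 1 (wv ^~ t).
Proof. by move=> j; rewrite cabsM cabs_expi !mul1r blk_bound. Qed.

Lemma dwv_gdom t : gdom 2 (dwv ^~ t).
Proof.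
move=> j; rewrite cabsM cabs_expi mul1r mulr_natl mulr2n.
by apply: le_trans (cabsD _ _) _; rewrite cabsM cabs_i mul1r lerD ?blk_bound ?dblk_bound.
Qed.

Lemma wv_quad t h : gdom (5 * h ^+ 2) (fun j => wv j (t + h) - wv j t - h%:C * dwv j t).
Proof.
move=> j; rewrite /wv /dwv.
(* Product rule with remainder: [5 = 2 + 2 + 1], from the exponential, the block and the mixed
   term. *)
have -> : expi (t + h) * blk j (t + h) - expi t * blk j t -
    h%:C * (expi t * ('i * blk j t + dblk j t)) =
  expi t * ((expi h - 1 - 'i * h%:C) * blk j t +
            (expi h * (blk j (t + h) - blk j t - h%:C * dblk j t) +
             h%:C * (expi h - 1) * dblk j t)).
  by rewrite expiD; ring.
rewrite cabsM cabs_expi mul1r.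
have r0 := r_ge0 j.
have e1 := expi_sub1B_le h; have e2 := expi_sub1_le h.
have b1 := blk_bound j t; have b2 := blk_quad j t h; have b3 := dblk_bound j t.
apply: le_trans (cabsD _ _) _; apply: le_trans (lerD (lexx _) (cabsD _ _)) _.
rewrite cabsM (cabsM (expi h)) cabs_expi mul1r cabsM (cabsM h%:C) cabs_real.
have h1 : cabs (expi h - 1 - 'i * h%:C) * cabs (blk j t) <= 2 * h ^+ 2 * r ^+ j.
  by apply: ler_pM => //; exact: cabs_ge0.
have h2 : `|h| * cabs (expi h - 1) * cabs (dblk j t) <= h ^+ 2 * r ^+ j.
  apply: ler_pM => //; rewrite ?cabs_ge0 ?mulr_ge0 ?cabs_ge0//.
  by rewrite -[leRHS](real_normK (num_real h)) expr2 ler_wpM2l.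
have -> : 5 * h ^+ 2 * r ^+ j = 2 * h ^+ 2 * r ^+ j + (2 * r ^+ j * h ^+ 2 + h ^+ 2 * r ^+ j).
  by ring.
by apply: lerD h1 (lerD b2 h2).
Qed.

Lemma wv_lip t u : gdom (2 * `|t - u|) (fun j => wv j t - wv j u).
Proof.
move=> j; rewrite /wv.
have -> : expi t * blk j t - expi u * blk j u =
  (expi t - expi u) * blk j t + expi u * (blk j t - blk j u) by ring.
apply: le_trans (cabsD _ _) _; rewrite !cabsM cabs_expi mul1r.
have -> : 2 * `|t - u| * r ^+ j = `|t - u| * r ^+ j + r ^+ j * `|t - u| by ring.
apply: lerD; last exact: blk_lip.
by apply: ler_pM; rewrite ?cabs_ge0 ?expi_lip ?blk_bound.
Qed.

Lemma dwv_lip t u : gdom (4 * `|t - u|) (fun j => dwv j t - dwv j u).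
Proof.
move=> j; rewrite /dwv.
have -> : expi t * ('i * blk j t + dblk j t) - expi u * ('i * blk j u + dblk j u) =
  (expi t - expi u) * ('i * blk j t + dblk j t) +
  expi u * ('i * (blk j t - blk j u) + (dblk j t - dblk j u)) by ring.
apply: le_trans (cabsD _ _) _; rewrite !cabsM cabs_expi mul1r.
have -> : 4 * `|t - u| * r ^+ j =
   `|t - u| * (r ^+ j + r ^+ j) + (r ^+ j * `|t - u| + r ^+ j * `|t - u|) by ring.
apply: lerD.
  apply: ler_pM; rewrite ?cabs_ge0 ?expi_lip//.
  by apply: le_trans (cabsD _ _) _; rewrite cabsM cabs_i mul1r lerD ?blk_bound ?dblk_bound.
apply: le_trans (cabsD _ _) _; rewrite cabsM cabs_i mul1r.
by apply: lerD; [exact: blk_lip|exact: dblk_lip].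
Qed.

Definition gfun t : R[i] := csum (wv ^~ t).
Definition dgfun t : R[i] := csum (dwv ^~ t).

Lemma gfun_bound t : cabs (gfun t) <= 5.
Proof. by have := csum_bound (wv_gdom t); rewrite mulr1. Qed.

Lemma gfun_quad t h : cabs (gfun (t + h) - gfun t - h%:C * dgfun t) <= 25 * h ^+ 2.
Proof.
have s1 u : csummable (wv ^~ u) := gdom_csummable (wv_gdom u).
have s2 : csummable (dwv ^~ t) := gdom_csummable (dwv_gdom t).
have -> : gfun (t + h) - gfun t - h%:C * dgfun t =
   csum (fun j => wv j (t + h) - wv j t - h%:C * dwv j t).
  rewrite /gfun /dgfun -mulNr -[- csum _]mulN1r -(csumZ _ (s1 t)) -(csumZ _ s2).
  rewrite -(csumD (s1 _) (csummableZ _ (s1 _))).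
  rewrite -(csumD (csummableD (s1 _) (csummableZ _ (s1 _))) (csummableZ _ s2)).
  by congr csum; apply/funext => j; rewrite mulN1r mulNr.
apply: le_trans (csum_bound (wv_quad t h)) _; lra.
Qed.

Lemma gfun_lip t u : cabs (gfun t - gfun u) <= 10 * `|t - u|.
Proof.
rewrite /gfun csumB; [|exact: gdom_csummable (wv_gdom _)..].
apply: le_trans (csum_bound (wv_lip t u)) _; lra.
Qed.

Lemma dgfun_lip t u : cabs (dgfun t - dgfun u) <= 20 * `|t - u|.
Proof.
rewrite /dgfun csumB; [|exact: gdom_csummable (dwv_gdom _)..].
apply: le_trans (csum_bound (dwv_lip t u)) _; lra.
Qed.

Definition ffun x : R[i] := gfun (x.1 + x.2).

Lemma dist_sum x (y : R * R) : `|(x.1 + x.2) - (y.1 + y.2)| <= `|x.1 - y.1| + `|x.2 - y.2|.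
Proof. by rewrite opprD addrACA ler_normD. Qed.

Lemma ffun_derive_Re b x : is_derive x (axis R b) (fun y => complex.Re (ffun y))
  (complex.Re (dgfun (x.1 + x.2))).
Proof.
apply: (@is_derive_quad _ _ _ _ _ 25) => t.
have E : t *: axis R b + x = (t * (axis R b).1 + x.1, t * (axis R b).2 + x.2) by [].
have -> : ffun (t *: axis R b + x) = gfun (x.1 + x.2 + t).
  by rewrite E /ffun; congr gfun; case: b {E} => /=; ring.
apply: le_trans (gfun_quad (x.1 + x.2) t).
by apply: le_trans (cabs_Re _); rewrite !ReD !ReN ReM/= mul0r subr0.
Qed.

Lemma ffun_derive_Im b x : is_derive x (axis R b) (fun y => complex.Im (ffun y))
  (complex.Im (dgfun (x.1 + x.2))).
Proof.
apply: (@is_derive_quad _ _ _ _ _ 25) => t.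
have E : t *: axis R b + x = (t * (axis R b).1 + x.1, t * (axis R b).2 + x.2) by [].
have -> : ffun (t *: axis R b + x) = gfun (x.1 + x.2 + t).
  by rewrite E /ffun; congr gfun; case: b {E} => /=; ring.
apply: le_trans (gfun_quad (x.1 + x.2) t).
by apply: le_trans (cabs_Im _); rewrite !ImD !ImN ImM/= mul0r addr0.
Qed.

Lemma ffun_contdiff : contdiff ffun.
Proof.
move=> b; split; first by move=> x; have [? _] := ffun_derive_Re b x;
  have [? _] := ffun_derive_Im b x.
have -> : rpartial [:: b] (fun y => complex.Re (ffun y)) =
   (fun x => complex.Re (dgfun (x.1 + x.2))).
  by apply/funext => x; have [_ <-] := ffun_derive_Re b x.
have -> : rpartial [:: b] (fun y => complex.Im (ffun y)) =
   (fun x => complex.Im (dgfun (x.1 + x.2))).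
  by apply/funext => x; have [_ <-] := ffun_derive_Im b x.
have l x y : cabs (dgfun (x.1 + x.2) - dgfun (y.1 + y.2)) <=
    20 * (`|x.1 - y.1| + `|x.2 - y.2|).
  by apply: le_trans (dgfun_lip _ _) _; rewrite ler_wpM2l// dist_sum.
split; apply: (@lipschitz_continuous _ _ 20) => x y; apply: le_trans _ (l x y).
  by apply: le_trans (cabs_Re _); rewrite ReD ReN.
by apply: le_trans (cabs_Im _); rewrite ImD ImN.
Qed.

Lemma ffun_measurable : cmeasurable ffun.
Proof.
have l x y : cabs (ffun x - ffun y) <= 10 * (`|x.1 - y.1| + `|x.2 - y.2|).
  by apply: le_trans (gfun_lip _ _) _; rewrite ler_wpM2l// dist_sum.
split; apply: continuous_measurable_plane;
  apply: (@lipschitz_continuous _ _ 10) => x y; apply: le_trans _ (l x y).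
  by apply: le_trans (cabs_Re _); rewrite ReD ReN.
by apply: le_trans (cabs_Im _); rewrite ImD ImN.
Qed.

Lemma wv_wave j x : wv j (x.1 + x.2) =
  \sum_(0 <= k < 3 ^ j) coef j k * expi (dotp x (1 + freq j k, 1 + freq j k)).
Proof.
rewrite /wv /blk mulr_sumr; apply: eq_bigr => k _.
rewrite mulrCA -expiD; congr (_ * expi _); rewrite /dotp/=; ring.
Qed.

End witness.

(** * Convolution of the witness with the kernels *)

Section convolution.
Context {R : realType}.
Variables (w : R -> R) (hw : cutoff w).
Local Notation r := (4 / 5 : R).
Local Notation leb := (leb2 R).
Implicit Types (x y : R * R) (a : R).

Definition diag (j k : nat) : R * R := (1 + freq j k, 1 + freq j k).

(** The modulus is [sqrt 2 * (1 + freq)] with [freq] in []0, 2/9]]. *)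
Lemma rho_diag j k : (k < 3 ^ j)%N -> 1 < rho (diag j k) < 2.
Proof.
move=> /(@freq_bound R) /andP[f0 f1].
have f29 : freq j k <= 2 / 9 :> R.
  apply: le_trans f1 _; rewrite ler_piMr ?divr_ge0//.
  by rewrite exprn_ile1 ?invr_ge0// invf_le1// ler1n.
rewrite /rho /diag /=; set f : R := freq j k in f0 f1 f29 *.
rewrite -{1}(@sqrtr1 R) ltr_sqrt; last by nra.
apply/andP; split; first by nra.
have -> : 2 = Num.sqrt (2 ^+ 2) :> R by rewrite sqrtr_sqr ger0_norm.
by rewrite ltr_sqrt; nra.
Qed.

Definition wave_conv a x : R[i] := distr_conv (regular_distr (@ffun R)) (Wker w a) x.

Definition wave_convN a N x : R[i] := \sum_(0 <= j < N) \sum_(0 <= k < 3 ^ j)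
  coef j k * ((w (rho (diag j k) * a))%:C * expi (dotp x (diag j k))).

Section fixed_scale.
Variables (a : R) (a0 : 0 < a).

Lemma Wker_shift_measurable x : cmeasurable (fun y => Wker w a (x.1 - y.1, x.2 - y.2)).
Proof.
have cs : continuous (fun y : R * R => (x.1 - y.1, x.2 - y.2)).
  move=> y; apply/cvg_ballP => e e0; have : nbhs y (ball y e) by exact: nbhsx_ballx.
  apply: filterS => y' [/= b1 b2]; split; rewrite /ball/=.
    by rewrite [X in `|X|](_ : _ = - (y.1 - y'.1)) ?normrN//; ring.
  by rewrite [X in `|X|](_ : _ = - (y.2 - y'.2)) ?normrN//; ring.
have [c1 c2] := Wker_continuous hw a0.
split; apply: continuous_measurable_plane => y.
  exact: (continuous_comp (cs y) (c1 _)).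
exact: (continuous_comp (cs y) (c2 _)).
Qed.

Lemma Wker_shift_dom : exists2 D : R, 0 <= D & forall x y,
  cabs (Wker w a (x.1 - y.1, x.2 - y.2)) <=
    D * (poisson 1 (y.1 - x.1) * poisson 1 (y.2 - x.2)).
Proof.
have [D D0 hD] := schwartz_weight (Wker_schwartz hw a0); exists D => // x y.
apply: le_trans (hD _) _; rewrite /pweight/=.
by rewrite -(opprB y.1) -(opprB y.2) /poisson !sqrrN.
Qed.

Lemma Wker_shift_cinteg (g : R * R -> R[i]) (M : R) x : cmeasurable g ->
  (forall y, cabs (g y) <= M) ->
  cinteg leb (fun y => g y * Wker w a (x.1 - y.1, x.2 - y.2)).
Proof.
move=> mg gM; have [D D0 hD] := Wker_shift_dom.
have M0 : 0 <= M by exact: le_trans (cabs_ge0 _) (gM 0).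
apply: (@cinteg_dom _ _ R leb _ _ _
  (integrable_scale (M * D) (integrable_poisson2 x ltr01))).
  by apply: cmeasurableM; [exact: mg|exact: Wker_shift_measurable].
by move=> y; rewrite cabsM -mulrA; apply: ler_pM; rewrite ?cabs_ge0.
Qed.

Lemma wave_conv_partial N x :
  cint (fun y => (\sum_(0 <= j < N) wv j (y.1 + y.2)) * Wker w a (x.1 - y.1, x.2 - y.2)) =
  wave_convN a N x.
Proof.
have ie (lambda : R * R) : cinteg leb (fun y => expi (dotp y lambda) * Wker w a (x.1 - y.1, x.2 - y.2)).
  apply: (@Wker_shift_cinteg _ 1); last by move=> y; rewrite cabs_expi.
  by apply: cmeasurable_expi; have := measurable_dotp lambda 1; under eq_fun do rewrite mul1r.
transitivity (cintg leb (fun y => \sum_(0 <= j < N) \sum_(0 <= k < 3 ^ j)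
   coef j k * (expi (dotp y (diag j k)) * Wker w a (x.1 - y.1, x.2 - y.2)))).
  apply: eq_cintg => y; rewrite mulr_suml; apply: eq_bigr => j _.
  by rewrite wv_wave mulr_suml; apply: eq_bigr => k _; rewrite mulrA.
rewrite cintg_sum; last first.
  by move=> j; apply: cinteg_sum => k; apply: cintegZ; exact: ie.
apply: eq_bigr => j _; rewrite cintg_sum; last by move=> k; apply: cintegZ; exact: ie.
apply: eq_bigr => k _; rewrite (cintgZ _ (ie _)); congr (_ * _).
exact: Wker_conv.
Qed.

(** The remainder of the series has sup norm at most [5 r^N] and the kernel is integrable, so the
    estimate is uniform in [x]. Its case [N = 0] is the boundedness of the convolution. *)
Lemma wave_conv_tail : exists2 C : R, 0 <= C & forall N x,
  cabs (wave_conv a x - wave_convN a N x) <= C * r ^+ N.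
Proof.
have [D D0 hD] := Wker_shift_dom.
exists (2 * (5 * D * pi ^+ 2)); first by rewrite !mulr_ge0// pi_ge0.
move=> N x; rewrite -wave_conv_partial.
pose fN y : R[i] := \sum_(0 <= j < N) wv j (y.1 + y.2).
have mfN : cmeasurable fN.
  rewrite /fN; apply: cmeasurable_sum => j; rewrite (funext (@wv_wave R j)).
  apply: cmeasurable_sum => k; apply: cmeasurableM; first exact: cmeasurable_cst.
  by apply: cmeasurable_expi; have := measurable_dotp (diag j k) 1; under eq_fun do rewrite mul1r.
have dfN y : cabs (ffun y - fN y) <= 5 * r ^+ N.
  by have := csum_tail N (wv_gdom (y.1 + y.2)); rewrite mulr1.
have i1 : cinteg leb (fun y => ffun y * Wker w a (x.1 - y.1, x.2 - y.2)).
  by apply: (@Wker_shift_cinteg _ 5); [exact: ffun_measurable|move=> y; exact: gfun_bound].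
have bfN y : cabs (fN y) <= 5 + 5.
  have -> : fN y = ffun y - (ffun y - fN y) by rewrite opprB addrC subrK.
  apply: le_trans (cabsD _ _) _; rewrite cabsN; apply: lerD; first exact: gfun_bound.
  by apply: le_trans (dfN y) _; rewrite ler_piMr// exprn_ile1//; lra.
have i2 : cinteg leb (fun y => fN y * Wker w a (x.1 - y.1, x.2 - y.2)).
  exact: Wker_shift_cinteg mfN bfN.
have -> : wave_conv a x - cint (fun y => fN y * Wker w a (x.1 - y.1, x.2 - y.2)) =
   cintg leb (fun y => (ffun y - fN y) * Wker w a (x.1 - y.1, x.2 - y.2)).
  have i3 := cintegZ (-1) i2.
  rewrite -mulN1r -[-1 * _](cintgZ _ i2) -[LHS](cintgD i1 i3).
  by apply: eq_cintg => y; ring.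
have iG := integrable_scale (5 * r ^+ N * D) (integrable_poisson2 x ltr01).
have i4 : cinteg leb (fun y => (ffun y - fN y) * Wker w a (x.1 - y.1, x.2 - y.2)).
  apply: (@Wker_shift_cinteg _ (5 * r ^+ N)); last exact: dfN.
  by apply: cmeasurableD; [exact: ffun_measurable|exact: cmeasurableN].
have hb y : cabs ((ffun y - fN y) * Wker w a (x.1 - y.1, x.2 - y.2)) <=
    5 * r ^+ N * D * (poisson 1 (y.1 - x.1) * poisson 1 (y.2 - x.2)).
  by rewrite cabsM -mulrA; apply: ler_pM; rewrite ?cabs_ge0.
apply: le_trans (cabs_cintg_le i4 iG hb) _.
rewrite RintegralZl//; last exact: integrable_poisson2.
by rewrite Rintegral_poisson2// le_eqVlt; apply/orP; left; apply/eqP; ring.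
Qed.

Lemma wave_conv_bound : exists2 C : R, 0 <= C & forall x, cabs (wave_conv a x) <= C.
Proof.
have [C C0 h] := wave_conv_tail; exists C => // x.
by have := h 0%N x; rewrite /wave_convN big_geq// subr0 expr0 mulr1.
Qed.

Lemma wave_conv_cvg x :
  cabs (wave_conv a x - wave_convN a N x) @[N --> \oo] --> (0 : R).
Proof.
have [C C0 h] := wave_conv_tail.
have hr : C * r ^+ N @[N --> \oo] --> (0 : R).
  rewrite -(mulr0 C); apply: cvgM; first exact: cvg_cst.
  by apply: cvg_expr; rewrite ger0_norm; lra.
by apply: cvg0_le hr => N; rewrite cabs_ge0 h.
Qed.

Lemma wave_conv_measurable : cmeasurable (wave_conv a).
Proof.
have mN N : cmeasurable (wave_convN a N).
  apply: cmeasurable_sum => j; apply: cmeasurable_sum => k.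
  apply: cmeasurableM; first exact: cmeasurable_cst.
  apply: cmeasurableM; first exact: cmeasurable_cst.
  by apply: cmeasurable_expi; have := measurable_dotp (diag j k) 1; under eq_fun do rewrite mul1r.
split.
  apply: (@measurable_fun_cvg _ _ R setT (fun N x => complex.Re (wave_convN a N x))).
    by move=> N; exact: (mN N).1.
  move=> x _; apply/cvgrPdist_le => e e0.
  have /cvgrPdist_le/(_ e e0) := wave_conv_cvg x; apply: filterS => N.
  rewrite sub0r normrN ger0_norm ?cabs_ge0//; apply: le_trans.
  by apply: le_trans (cabs_Re _); rewrite ReD ReN.
apply: (@measurable_fun_cvg _ _ R setT (fun N x => complex.Im (wave_convN a N x))).
  by move=> N; exact: (mN N).2.
move=> x _; apply/cvgrPdist_le => e e0.
have /cvgrPdist_le/(_ e e0) := wave_conv_cvg x; apply: filterS => N.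
rewrite sub0r normrN ger0_norm ?cabs_ge0//; apply: le_trans.
by apply: le_trans (cabs_Im _); rewrite ImD ImN.
Qed.

Lemma cabs_cvg0_eq0 (z : R[i]) (h : nat -> R) : (forall N, cabs z <= h N) ->
  h N @[N --> \oo] --> (0 : R) -> z = 0.
Proof.
move=> zh h0; apply: cabs_eq0; apply/eqP; rewrite eq_le cabs_ge0 andbT.
by apply: (cvgr_to_ge h0); apply: nearW.
Qed.

(** For [2 <= a] the values [rho * a] exceed [2], for [a <= 1/4] they are below [1/2]: the support
    of [w] kills every wave. *)
Lemma wave_conv0 x : 2 <= a \/ a <= 4^-1 -> wave_conv a x = 0.
Proof.
move=> ha; apply: (cabs_cvg0_eq0 _ (wave_conv_cvg x)) => N.
rewrite [wave_convN a N x](_ : _ = 0) ?subr0//.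
rewrite /wave_convN big1// => j _; rewrite big_nat_cond big1// => k /andP[/andP[_ kj] _].
have /andP[r1 r2] := rho_diag kj.
have := @cutoff_out R w hw 0 (rho (diag j k) * a); rewrite /= => ->; first by rewrite mul0r mulr0.
by case: ha => ha; [right; nra|left; nra].
Qed.

End fixed_scale.

(** The identity [w s = 1 - w (s / 2)] on [[1, 2]] makes the two cutoffs add up to [1] on the
    spectrum. *)
Lemma wave_conv_split x : wave_conv 1 x + wave_conv 2^-1 x = ffun x.
Proof.
have a1 : 0 < (1 : R) by []; have a2 : 0 < (2^-1 : R) by rewrite invr_gt0.
have hs := cvg0D (cvg0D (wave_conv_cvg a1 x) (wave_conv_cvg a2 x))
  (csum_cvg (gdom_csummable (wv_gdom (x.1 + x.2)))).
apply/eqP; rewrite -subr_eq0; apply/eqP.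
apply: (cabs_cvg0_eq0 _ hs) => N.
have E : wave_convN 1 N x + wave_convN 2^-1 N x = \sum_(0 <= j < N) wv j (x.1 + x.2).
  rewrite -big_split; apply: eq_bigr => j _; rewrite /= wv_wave -big_split.
  apply: eq_big_nat => k /andP[_ kj]; rewrite /= -mulrDr -mulrDl; congr (_ * _).
  have /andP[r1 r2] := rho_diag kj; rewrite mulr1 -rmorphD/=.
  case: hw => _ _ _ /(_ (rho (diag j k))) ->; last by rewrite !ltW.
  by rewrite subrK mul1r.
have key (A B F p q s : R[i]) : p + q = s -> A + B - F = ((A - p) + (B - q)) - (F - s).
  by move=> <-; ring.
rewrite (key _ _ _ _ _ _ E).
apply: le_trans (cabsD _ _) _; rewrite cabsN; apply: lerD; last exact: lexx.
exact: cabsD.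
Qed.

End convolution.

(** * Tempered distributions given by bounded functions *)

Section schwartz_closure.
Context {R : realType}.
Implicit Types phi psi : R * R -> R[i].

Lemma rpartial_cat s1 s2 (g : R * R -> R) : rpartial s1 (rpartial s2 g) = rpartial (s1 ++ s2) g.
Proof. by rewrite /rpartial foldr_cat. Qed.

Lemma schwartz_cpartial s phi : schwartz phi -> schwartz (cpartial s phi).
Proof.
move=> [s1 s2 s3]; split.
- by move=> s'; rewrite [rpartial s' _]rpartial_cat; exact: s1.
- by move=> s'; rewrite [rpartial s' _]rpartial_cat; exact: s2.
- move=> s' m n; have [C hC] := s3 (s' ++ s) m n; exists C => x.
  by have := hC x; rewrite /cpartial -!rpartial_cat.
Qed.

Lemma bounded_schwartz_cinteg (g phi : R * R -> R[i]) (M : R) : cmeasurable g ->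
  (forall x, cabs (g x) <= M) -> schwartz phi -> cinteg (leb2 R) (fun x => g x * phi x).
Proof.
move=> mg gM sp; have [C C0 h] := schwartz_weight sp.
apply: (@cinteg_dom _ _ R (leb2 R) _ _ _ (integrable_scale (M * C) integrable_pweight)).
  by apply: cmeasurableM; [exact: mg|exact: schwartz_measurable].
by move=> x; rewrite cabsM -mulrA; apply: ler_pM; rewrite ?cabs_ge0.
Qed.

Lemma regular_distr_tempered (g : R * R -> R[i]) (M : R) : cmeasurable g ->
  (forall x, cabs (g x) <= M) -> tempered (regular_distr g).
Proof.
move=> mg gM; have M0 : 0 <= M by exact: le_trans (cabs_ge0 _) (gM 0).
split.
  move=> a phi psi sphi spsi.
  have i1 := bounded_schwartz_cinteg mg gM sphi.
  have i2 := bounded_schwartz_cinteg mg gM spsi.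
  rewrite /regular_distr -[a * _](cintgZ a i1) -[RHS](cintgD (cintegZ a i1) i2).
  by apply: eq_cintg => x; ring.
(* [2] comes from [cabs_cintg_le], [4] from [seminorm_weight] and [pi ^+ 2] is the integral of the
   weight; dividing by [K + 1] covers the case [K = 0]. *)
move=> eps eps0; pose K := 2 * (M * 4 * pi ^+ 2).
have K0 : 0 <= K by rewrite !mulr_ge0// pi_ge0.
exists 2%N, (eps / (K + 1)); split; first by rewrite divr_gt0// ltr_wpDl.
move=> phi sphi hphi.
have d0 : 0 <= eps / (K + 1) by rewrite divr_ge0 ?ltW// ltr_wpDl.
have hw : forall x, cabs (phi x) <= 4 * (eps / (K + 1)) * pweight x.
  by apply: seminorm_weight => m n m2 n2; exact: hphi.
have iG := integrable_scale (M * (4 * (eps / (K + 1)))) (@integrable_pweight R).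
have hb x : cabs (g x * phi x) <= M * (4 * (eps / (K + 1))) * pweight x.
  by rewrite cabsM -mulrA; apply: ler_pM; rewrite ?cabs_ge0.
apply: le_trans (cabs_cintg_le (bounded_schwartz_cinteg mg gM sphi) iG hb) _.
rewrite RintegralZl//; last exact: integrable_pweight.
have -> : \int[leb2 R]_x pweight x = pi ^+ 2.
  rewrite -(Rintegral_poisson2 (0, 0) ltr01); apply: eq_Rintegral => x _.
  by rewrite /pweight !subr0.
have -> : 2 * (M * (4 * (eps / (K + 1))) * pi ^+ 2) = K * (eps / (K + 1)) by rewrite /K; ring.
rewrite mulrA ler_pdivrMr; last by rewrite ltr_wpDl.
by rewrite mulrC ler_wpM2l ?(ltW eps0)// lerDl.
Qed.

End schwartz_closure.

(** * Membership of the witness in the Besov class *)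

Section besov_witness.
Context {R : realType}.
Variables (w : R -> R) (hw : cutoff w).

Let scale (n : int) : R := (2 ^ n)^-1.

Let scale_gt0 n : 0 < scale n.
Proof. by rewrite invr_gt0 exprz_gt0. Qed.

Let scale_far (n : int) : n != 0 -> n != 1 -> 2 <= scale n \/ scale n <= 4^-1.
Proof.
case: n => [[|[|n]]|n] // _ _; rewrite /scale.
  right; rewrite lef_pV2 ?posrE ?exprz_gt0//.
  rewrite -exprnP !exprS mulrA; have -> : 2 * 2 = 4 :> R by lra.
  by rewrite ler_peMr// exprn_ege1// ler1n.
left; rewrite (_ : (2 ^ Negz n)^-1 = 2 ^+ n.+1); last by rewrite /exprz invrK.
by rewrite exprS ler_peMr// exprn_ege1// ler1n.
Qed.

Lemma ffun_besov : besov_fun w (@ffun R).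
Proof.
split; first exact: ffun_contdiff.
  by move=> phi sphi; apply: bounded_schwartz_cinteg sphi;
    [exact: ffun_measurable|move=> x; exact: gfun_bound].
split.
  by apply: regular_distr_tempered; [exact: ffun_measurable|move=> x; exact: gfun_bound].
exists (fun n => Wker w (scale n)); split.
- move=> n; split; first exact: (Wker_schwartz hw (scale_gt0 n)).
  by move=> xi; rewrite (Wker_fourier hw (scale_gt0 n)).
- pose S01 : set int := [set 0; 1].
  have fS01 : finite_set S01 by exact: finite_set2.
  have -> : (\esum_(n in [set: int]) ((2 ^ n)%:E *
      'N[leb2 R]_+oo[(fun x => (cabs (wave_conv w (scale n) x))%:E)]) =
    \esum_(n in S01) ((2 ^ n)%:E *
      'N[leb2 R]_+oo[(fun x => (cabs (wave_conv w (scale n) x))%:E)]))%E.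
    rewrite [RHS]esum_mkcond; apply: eq_esum => n _; case: ifPn => //.
    rewrite notin_setE/= => n01.
    have n0 : n != 0 by apply/eqP => h; apply: n01; left.
    have n1 : n != 1 by apply/eqP => h; apply: n01; right.
    under eq_Lnorm do rewrite (wave_conv0 hw (scale_gt0 n) _ (scale_far n0 n1)) cabs0.
    by rewrite (@Lnorm0 _ _ _ (leb2 R) +oo%E) ?mule0.
  rewrite esum_fset//; last first.
    by move=> n _; rewrite mule_ge0 ?Lnorm_ge0// lee_fin exprz_ge0.
  rewrite fsbig_finite/=; last exact: fS01.
  apply: lte_sum_pinfty => n _.
  have [C C0 hC] := wave_conv_bound hw (scale_gt0 n).
  rewrite lte_mul_pinfty ?lee_fin ?exprz_ge0//.
  rewrite unlock; case: ifP => // _; apply: le_lt_trans (ltry C).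
  by apply/ess_supP; apply: aeW => x /=; rewrite lee_fin ger0_norm ?cabs_ge0.
- move=> b phi sphi; rewrite /bisum_cvg.
  set A := fun n => distr_deriv b (regular_distr (wave_conv w (scale n))) phi.
  have sp := schwartz_cpartial [:: b] sphi.
  have A0 n : n != 0 -> n != 1 -> A n = 0.
    move=> n0 n1; rewrite /A /distr_deriv /regular_distr.
    rewrite [cint _](_ : _ = 0) ?oppr0// -[RHS](@cintg0 _ _ R (leb2 R)).
    apply: eq_cintg => x.
    by rewrite (wave_conv0 hw (scale_gt0 n) _ (scale_far n0 n1)) mul0r.
  have s0 : scale 0 = 1 by rewrite /scale expr0z invr1.
  have s1 : scale 1 = 2^-1 by rewrite /scale expr1z.
  have A01 : A 0 + A 1 = distr_deriv b (regular_distr (@ffun R)) phi.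
    rewrite /A s0 s1 /distr_deriv /regular_distr -opprD; congr (- _).
    have a1 : 0 < (1 : R) by []; have a2 : 0 < (2^-1 : R) by rewrite invr_gt0.
    have [C1 C10 h1] := wave_conv_bound hw a1; have [C2 C20 h2] := wave_conv_bound hw a2.
    have i1 := bounded_schwartz_cinteg (wave_conv_measurable hw a1) h1 sp.
    have i2 := bounded_schwartz_cinteg (wave_conv_measurable hw a2) h2 sp.
    rewrite -[LHS](cintgD i1 i2); apply: eq_cintg => x.
    by rewrite -mulrDl wave_conv_split.
  rewrite -[X in _ --> X]A01.
  (* The two-sided sums are eventually constant: the indices [0] and [1] are both present once
     [1 <= N], since the second sum runs up to [N] included. *)
  have nearE : \forall MN \near (\oo, \oo), \sum_(0 <= k < MN.1) A (- k.+1%:Z) +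
      \sum_(0 <= k < MN.2.+1) A k%:Z = A 0 + A 1.
    exists ([set: nat], [set n | (1 <= n)%N]).
      by split; [exact: filterT|exact: nbhs_infty_ge].
    move=> [M N] [_ /= N1].
    rewrite big1 ?add0r; last by move=> k _; rewrite A0.
    case: N N1 => // N _; rewrite 2?big_nat_recl//= addrA big1 ?addr0//.
    by move=> k _; rewrite A0.
  move=> U UN; have U0 : U (A 0 + A 1) := @nbhs_singleton (R[i]^o) _ _ UN.
  by apply: filterS nearE => MN /= ->.
Qed.

End besov_witness.

(** * The Hilbert space of square summable sequences *)

Lemma cvg_fin_sum (K : numFieldType) (V : normedModType K) (T : Type) (F : set_system T)
    (FF : Filter F) (f : nat -> T -> V) (l : nat -> V) n :
  (forall k, f k @ F --> l k) -> (\sum_(0 <= k < n) f k y) @[y --> F] --> \sum_(0 <= k < n) l k.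
Proof.
move=> fl; elim: n => [|n IH].
  by rewrite big_geq//; under eq_fun do rewrite big_geq//; exact: cvg_cst.
rewrite big_nat_recr//=; under eq_fun do rewrite big_nat_recr//=.
by apply: cvgD.
Qed.

Section square_summable.
Context {R : realType}.

Definition l2pred : pred (nat -> R[i]) :=
  fun a => `[< exists M : R, forall n, \sum_(0 <= k < n) cabs (a k) ^+ 2 <= M >].

Lemma l2predP a : reflect (exists M : R, forall n, \sum_(0 <= k < n) cabs (a k) ^+ 2 <= M)
  (a \in l2pred).
Proof. exact: asboolP. Qed.

Lemma cabsD_sqr (x y : R[i]) : cabs (x + y) ^+ 2 <= 2 * cabs x ^+ 2 + 2 * cabs y ^+ 2.
Proof.
have h : cabs (x + y) ^+ 2 <= (cabs x + cabs y) ^+ 2.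
  by rewrite lerXn2r ?nnegrE ?addr_ge0 ?cabs_ge0// cabsD.
by apply: le_trans h _; have := sqr_ge0 (cabs x - cabs y); nra.
Qed.

Lemma l2pred_submod : GRing.submod_closed l2pred.
Proof.
split.
  by apply/l2predP; exists 0 => n; rewrite big1// => k _; rewrite cabs0 expr0n.
move=> c a b /l2predP[M hM] /l2predP[N hN]; apply/l2predP.
exists (2 * (cabs c ^+ 2 * M) + 2 * N) => n.
apply: (@le_trans _ _ (\sum_(0 <= k < n) (2 * (cabs c ^+ 2 * cabs (a k) ^+ 2) + 2 * cabs (b k) ^+ 2))).
  apply: ler_sum => k _; apply: le_trans (cabsD_sqr _ _) _.
  by rewrite cabsM exprMn.
rewrite big_split/= -!mulr_sumr; apply: lerD; rewrite ler_wpM2l//.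
by rewrite ler_wpM2l ?sqr_ge0.
Qed.

HB.instance Definition _ := GRing.isSubmodClosed.Build _ _ l2pred l2pred_submod.

Record l2 := L2 { l2val :> nat -> R[i]; l2valP : l2val \in l2pred }.

HB.instance Definition _ := [isSub for l2val].
HB.instance Definition _ := [Choice of l2 by <:].
HB.instance Definition _ := [SubChoice_isSubLmodule of l2 by <:].

Lemma l20 k : (0 : l2) k = 0.
Proof. by []. Qed.

Definition nsq (a : nat -> R[i]) : R := limn (series (fun k => cabs (a k) ^+ 2)).

Lemma nsq_series_nd (a : nat -> R[i]) : nondecreasing_seq (series (fun k => cabs (a k) ^+ 2)).
Proof. by apply/nondecreasing_seqP => n; rewrite seriesEnat/= big_nat_recr//= lerDl sqr_ge0. Qed.

Lemma nsq_cvg (a : nat -> R[i]) : a \in l2pred -> cvgn (series (fun k => cabs (a k) ^+ 2)).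
Proof.
move=> /l2predP[M hM]; apply: nondecreasing_is_cvgn; first exact: nsq_series_nd.
by exists M => _ [n _ <-]; exact: hM.
Qed.

Lemma nsq_ub (a : nat -> R[i]) n : a \in l2pred -> \sum_(0 <= k < n) cabs (a k) ^+ 2 <= nsq a.
Proof. by move=> /nsq_cvg ca; exact: (nondecreasing_cvgn_le (nsq_series_nd a) ca). Qed.

Lemma nsq_lub (a : nat -> R[i]) (M : R) : (forall n, \sum_(0 <= k < n) cabs (a k) ^+ 2 <= M) ->
  nsq a <= M.
Proof.
move=> hM; apply: limr_le; first by apply: nsq_cvg; apply/l2predP; exists M.
by apply: nearW => n; exact: hM.
Qed.

Lemma nsq_ge0 (a : l2) : 0 <= nsq a.
Proof. by have := nsq_ub 0 (l2valP a); rewrite big_geq. Qed.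

Lemma nsq_coord (a : l2) k : cabs (a k) ^+ 2 <= nsq a.
Proof.
apply: le_trans (nsq_ub k.+1 (l2valP a)); rewrite big_nat_recr//= lerDr.
by apply: sumr_ge0 => j _; exact: sqr_ge0.
Qed.

Lemma nsqZ (c : R[i]) (a : l2) : nsq (c *: a) = cabs c ^+ 2 * nsq a.
Proof.
rewrite /nsq; apply/cvg_lim => //.
have -> : series (fun k => cabs ((c *: a) k) ^+ 2) =
    (fun n => cabs c ^+ 2 * series (fun k => cabs (a k) ^+ 2) n).
  by apply/funext => n; rewrite /series/= mulr_sumr; apply: eq_bigr => k _; rewrite cabsM exprMn.
by apply: cvgM; [exact: cvg_cst|exact: nsq_cvg (l2valP a)].
Qed.

Definition l2norm (a : l2) : R[i] := (Num.sqrt (nsq a))%:C.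

Lemma nsq_eq0 (a : l2) : nsq a = 0 -> a = 0.
Proof.
move=> a0; apply/val_inj/funext => k; apply: cabs_eq0; apply/eqP.
rewrite -sqrf_eq0; have := nsq_coord a k; rewrite a0.
by rewrite le_eqVlt ltNge sqr_ge0 orbF.
Qed.

(** Sum the inequalities [2 A B |a_k| |b_k| <= B^2 |a_k|^2 + A^2 |b_k|^2]; zero norms are treated
    apart so that [A B] can be cancelled. *)
Lemma l2_cauchy_schwarz (a b : l2) n :
  \sum_(0 <= k < n) cabs (a k) * cabs (b k) <= Num.sqrt (nsq a) * Num.sqrt (nsq b).
Proof.
set A := Num.sqrt (nsq a); set B := Num.sqrt (nsq b).
have A2 : A ^+ 2 = nsq a by rewrite sqr_sqrtr// nsq_ge0.
have B2 : B ^+ 2 = nsq b by rewrite sqr_sqrtr// nsq_ge0.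
have A0 : 0 <= A by exact: sqrtr_ge0.
have B0 : 0 <= B by exact: sqrtr_ge0.
have [Az|An] := eqVneq A 0.
  have -> : a = 0 by apply: nsq_eq0; rewrite -A2 Az expr0n.
  by rewrite big1 ?mulr_ge0// => k _; rewrite l20 cabs0 mul0r.
have [Bz|Bn] := eqVneq B 0.
  have -> : b = 0 by apply: nsq_eq0; rewrite -B2 Bz expr0n.
  by rewrite big1 ?mulr_ge0// => k _; rewrite l20 cabs0 mulr0.
have AB : 0 < 2 * (A * B).
  by apply: mulr_gt0 => //; apply: mulr_gt0; rewrite lt_def ?An ?Bn ?A0 ?B0.
rewrite -(ler_pM2l AB).
apply: (@le_trans _ _ (\sum_(0 <= k < n) (B ^+ 2 * cabs (a k) ^+ 2 + A ^+ 2 * cabs (b k) ^+ 2))).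
  rewrite mulr_sumr; apply: ler_sum => k _.
  have := sqr_ge0 (B * cabs (a k) - A * cabs (b k)); lra.
rewrite big_split/= -!mulr_sumr.
have ha := nsq_ub n (l2valP a); have hb := nsq_ub n (l2valP b).
rewrite -A2 in ha; rewrite -B2 in hb.
have h1 := ler_wpM2l (sqr_ge0 B) ha; have h2 := ler_wpM2l (sqr_ge0 A) hb.
by lra.
Qed.

Lemma l2_normD (a b : l2) : l2norm (a + b) <= l2norm a + l2norm b.
Proof.
rewrite /l2norm -rmorphD lecR.
rewrite -(@ler_pXn2r _ 2) ?nnegrE ?addr_ge0 ?sqrtr_ge0// sqr_sqrtr ?nsq_ge0//.
apply: nsq_lub => n.
apply: (@le_trans _ _ (\sum_(0 <= k < n)
   (cabs (a k) ^+ 2 + cabs (b k) ^+ 2 + 2 * (cabs (a k) * cabs (b k))))).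
  apply: ler_sum => k _.
  have h : cabs (a k + b k) ^+ 2 <= (cabs (a k) + cabs (b k)) ^+ 2.
    by rewrite lerXn2r ?nnegrE ?addr_ge0 ?cabs_ge0// cabsD.
  by apply: le_trans h _; rewrite sqrrD; lra.
rewrite !big_split/= -mulr_sumr sqrrD !sqr_sqrtr ?nsq_ge0//.
have h := l2_cauchy_schwarz a b n.
have ha := nsq_ub n (l2valP a); have hb := nsq_ub n (l2valP b).
by lra.
Qed.

Lemma l2_normZ (c : R[i]) (a : l2) : l2norm (c *: a) = `|c| * l2norm a.
Proof.
rewrite /l2norm nsqZ cabs_norm -rmorphM/= sqrtrM ?sqr_ge0// sqrtr_sqr ger0_norm//.
exact: cabs_ge0.
Qed.

Lemma l2_norm_eq0 (a : l2) : l2norm a = 0 -> a = 0.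
Proof.
move=> /(congr1 (@complex.Re R))/= /eqP; rewrite sqrtr_eq0 => a0; apply: nsq_eq0.
by apply/eqP; rewrite eq_le a0 nsq_ge0.
Qed.

HB.instance Definition _ :=
  Lmodule_isNormed.Build R[i] l2 l2_normD l2_normZ l2_norm_eq0.

Lemma l2_normE (a : l2) : `|a| = (Num.sqrt (nsq a))%:C.
Proof. by []. Qed.

Lemma l2_norm_lt (a : l2) (e : R) : 0 < e -> `|a| < e%:C -> nsq a <= e ^+ 2.
Proof.
move=> e0; rewrite l2_normE ltcR => h.
rewrite -[leLHS]sqr_sqrtr ?nsq_ge0// lerXn2r ?nnegrE ?sqrtr_ge0 ?(ltW e0)//; exact: ltW.
Qed.

Lemma l2_norm_le (a : l2) (e : R) : 0 <= e -> nsq a <= e ^+ 2 -> `|a| <= e%:C.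
Proof.
by move=> e0 h; rewrite l2_normE lecR -[leRHS]ger0_norm// -sqrtr_sqr ler_wsqrtr.
Qed.

Lemma l2_coord_lt (a : l2) k (e : R) : 0 < e -> `|a| < e%:C -> cabs (a k) <= e.
Proof.
move=> e0 /(l2_norm_lt e0) h; have := le_trans (nsq_coord a k) h.
by rewrite ler_pXn2r ?nnegrE ?cabs_ge0 ?(ltW e0).
Qed.

(** Real and imaginary parts of coordinates are 1-Lipschitz and so converge by completeness of [R].
    The Cauchy bound survives the limit on finitely many coordinates, hence on all: this shows both
    that the limit is square summable and that it is approached in norm. *)
Lemma l2_complete (F : set_system l2) : ProperFilter F -> cauchy F -> cvg F.
Proof.
move=> FF /cauchyP cF.
have cb (e : R) : 0 < e -> exists x : l2, F (fun y => `|x - y| < e%:C).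
  move=> e0; have [|x hx] := cF e%:C; first by rewrite ltcR.
  by exists x; move: hx; apply: filterS => y; rewrite -ball_normE.
have coord (p : R[i] -> R) : (forall z t, `|p z - p t| <= cabs (z - t)) -> forall k,
    cvg ((fun a : l2 => p (a k)) @ F).
  move=> hp k; apply: cauchy_cvg; apply/cauchy_exP => e e0.
  have [|x hx] := cb (e / 2); first by rewrite divr_gt0.
  exists (p (x k)); rewrite /fmap/=.
  move: hx; apply: filterS => y hy; rewrite -ball_normE/=.
  apply: le_lt_trans (hp _ _) _; apply: (@le_lt_trans _ _ (e / 2)); last by lra.
  by apply: (@l2_coord_lt (x - y) k) hy; rewrite divr_gt0.
have cRe : forall k, cvg ((fun a : l2 => complex.Re (a k)) @ F).
  by apply: coord => z t; apply: le_trans (cabs_Re _); rewrite ReD ReN.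
have cIm : forall k, cvg ((fun a : l2 => complex.Im (a k)) @ F).
  by apply: coord => z t; apply: le_trans (cabs_Im _); rewrite ImD ImN.
pose l k : R[i] := lim ((fun a : l2 => complex.Re (a k)) @ F) +i*
  lim ((fun a : l2 => complex.Im (a k)) @ F).
have lim_le (e : R) (x : l2) : F (fun y => `|x - y| < e%:C) -> 0 < e ->
    forall n, \sum_(0 <= k < n) cabs (x k - l k) ^+ 2 <= e ^+ 2.
  move=> Fx e0 n.
  have c : (\sum_(0 <= k < n) cabs ((x - y : l2) k) ^+ 2) @[y --> F] -->
      \sum_(0 <= k < n) cabs (x k - l k) ^+ 2.
    have E1 y : \sum_(0 <= k < n) cabs ((x - y : l2) k) ^+ 2 =
       \sum_(0 <= k < n) ((complex.Re (x k) - complex.Re (y k)) ^+ 2 +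
         (complex.Im (x k) - complex.Im (y k)) ^+ 2).
      by apply: eq_bigr => k _; rewrite cabs_sqr ReD ImD ReN ImN.
    rewrite (_ : \sum_(0 <= k < n) cabs (x k - l k) ^+ 2 =
       \sum_(0 <= k < n) ((complex.Re (x k) - complex.Re (l k)) ^+ 2 +
         (complex.Im (x k) - complex.Im (l k)) ^+ 2)); last first.
      by apply: eq_bigr => k _; rewrite cabs_sqr ReD ImD ReN ImN.
    under eq_fun do rewrite E1.
    apply: cvg_fin_sum => k; apply: cvgD; rewrite /GRing.exp/=; apply: cvgM;
      by apply: cvgB; [exact: cvg_cst|first [exact: cRe|exact: cIm]].
  apply: (cvgr_to_le c); move: Fx; apply: filterS => y hy.
  by apply: le_trans (nsq_ub _ (l2valP _)) _; exact: l2_norm_lt.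
have lP : l \in l2pred.
  have [|x hx] := cb 1; first by [].
  have d : (fun k => x k - l k) \in l2pred by apply/l2predP; exists (1 ^+ 2); apply: lim_le.
  have -> : l = (x : nat -> R[i]) - (fun k => x k - l k).
    by apply/funext => k; rewrite !fctE opprB addrCA subrr addr0.
  exact: (rpredB (l2valP x) d).
apply/cvg_ex; exists (L2 lP : l2).
apply/cvgrPdist_le => e e0; have er : e = (complex.Re e)%:C by rewrite RRe_real// gtr0_real.
have e0' : 0 < complex.Re e by rewrite -(@ltcR R) -er.
have [|x hx] := cb (complex.Re e / 2); first by rewrite divr_gt0.
move: (hx); apply: filterS => y hy.
rewrite (_ : L2 lP - y = (L2 lP - x) + (x - y)); last by rewrite addrA subrK.
apply: le_trans (ler_normD _ _) _.
have -> : e = (complex.Re e / 2)%:C + (complex.Re e / 2)%:C.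
  by rewrite -rmorphD/= -splitr -er.
apply: lerD; last exact: ltW.
rewrite distrC; apply: l2_norm_le; first by rewrite divr_ge0// ltW.
by apply: nsq_lub => n; apply: lim_le => //; rewrite divr_gt0.
Qed.

HB.instance Definition _ := Uniform_isComplete.Build l2 l2_complete.

Definition l2dot (a b : l2) : R[i] := csum (fun k => a k * Num.conj (b k)).

Lemma cabs_conj (z : R[i]) : cabs (Num.conj z) = cabs z.
Proof. by rewrite /cabs norm_conjC. Qed.

Lemma l2dot_summable (a b : l2) : csummable (fun k => a k * Num.conj (b k)).
Proof.
apply: (@abs_csummable _ _ (Num.sqrt (nsq a) * Num.sqrt (nsq b))) => n.
by apply: le_trans (l2_cauchy_schwarz a b n); apply: ler_sum => k _; rewrite cabsM cabs_conj.
Qed.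

Lemma l2dot_subl (c : l2) : zmod_morphism (l2dot^~ c).
Proof.
move=> a b; rewrite /l2dot csumB; [|exact: l2dot_summable..].
by congr csum; apply/funext => k; rewrite -mulrBl.
Qed.

Lemma l2dot_subr (c : l2) : zmod_morphism (l2dot c).
Proof.
move=> a b; rewrite /l2dot csumB; [|exact: l2dot_summable..].
by congr csum; apply/funext => k; rewrite -mulrBr -rmorphB.
Qed.

Lemma l2dot_scalel (c : l2) : scalable_for *%R (l2dot^~ c).
Proof.
move=> x a; rewrite /l2dot -csumZ; last exact: l2dot_summable.
by congr csum; apply/funext => k; rewrite mulrA.
Qed.

Lemma l2dot_scaler (c : l2) : scalable_for (Num.conj \; *%R) (l2dot c).
Proof.
move=> x a; rewrite /l2dot /= -csumZ; last exact: l2dot_summable.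
by congr csum; apply/funext => k; rewrite mulrCA rmorphM.
Qed.

Lemma l2dot_herm (a b : l2) : l2dot a b = (-1) ^+ false * Num.conj (l2dot b a).
Proof.
rewrite expr0 mul1r /l2dot.
have -> : (fun k => b k * Num.conj (a k)) = (fun k => Num.conj (a k * Num.conj (b k))).
  by apply/funext => k; rewrite rmorphM/= conjCK mulrC.
move: (l2dot_summable a b); set u := fun k => _ => su.
rewrite -[LHS]conjCK; congr Num.conj; apply/esym.
have c : csummable (fun k => Num.conj (u k)).
  rewrite (_ : (fun k => Num.conj (u k)) = fun k => b k * Num.conj (a k)).
    exact: l2dot_summable.
  by apply/funext => k; rewrite rmorphM/= conjCK mulrC.
apply/esym/(csum_unique c); apply: cvg0_le (csum_cvg su) => n.
rewrite cabs_ge0/= -rmorph_sum -rmorphB.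
by rewrite -[X in cabs X]/(Num.conj (csum u - \sum_(0 <= j < n) u j)) cabs_conj.
Qed.

Lemma l2dotE (a : l2) : l2dot a a = (nsq a)%:C.
Proof.
apply/esym/(csum_unique (l2dot_summable a a)).
have h := nsq_cvg (l2valP a).
have -> : (fun n => cabs ((nsq a)%:C - \sum_(0 <= j < n) a j * Num.conj (a j))) =
    (fun n => `|nsq a - series (fun k => cabs (a k) ^+ 2) n|).
  apply/funext => n; rewrite -cabs_real; congr cabs.
  rewrite /series/= rmorphB rmorph_sum/=; congr (_ - _).
  by apply: eq_bigr => k _; rewrite -normCK cabs_norm -rmorphXn.
rewrite -(normr0 R); apply: cvg_norm; rewrite -(subrr (nsq a)).
by apply: cvgB; [exact: cvg_cst|exact: h].
Qed.

Lemma l2dot_gt0 (a : l2) : a != 0 -> 0 < l2dot a a.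
Proof.
move=> a0; rewrite l2dotE ltcR lt_def nsq_ge0 andbT.
by apply/eqP => /nsq_eq0/eqP; apply/negP.
Qed.

HB.instance Definition _ := isBilinear.Build R[i] l2 l2 R[i] *%R (Num.conj \; *%R) l2dot
  l2dot_subl l2dot_subr l2dot_scalel l2dot_scaler.
HB.instance Definition _ :=
  isHermitianSesquilinear.Build R[i] l2 false Num.conj l2dot l2dot_herm.
HB.instance Definition _ := isDotProduct.Build R[i] l2 l2dot l2dot_gt0.

Lemma l2dot_normE (a : l2) : `|a| ^+ 2 = l2dot a a.
Proof. by rewrite l2dotE l2_normE -rmorphXn/= sqr_sqrtr// nsq_ge0. Qed.

End square_summable.
Arguments l2 R : clear implicits.

Definition l2_hilbert (R : realType) : hilbertSpace R :=
  @HilbertSpace R (l2 R) (@l2dot R) (@l2dot_normE R).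

(** * Spectral measures with countably many atoms *)

Section atomic_spectral_measure.
Context {R : realType}.
Variable p : nat -> R.
Implicit Types (A B : set (measurableTypeR R)) (u v : l2_hilbert R).

Definition atom_ind A (n : nat) : R[i] := (`[< A (p n) >])%:R.

Lemma cabs_ind A n : cabs (atom_ind A n) <= 1.
Proof. by rewrite /atom_ind; case: asboolP => _; rewrite ?cabs1 ?cabs0. Qed.

Lemma atom_restrict_l2 A u : (fun n => u n * atom_ind A n) \in l2pred.
Proof.
apply/l2predP; exists (nsq u) => n; apply: le_trans (nsq_ub n (l2valP u)).
apply: ler_sum => k _; rewrite cabsM exprMn ler_piMr ?sqr_ge0//.
by rewrite exprn_ile1 ?cabs_ge0 ?cabs_ind.
Qed.

(** The spectral projection of the diagonal operator with entries [p n]. *)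
Definition atom_restrict A u : l2_hilbert R := L2 (atom_restrict_l2 A u).

Lemma atom_restrict_linear A : linear (atom_restrict A).
Proof. by move=> c u v; apply/val_inj/funext => n /=; rewrite mulrDl -mulrA. Qed.

Lemma atom_restrict_idem A u : atom_restrict A (atom_restrict A u) = atom_restrict A u.
Proof.
apply/val_inj/funext => n /=; rewrite /atom_ind.
by case: asboolP => _; rewrite ?mulr1 ?mulr0.
Qed.

Lemma atom_restrict_selfadj A u v :
  hs_dot (l2_hilbert R) (atom_restrict A u) v = hs_dot (l2_hilbert R) u (atom_restrict A v).
Proof.
congr csum; apply/funext => n /=; rewrite rmorphM/= /atom_ind rmorph_nat.
by rewrite -mulrA; congr (_ * _); rewrite mulrC.
Qed.

Lemma atom_restrict_setT u : atom_restrict setT u = u.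
Proof.
apply/val_inj/funext => n /=; rewrite /atom_ind.
by case: asboolP => [_|[]//]; rewrite mulr1.
Qed.

Lemma atom_restrict_set0 u : atom_restrict set0 u = 0.
Proof.
apply/val_inj/funext => n /=; rewrite /atom_ind.
by case: asboolP => // _; rewrite mulr0.
Qed.

Lemma l2_sum_coord (x : nat -> l2_hilbert R) n k :
  (\sum_(0 <= j < n) x j : l2 R) k = \sum_(0 <= j < n) (x j : l2 R) k.
Proof.
elim: n => [|n IH]; first by rewrite !big_geq.
by rewrite !big_nat_recr//= -IH.
Qed.

Lemma atom_ind_sum (F : nat -> set R) m n : trivIset setT F ->
  (exists2 k0, F k0 (p m) & \sum_(0 <= k < n) atom_ind (F k) m = (k0 < n)%:R) \/
  (~ (\bigcup_k F k) (p m) /\ \sum_(0 <= k < n) atom_ind (F k) m = 0).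
Proof.
move=> tF; have [[k0 _ Fk0]|nF] := pselect ((\bigcup_k F k) (p m)); [left|right].
  exists k0 => //; elim: n => [|n IH]; first by rewrite big_geq.
  rewrite big_nat_recr//= IH /atom_ind; case: asboolP => [Fn|Fn].
    have -> : k0 = n by apply: tF => //; exists (p m).
    by rewrite ltnn ltnSn add0r.
  rewrite addr0 [in RHS]ltnS [in RHS]leq_eqVlt; case: eqP => [e|//].
  by exfalso; apply: Fn; rewrite -e.
split=> //; apply: big1 => k _; rewrite /atom_ind.
by case: asboolP => // Fk; case: nF; exists k.
Qed.

(* Dominated convergence in l^2: the coordinates of the remainder are eventually zero and
   dominated by those of [u]. *)
Lemma atom_restrict_sigma (F : nat -> set (measurableTypeR R)) u :
  (forall n, measurable (F n)) -> trivIset setT F ->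
  (\sum_(0 <= k < n) atom_restrict (F k) u) @[n --> \oo]
     --> atom_restrict (\bigcup_k F k) u.
Proof.
move=> _ tF.
pose v n : l2 R := atom_restrict (\bigcup_k F k) u - \sum_(0 <= k < n) atom_restrict (F k) u.
have vE n m : v n m = (u : l2 R) m * (atom_ind (\bigcup_k F k) m - \sum_(0 <= k < n) atom_ind (F k) m).
  rewrite mulrBr mulr_sumr.
  have -> : v n m = (atom_restrict (\bigcup_k F k) u : l2 R) m -
     (\sum_(0 <= k < n) atom_restrict (F k) u : l2 R) m by [].
  by rewrite l2_sum_coord.
have v_le n m : cabs (v n m) <= cabs ((u : l2 R) m).
  rewrite vE cabsM ler_piMr ?cabs_ge0//.
  have [[k0 Fk0 ->]|[nF ->]] := atom_ind_sum m n tF; rewrite /atom_ind; case: asboolP => // h.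
  - by case: ltnP => _; rewrite ?subrr ?subr0 ?cabs0 ?cabs1.
  - by case: h; exists k0.
  - by rewrite subr0 cabs0.
have v_ev m : \forall n \near \oo, v n m = 0.
  have [nF|nF] := pselect ((\bigcup_k F k) (p m)); last first.
    apply: nearW => n; rewrite vE.
    have [[k0 Fk0 _]|[_ ->]] := atom_ind_sum m n tF; first by case: nF; exists k0.
    by rewrite /atom_ind asboolF// subr0 mulr0.
  have [k0 _ Fk0] := nF; exists k0.+1 => // n kn; have {}kn : (k0 < n)%N := kn; rewrite vE.
  have [[k1 Fk1 ->]|[/(_ nF)//]] := atom_ind_sum m n tF.
  have -> : k1 = k0 by apply: tF => //; exists (p m).
  by rewrite kn /atom_ind asboolT// subrr mulr0.
apply/cvgrPdist_le => e e0; have er : e = (complex.Re e)%:C by rewrite RRe_real// gtr0_real.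
have e0' : 0 < complex.Re e by rewrite -(@ltcR R) -er.
have /cvgrPdist_le/(_ (complex.Re e ^+ 2)) := nsq_cvg (l2valP (u : l2 R)).
rewrite exprn_gt0// => /(_ isT)[K _ /(_ K (leqnn K)) hK].
have zK : \forall n \near \oo, forall m, (m < K)%N -> v n m = 0.
  elim: K {hK} => [|K IH]; first exact: nearW.
  have := v_ev K; apply: filterS2 IH => n h1 h2 m; rewrite ltnS leq_eqVlt => /predU1P[->//|].
  exact: h1.
apply: filterS zK => n hn.
rewrite er; apply: (@l2_norm_le _ (v n)); first exact: ltW.
apply: nsq_lub => M.
have uM := nsq_ub (K + M) (l2valP (u : l2 R)).
have h1 : \sum_(0 <= k < M) cabs (v n k) ^+ 2 <= \sum_(0 <= k < K + M) cabs (v n k) ^+ 2.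
  rewrite (@big_cat_nat _ _ _ M 0 (K + M))//= ?leq_addl// lerDl.
  by apply: sumr_ge0 => k _; exact: sqr_ge0.
apply: le_trans h1 _.
rewrite (@big_cat_nat _ _ _ K 0 (K + M))//= ?leq_addr// big_nat big1 ?add0r; last first.
  by move=> k /andP[_ kK]; move/(congr1 (@cabs R)): (hn k kK) => /= ->; rewrite cabs0 expr0n.
rewrite (@big_cat_nat _ _ _ K 0 (K + M))//= ?leq_addr// in uM.
have h2 : \sum_(K <= k < K + M) cabs (v n k) ^+ 2 <= \sum_(K <= k < K + M) cabs ((u : l2 R) k) ^+ 2.
  by apply: ler_sum => k _; rewrite lerXn2r ?nnegrE ?cabs_ge0.
apply: le_trans h2 _; apply: le_trans (le_trans (ler_norm _) hK).
by rewrite seriesEnat/= lerBrDl.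
Qed.

Definition atomic_spectral : spectralMeasure (l2_hilbert R) :=
  @SpectralMeasure R (l2_hilbert R) atom_restrict
    (fun A _ => atom_restrict_linear A) (fun A _ => atom_restrict_idem A)
    (fun A _ => atom_restrict_selfadj A)
    atom_restrict_setT atom_restrict_set0 (fun F mF tF u => @atom_restrict_sigma F u mF tF).

Lemma halves_l2 : (fun k => (2^-1 ^+ k)%:C : R[i]) \in l2pred.
Proof.
apply/l2predP; exists 2 => n.
(* The extra term [2 * 2^(-n)] is the slack that lets the induction close, because
   [4^(-n) <= 2^(-n)]. *)
suff h : \sum_(0 <= k < n) cabs ((2^-1 ^+ k)%:C : R[i]) ^+ 2 + 2 * 2^-1 ^+ n <= 2 :> R.
  by apply: le_trans h; rewrite lerDl mulr_ge0 ?exprn_ge0.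
elim: n => [|n IH]; first by rewrite big_geq// expr0 add0r mulr1.
apply: le_trans IH; rewrite big_nat_recr//= -addrA lerD2l cabs_real ger0_norm ?exprn_ge0//.
have h0 : 0 <= (2^-1 : R) ^+ n by rewrite exprn_ge0.
have h1 : (2^-1 : R) ^+ n <= 1 by apply: exprn_ile1; rewrite ?invr_ge0 ?invf_le1 ?ler1n.
by rewrite (exprS _ n) mulrA mulfV// mul1r; move: (2^-1 ^+ n : R) h0 h1 => x h0 h1; nra.
Qed.

(** A vector without zero coordinates: its scalar measure charges every atom. *)
Definition halves : l2_hilbert R := L2 halves_l2.

Lemma cabs_halves n : 0 < cabs ((halves : l2 R) n).
Proof. by rewrite /= cabs_real normr_gt0 expf_neq0// invr_eq0. Qed.

Lemma atomic_ae (P : R -> Prop) n : spectral_ae atomic_spectral P -> P (p n).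
Proof.
move=> [A [_ A0 AP]]; apply: AP => Apn.
have /(congr1 (fun v : l2 R => cabs (v n)))/= := A0 halves.
rewrite /atom_ind asboolT// mulr1 cabs0 => h; have := cabs_halves n.
by rewrite /= h ltxx.
Qed.

Lemma atomic_scalar_gt0 n : (0 < scalar_spectral atomic_spectral halves [set p n])%E.
Proof.
rewrite /scalar_spectral lte_fin /rnorm.
have -> : `|atomic_spectral [set p n] halves| =
  (Num.sqrt (nsq (atom_restrict [set p n] halves : l2 R)))%:C by [].
rewrite /= sqr_sqrtr; last exact: (nsq_ge0 (atom_restrict [set p n] halves : l2 R)).
apply: lt_le_trans (nsq_coord (atom_restrict [set p n] halves : l2 R) n).
have -> : (atom_restrict [set p n] halves : l2 R) n = (halves : l2 R) n.
  by rewrite /= /atom_ind (@asboolT ([set p n] (p n)))// mulr1.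
apply: exprn_gt0; exact: cabs_halves.
Qed.

(** The product of the scalar measures of [halves] has positive mass at each triple of atoms, so a
    null set contains none of them. *)
Lemma atomic_ae3 (P : R -> R -> R -> Prop) a b c :
  spectral_ae3 atomic_spectral atomic_spectral atomic_spectral P -> P (p a) (p b) (p c).
Proof.
move=> /(_ halves halves halves) [N [mN N0 PN]].
have [//|nP] := pselect (P (p a) (p b) (p c)); exfalso.
have sN : ([set p a] `*` [set p b]) `*` [set p c] `<=` N.
  by move=> [[x y] z] [[/= -> ->] ->]; apply: PN.
have ms x : measurable ([set x] : set (measurableTypeR R)) by exact: measurable_set1.
pose mu := scalar_spectral atomic_spectral halves.
have : (mu \x mu \x mu)%E (([set p a] `*` [set p b]) `*` [set p c]) = 0%E.
  by apply: (subset_measure0 _ mN sN N0); apply: measurableX => //; exact: measurableX.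
rewrite product_measure1E//; last exact: measurableX.
have pos n : (mu [set p n] != 0)%E by rewrite gt_eqF// atomic_scalar_gt0.
move=> /eqP; rewrite mule_eq0 (negbTE (pos c)) orbF => /eqP h.
have /eqP := etrans (esym (product_measure1E mu mu (ms (p a)) (ms (p b)))) h.
by rewrite mule_eq0 !(negbTE (pos _)).
Qed.

End atomic_spectral_measure.

(** * The lower bound *)

Section characters.
Context {R : realType}.
Implicit Types (M e x y a b : nat) (u v : nat -> R[i]).

Lemma expi_conj (t : R) : Num.conj (expi t) = expi (- t).
Proof. by rewrite expiN. Qed.

Lemma expi_eq1 (t : R) : 0 < t < 2 * pi -> expi t != 1.
Proof.
move=> /andP[t0 t2]; apply/eqP => /(congr1 (@complex.Re R))/= ct.
have s0 : 0 < sin (t / 2) by apply: sin_gt0_pi; rewrite divr_gt0//= ltr_pdivrMr// mulrC.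
have : cos ((t / 2) *+ 2) = 1 by rewrite -mulr_natr divfK.
rewrite cos_mulr2n mulr2n; have := cos2Dsin2 (t / 2).
have := mulr_gt0 s0 s0; rewrite -expr2; lra.
Qed.

Definition root M e x : R[i] := expi (2 * pi * e%:R / M%:R * x%:R).

Lemma rootC M e x : root M e x = root M x e.
Proof. by congr expi; ring. Qed.

Lemma geometric_sum0 (z : R[i]) M : z != 1 -> z ^+ M = 1 -> \sum_(0 <= x < M) z ^+ x = 0.
Proof.
move=> z1 zM; apply/eqP; have := subrX1 z M; rewrite zM subrr => /esym/eqP.
by rewrite mulf_eq0 subr_eq0 (negbTE z1) big_mkord.
Qed.

(** For [a != b] the terms are the powers of an [M]-th root of unity other than [1], whose sum
    vanishes. *)
Lemma root_ortho M a b : (a < M)%N -> (b < M)%N ->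
  \sum_(0 <= x < M) root M a x * Num.conj (root M b x) = (if a == b then M%:R else 0).
Proof.
move=> aM bM; have M0 : (M%:R : R) != 0 by rewrite pnatr_eq0 -lt0n (leq_ltn_trans _ aM).
have E x : root M a x * Num.conj (root M b x) =
    expi (2 * pi * (a%:R - b%:R) / M%:R) ^+ x.
  by rewrite expi_conj -expiD -expiMn -mulr_natr; congr expi; ring.
under eq_bigr do rewrite E.
have [->|ab] := eqVneq a b.
  rewrite subrr mulr0 mul0r expi0; under eq_bigr do rewrite expr1n.
  by rewrite sumr_const_nat subn0.
apply: geometric_sum0; last first.
  rewrite -expiMn -[X in expi X]mulr_natr divfK//.
  have h (n : nat) : expi (2 * pi * n%:R) = 1 :> R[i].
    rewrite mulr_natr expiMn mulr_natl /expi cos2pi sin2pi.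
    exact: expr1n.
  by rewrite mulrBr expiD -(expi_conj (_ * b%:R)) !h rmorph1 mulr1.
have main n m : (n < m)%N -> (m < M)%N -> expi (2 * pi * (m%:R - n%:R) / M%:R) != 1 :> R[i].
  move=> nm mM; apply: expi_eq1.
  have p0 := @pi_gt0 R; have Mp : (0 : R) < M%:R by rewrite ltr0n (leq_ltn_trans _ mM).
  rewrite divr_gt0// ?mulr_gt0// ?subr_gt0 ?ltr_nat//= -mulrA gtr_pMr ?mulr_gt0//.
  rewrite ltr_pdivrMr// mul1r -natrB 1?ltnW// ltr_nat (leq_ltn_trans (leq_subr _ _))//.
move: ab; rewrite neq_ltn => /orP[ab|ab]; last exact: main.
apply: contra (main _ _ ab bM) => /eqP h; apply/eqP.
rewrite -[LHS]conjCK expi_conj -mulNr -mulrN opprB h; exact: rmorph1.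
Qed.

(** The factor [expi (pi * x)] is the sign [(-1)^x], the trace on the grid [pi x] of the modulation
    by [expi t]; being unimodular, it leaves orthogonality intact. *)
Definition chi M e x : R[i] := expi (pi * x%:R) * root M e x.

Lemma chiD M e x y : chi M e (x + y) = chi M e x * chi M e y.
Proof.
by rewrite /chi /root natrD !mulrDr !expiD; ring.
Qed.

Lemma cabs_chi M e x : cabs (chi M e x) = 1.
Proof. by rewrite cabsM !cabs_expi mulr1. Qed.

Lemma chi_ortho M a b : (a < M)%N -> (b < M)%N ->
  \sum_(0 <= x < M) chi M a x * Num.conj (chi M b x) = (if a == b then M%:R else 0).
Proof.
move=> aM bM; rewrite -(root_ortho aM bM); apply: eq_bigr => x _.
have e1 : expi (pi * x%:R) * Num.conj (expi (pi * x%:R)) = 1 :> R[i].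
  by rewrite expi_conj mulrC expiK.
by rewrite /chi rmorphM/= mulrACA e1 mul1r.
Qed.

(** [root M] is symmetric in its two arguments, so summing over the frequency is the same as summing
    over the point. *)
Lemma chi_ortho_dual M x y : (x < M)%N -> (y < M)%N ->
  \sum_(0 <= e < M) Num.conj (chi M e x) * chi M e y = (if x == y then M%:R else 0).
Proof.
move=> xM yM; rewrite eq_sym.
have h : \sum_(0 <= e < M) Num.conj (chi M e x) * chi M e y =
   (Num.conj (expi (pi * x%:R)) * expi (pi * y%:R)) *
   \sum_(0 <= e < M) root M y e * Num.conj (root M x e).
  rewrite mulr_sumr; apply: eq_bigr => e _.
  by rewrite /chi rmorphM/= (rootC M e x) (rootC M e y); ring.
rewrite h root_ortho//; case: eqP => [->|_]; last by rewrite mulr0.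
by rewrite expi_conj expiK mul1r.
Qed.

Lemma cabs_conjM (z : R[i]) : (cabs z ^+ 2)%:C = z * Num.conj z.
Proof. by rewrite -normCK cabs_norm -rmorphXn. Qed.

Definition dft M u e : R[i] := \sum_(0 <= x < M) Num.conj (chi M e x) * u x.

Lemma parseval M u :
  \sum_(0 <= e < M) cabs (dft M u e) ^+ 2 = M%:R * \sum_(0 <= x < M) cabs (u x) ^+ 2.
Proof.
apply: (@complexI R); rewrite rmorphM/= !rmorph_sum/=.
under eq_bigr do rewrite cabs_conjM.
under [in RHS]eq_bigr do rewrite cabs_conjM.
have -> : \sum_(0 <= e < M) dft M u e * Num.conj (dft M u e) =
    \sum_(0 <= x < M) \sum_(0 <= y < M) u x * Num.conj (u y) *
      (\sum_(0 <= e < M) Num.conj (chi M e x) * chi M e y).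
  under [RHS]eq_bigr do under eq_bigr do rewrite mulr_sumr.
  under [RHS]eq_bigr do rewrite exchange_big.
  rewrite [RHS]exchange_big; apply: eq_bigr => e _.
  rewrite /dft rmorph_sum/= mulr_suml; apply: eq_bigr => x _.
  rewrite mulr_sumr; apply: eq_bigr => y _.
  by rewrite [Num.conj (_ * u y)]rmorphM/= conjCK; ring.
rewrite mulr_sumr big_nat [RHS]big_nat; apply: eq_bigr => x /andP[_ xM].
rewrite (bigD1_seq x) ?mem_index_iota ?iota_uniq//= chi_ortho_dual// eqxx.
rewrite big_seq_cond big1 ?addr0; last first.
  move=> y; rewrite mem_index_iota => /andP[/andP[_ yM] yx].
  by rewrite chi_ortho_dual// eq_sym (negbTE yx) mulr0.
by rewrite mulrC rmorph_nat.
Qed.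

(** Reads off, with weights [s e], the coefficients of a combination of the matrices
    [chi M e (x + y)]. *)
Definition pairing M (s : nat -> R[i]) (Psi : nat -> nat -> R[i]) : R[i] :=
  \sum_(0 <= e < M) s e * \sum_(0 <= x < M) \sum_(0 <= y < M)
    Num.conj (chi M e x) * Num.conj (chi M e y) * Psi x y.

End characters.

(** * Upper bounds and linearity of the pairing *)

Section pairing_bounds.
Context {R : realType}.
Implicit Types (M K e x y : nat) (s : nat -> R[i]) (Psi : nat -> nat -> R[i]).

Lemma pairing_tensor M s (u v : nat -> nat -> R[i]) K :
  pairing M s (fun x y => \sum_(0 <= l < K) u x l * v y l) =
  \sum_(0 <= l < K) \sum_(0 <= e < M) s e * (dft M (u^~ l) e * dft M (v^~ l) e).
Proof.
rewrite exchange_big; apply: eq_bigr => e _; rewrite -mulr_sumr; congr (_ * _).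
under eq_bigr do under eq_bigr do rewrite mulr_sumr.
under eq_bigr do rewrite exchange_big.
rewrite exchange_big; apply: eq_bigr => l _.
rewrite /dft mulr_suml; apply: eq_bigr => x _; rewrite mulr_sumr; apply: eq_bigr => y _.
by ring.
Qed.

(** The inequality [2 |p q| <= |p|^2 + |q|^2] separates the transforms of the factors. Parseval
    gives one factor [M], and summing the row bounds over the points gives the other; the number [K]
    of terms does not enter. *)
Lemma pairing_tensor_le M s (u v : nat -> nat -> R[i]) K (A G : R) :
  (forall e, cabs (s e) <= 1) ->
  (forall x, \sum_(0 <= l < K) cabs (u x l) ^+ 2 <= A) ->
  (forall y, \sum_(0 <= l < K) cabs (v y l) ^+ 2 <= G) ->
  cabs (pairing M s (fun x y => \sum_(0 <= l < K) u x l * v y l)) <= M%:R ^+ 2 * (A + G) / 2.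
Proof.
move=> s1 uA vG; rewrite pairing_tensor.
have half (w : nat -> nat -> R[i]) (B : R) :
    (forall x, \sum_(0 <= l < K) cabs (w x l) ^+ 2 <= B) ->
    \sum_(0 <= l < K) \sum_(0 <= e < M) cabs (dft M (w^~ l) e) ^+ 2 <= M%:R ^+ 2 * B.
  move=> wB; under eq_bigr do rewrite parseval.
  rewrite -mulr_sumr expr2 -mulrA ler_wpM2l// exchange_big.
  apply: (@le_trans _ _ (\sum_(0 <= x < M) B)); first by apply: ler_sum => x _; exact: wB.
  by rewrite sumr_const_nat subn0 mulr_natl.
apply: (@le_trans _ _ (2^-1 * \sum_(0 <= l < K) \sum_(0 <= e < M)
   (cabs (dft M (u^~ l) e) ^+ 2 + cabs (dft M (v^~ l) e) ^+ 2))).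
  rewrite mulr_sumr; apply: le_trans (cabs_sum _ _ _) _; apply: ler_sum => l _.
  rewrite mulr_sumr; apply: le_trans (cabs_sum _ _ _) _; apply: ler_sum => e _.
  rewrite cabsM; apply: (@le_trans _ _ (cabs (dft M (u^~ l) e * dft M (v^~ l) e))).
    by rewrite ler_piMl ?cabs_ge0.
  rewrite cabsM; have := sqr_ge0 (cabs (dft M (u^~ l) e) - cabs (dft M (v^~ l) e)); lra.
have -> : \sum_(0 <= l < K) \sum_(0 <= e < M)
    (cabs (dft M (u^~ l) e) ^+ 2 + cabs (dft M (v^~ l) e) ^+ 2) =
  \sum_(0 <= l < K) \sum_(0 <= e < M) cabs (dft M (u^~ l) e) ^+ 2 +
  \sum_(0 <= l < K) \sum_(0 <= e < M) cabs (dft M (v^~ l) e) ^+ 2.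
  by rewrite -big_split; apply: eq_bigr => l _; rewrite -big_split.
have hu := half _ _ uA; have hv := half _ _ vG; lra.
Qed.

Lemma pairingD M s Psi Psi' :
  pairing M s (fun x y => Psi x y + Psi' x y) = pairing M s Psi + pairing M s Psi'.
Proof.
rewrite /pairing -big_split; apply: eq_bigr => e _ /=; rewrite -mulrDr; congr (_ * _).
rewrite -big_split; apply: eq_bigr => x _ /=; rewrite -big_split; apply: eq_bigr => y _ /=.
by rewrite mulrDr.
Qed.

Lemma pairingZ M s a Psi : pairing M s (fun x y => a * Psi x y) = a * pairing M s Psi.
Proof.
rewrite /pairing mulr_sumr; apply: eq_bigr => e _; rewrite mulrCA; congr (_ * _).
rewrite mulr_sumr; apply: eq_bigr => x _; rewrite mulr_sumr; apply: eq_bigr => y _.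
by rewrite mulrCA.
Qed.

Lemma pairing_sum M s (I : Type) (J : seq I) (F : I -> nat -> nat -> R[i]) :
  pairing M s (fun x y => \sum_(j <- J) F j x y) = \sum_(j <- J) pairing M s (F j).
Proof.
elim: J => [|j J IH].
  rewrite big_nil /pairing big1// => e _; rewrite big1 ?mulr0// => x _.
  by rewrite big1// => y _; rewrite big_nil mulr0.
rewrite big_cons -IH -pairingD; congr pairing; apply/funext => x; apply/funext => y.
by rewrite big_cons.
Qed.

(** A crude bound, meant for the tail of the series, where the smallness of [B] makes up for the
    size of [L]. *)
Lemma pairing_sup M s Psi (L B : R) : 0 <= B ->
  \sum_(0 <= e < M) cabs (s e) <= L ->
  (forall x y, (x < M)%N -> (y < M)%N -> cabs (Psi x y) <= B) ->
  cabs (pairing M s Psi) <= L * (M%:R ^+ 2 * B).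
Proof.
move=> B0 sL PB; apply: le_trans (cabs_sum _ _ _) _.
apply: (@le_trans _ _ (\sum_(0 <= e < M) cabs (s e) * (M%:R ^+ 2 * B))).
  apply: ler_sum => e _; rewrite cabsM ler_wpM2l ?cabs_ge0//.
  apply: le_trans (cabs_sum _ _ _) _.
  apply: (@le_trans _ _ (\sum_(0 <= x < M) M%:R * B)); last first.
    by rewrite sumr_const_nat subn0 -(mulr_natl (M%:R * B) M) expr2 mulrA.
  apply: ler_sum_nat => x /andP[_ xM]; apply: le_trans (cabs_sum _ _ _) _.
  apply: (@le_trans _ _ (\sum_(0 <= y < M) B)); last first.
    by rewrite sumr_const_nat subn0 -(mulr_natl B M).
  apply: ler_sum_nat => y /andP[_ yM]; rewrite !cabsM !cabs_conj !cabs_chi !mul1r.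
  exact: PB.
by rewrite -mulr_suml ler_wpM2r// mulr_ge0// exprn_ge0.
Qed.

(** As [chi] is multiplicative, the double sum factors into two orthogonality relations, and each
    gives [M] at [e = a]. *)
Lemma pairing_chi M s a : (a < M)%N ->
  pairing M s (fun x y => chi M a (x + y)) = s a * M%:R ^+ 2.
Proof.
move=> aM; rewrite /pairing (bigD1_seq a) ?mem_index_iota ?iota_uniq//=.
have E (e : nat) (eM : (e < M)%N) : (\sum_(0 <= x < M) \sum_(0 <= y < M)
     Num.conj (chi M e x) * Num.conj (chi M e y) * chi M a (x + y)) =
     (if a == e then M%:R else 0) * (if a == e then M%:R else 0) :> R[i].
  rewrite -(chi_ortho aM eM) mulr_suml; apply: eq_bigr => x _.
  by rewrite mulr_sumr; apply: eq_bigr => y _; rewrite chiD; ring.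
rewrite E// eqxx -expr2 big_seq_cond big1 ?addr0// => e.
rewrite mem_index_iota => /andP[/andP[_ eM] ea].
by rewrite E// eq_sym (negbTE ea) mulr0 mulr0.
Qed.

(** The pairing involves finitely many entries, so pointwise convergence is enough. The filter is
    arbitrary because the Haagerup series converges along pairs of truncation indices. *)
Lemma pairing_lim (M : nat) s (T : Type) (F : set_system T) (FF : ProperFilter F)
    (Phi : T -> nat -> nat -> R[i]) Psi (C : R) :
  (forall x y, Phi^~ x ^~ y @ F --> (Psi x y : R[i]^o)) ->
  (forall t, cabs (pairing M s (Phi t)) <= C) -> cabs (pairing M s Psi) <= C.
Proof.
move=> lP hC; apply/ler_addgt0Pr => e e0.
have cP : pairing M s (Phi t) @[t --> F] --> (pairing M s Psi : R[i]^o).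
  apply: (@cvg_fin_sum R[i] R[i]^o T F FF (fun e t => _) (fun e => _) M) => n.
  apply: (@cvgM R[i] T F FF (fun=> s n)); first exact: cvg_cst.
  apply: (@cvg_fin_sum R[i] R[i]^o T F FF (fun e t => _) (fun e => _) M) => x.
  apply: (@cvg_fin_sum R[i] R[i]^o T F FF (fun e t => _) (fun e => _) M) => y.
  by apply: (@cvgM R[i] T F FF (fun=> _)); [exact: cvg_cst|exact: lP].
have e0' : (0 : R[i]) < e%:C by rewrite ltcR.
have /filter_ex[t] := proj1 (@cvgrPdist_le R[i] R[i]^o T F FF (fun t => pairing M s (Phi t)) _) cP _ e0'.
rewrite cabs_norm lecR => ht.
have := cabsD (pairing M s Psi - pairing M s (Phi t)) (pairing M s (Phi t)).
by rewrite subrK => h; apply: le_trans h _; rewrite addrC lerD.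
Qed.

End pairing_bounds.

(** * Haagerup representations on the grid *)

Section haagerup_bound.
Context {R : realType}.

Lemma l2normsq_partial (a : nat -> R[i]) (C : R) n : (l2normsq a <= C%:E)%E ->
  \sum_(0 <= k < n) cabs (a k) ^+ 2 <= C.
Proof.
move=> aC; rewrite -lee_fin; apply: le_trans aC; rewrite -sumEFin.
by apply: nneseries_lim_ge => k _ _; rewrite lee_fin sqr_ge0.
Qed.

Lemma l2normsq_le (a : nat -> R[i]) (C : R) :
  (forall n, \sum_(0 <= k < n) cabs (a k) ^+ 2 <= C) -> (l2normsq a <= C%:E)%E.
Proof.
move=> aC; apply: lime_le.
  by apply: is_cvg_nneseries => k _ _; rewrite lee_fin sqr_ge0.
by apply: nearW => n; rewrite sumEFin lee_fin.
Qed.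

(* The matrix only acts on columns: test the row [a b] against its own truncated conjugate. *)
Lemma matrix_row_bound (b : nat -> nat -> R[i]) (a : nat -> R[i]) (C A : R) N K :
  matrix_opnorm_le b C -> (forall n, \sum_(0 <= j < n) cabs (a j) ^+ 2 <= A) ->
  \sum_(0 <= k < K) cabs (\sum_(0 <= j < N) a j * b j k) ^+ 2 <= (C ^+ 2 + 1) * A.
Proof.
move=> bC aA; pose u k := \sum_(0 <= j < N) a j * b j k.
pose v k := if (k < K)%N then Num.conj (u k) else 0.
set S := \sum_(0 <= k < K) _.
have SE : S = \sum_(0 <= k < K) cabs (v k) ^+ 2.
  by rewrite /S !big_nat; apply: eq_bigr => k /andP[_ kK]; rewrite /v kK cabs_conj.
have v0 k : (K <= k)%N -> v k = 0 by rewrite /v leqNgt => /negbTE ->.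
have vS n : \sum_(0 <= k < n) cabs (v k) ^+ 2 <= S.
  rewrite SE; apply: (@le_trans _ _ (\sum_(0 <= k < K + n) cabs (v k) ^+ 2)).
    rewrite (@big_cat_nat _ _ _ n 0 (K + n))//= ?leq_addl// lerDl.
    by apply: sumr_ge0 => k _; exact: sqr_ge0.
  rewrite (@big_cat_nat _ _ _ K 0 (K + n))//= ?leq_addr// gerDl big_nat big1// => k /andP[Kk _].
  by rewrite v0// cabs0 expr0n.
have vle := l2normsq_le vS.
have [|bv [bvl bvn]] := bC v; first by apply: le_lt_trans vle _; exact: ltry.
have bvE j : bv j = \sum_(0 <= k < K) b j k * v k.
  apply: (@cvg_unique _ (@norm_hausdorff _ R[i]^o) _ _ _ _ (bvl j)).
  apply: cvg_near_cst; exists K => // n /= Kn.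
  rewrite (@big_cat_nat _ _ _ K 0 n)//= [X in _ + X](_ : _ = 0) ?addr0//.
  by rewrite big_nat big1// => k /andP[Kk _]; rewrite v0// mulr0.
have bvS : \sum_(0 <= j < N) cabs (bv j) ^+ 2 <= C ^+ 2 * S.
  apply: l2normsq_partial; apply: le_trans bvn _; rewrite (EFinM (C ^+ 2) S).
  apply: lee_pmul => //; rewrite ?lee_fin ?sqr_ge0//.
  by apply: nneseries_ge0 => k _ _; rewrite lee_fin sqr_ge0.
have SD : S <= \sum_(0 <= j < N) cabs (a j) * cabs (bv j).
  have -> : S = cabs (\sum_(0 <= j < N) a j * bv j).
    have -> : \sum_(0 <= j < N) a j * bv j = S%:C.
      rewrite /S rmorph_sum/=.
      transitivity (\sum_(0 <= k < K) u k * v k); last first.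
        rewrite !big_nat; apply: eq_bigr => k /andP[_ kK].
        by rewrite cabs_conjM /v kK.
      under eq_bigr do rewrite bvE mulr_sumr.
      rewrite exchange_big; apply: eq_bigr => k _; rewrite /u mulr_suml.
      by apply: eq_bigr => j _; rewrite mulrA.
    by rewrite cabs_real ger0_norm// /S; apply: sumr_ge0 => k _; exact: sqr_ge0.
  apply: le_trans (cabs_sum _ _ _) _.
  by apply: ler_sum => j _; rewrite cabsM.
have D1 : 1 <= C ^+ 2 + 1 by rewrite lerDr sqr_ge0.
have D2 : C ^+ 2 <= C ^+ 2 + 1 by rewrite lerDl.
have S0 : 0 <= S by rewrite /S; apply: sumr_ge0 => k _; exact: sqr_ge0.
have aN := aA N; set D := C ^+ 2 + 1 in D1 D2 *.
(* Young's inequality with weight [D], together with the sum of [|bv j|^2] being at most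
   [C^2 S <= D S]; cancelling leaves [S <= D A]. Taking [D = C^2 + 1] keeps it positive for
   [C = 0]. *)
have h : 2 * D * S <= D ^+ 2 * A + D * S.
  apply: (@le_trans _ _ (\sum_(0 <= j < N) (D ^+ 2 * cabs (a j) ^+ 2 + cabs (bv j) ^+ 2))).
    apply: (@le_trans _ _ (\sum_(0 <= j < N) 2 * D * (cabs (a j) * cabs (bv j)))).
      by rewrite -mulr_sumr ler_wpM2l// mulr_ge0// (le_trans ler01).
    apply: ler_sum => j _; have := sqr_ge0 (D * cabs (a j) - cabs (bv j)); lra.
  rewrite big_split/= -mulr_sumr lerD//; first by rewrite ler_wpM2l// sqr_ge0.
  by apply: le_trans bvS _; rewrite ler_wpM2r.
have Dp : 0 < D by exact: lt_le_trans D1.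
by rewrite -(ler_pM2l Dp); lra.
Qed.

(** The bounds on rows and columns do not depend on the truncation [(N, K)], and the limit is taken
    in the pairing only: the infinite product of [a] with the matrix [b] is never formed. *)
Lemma haagerup_pairing (p : nat -> R) (Psi : R -> R -> R -> R[i]) :
  haagerup (atomic_spectral p) (atomic_spectral p) (atomic_spectral p) Psi ->
  exists S : R, forall M (s : nat -> R[i]), (forall e, cabs (s e) <= 1) ->
    cabs (pairing M s (fun x y => Psi (p x.+1) (p x) (p y))) <= M%:R ^+ 2 * S.
Proof.
move=> [a [b [c [[_ [C1 aC]] [_ [C2 bC]] [_ [C3 cC]] hPsi]]]].
exists (((C2 ^+ 2 + 1) * C1 ^+ 2 + C3 ^+ 2) / 2) => M s s1.
apply: (@pairing_lim _ M s (nat * nat)%type (filter_prod \oo \oo) _ (fun NM x y =>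
    \sum_(0 <= k < NM.2.+1) (\sum_(0 <= j < NM.1.+1) a (p x.+1) j * b (p x) j k) * c (p y) k)).
  move=> x y; have := @atomic_ae3 _ p _ x.+1 x y hPsi.
  apply: cvg_trans; rewrite (_ : (fun NM : nat * nat => _) = (fun NM : nat * nat =>
     \sum_(0 <= j < NM.1.+1) \sum_(0 <= k < NM.2.+1) a (p x.+1) j * b (p x) j k * c (p y) k)) //.
  apply/funext => NM; rewrite exchange_big; apply: eq_bigr => k _.
  by rewrite mulr_suml.
move=> [N K] /=; rewrite mulrA.
apply: (@pairing_tensor_le _ M s (fun x k => \sum_(0 <= j < N.+1) a (p x.+1) j * b (p x) j k)
  (fun y k => c (p y) k)) => //.
  move=> x; apply: matrix_row_bound; first exact: (atomic_ae x bC).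
  by move=> n; apply: l2normsq_partial; exact: (atomic_ae x.+1 aC).
by move=> y; apply: l2normsq_partial; exact: (atomic_ae y cC).
Qed.

End haagerup_bound.

(** * Test sequences carried by the spectrum of a block *)

Section test_function.
Context {R : realType}.
Variables (L : nat) (ix : nat -> nat) (ph : nat -> R[i]).

(** [ph] transported along [ix] and extended by zero; where [ix] is injective, [pick] has a single
    candidate. *)
Definition test (e : nat) : R[i] :=
  if [pick k : 'I_L | ix k == e] is Some k then ph k else 0.

Lemma test_ix k : (forall i j, (i < L)%N -> (j < L)%N -> ix i = ix j -> i = j) ->
  (k < L)%N -> test (ix k) = ph k.
Proof.
move=> ixI kL; rewrite /test; case: pickP => [l /eqP/(ixI _ _ (ltn_ord l) kL) ->//|].
by move=> /(_ (Ordinal kL)); rewrite eqxx.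
Qed.

Lemma test_out e : (forall k, (k < L)%N -> ix k <> e) -> test e = 0.
Proof. by move=> h; rewrite /test; case: pickP => // k /eqP /(h k (ltn_ord k)). Qed.

Hypothesis ph1 : forall k, cabs (ph k) <= 1.

Lemma test_le1 e : cabs (test e) <= 1.
Proof. by rewrite /test; case: pickP => // _; rewrite cabs0. Qed.

(** Each value is at most the number of [k] with [ix k = e], and these numbers add up to at most
    [L]. *)
Lemma test_l1 M : \sum_(0 <= e < M) cabs (test e) <= L%:R.
Proof.
apply: (@le_trans _ _ (\sum_(0 <= e < M) \sum_(k < L) ((ix k == e)%:R : R))).
  apply: ler_sum => e _; rewrite /test; case: pickP => [k ke|_]; last first.
    by rewrite cabs0; apply: sumr_ge0.
  rewrite (bigD1 k)//= ke; apply: le_trans (ph1 _) _.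
  by rewrite lerDl; apply: sumr_ge0.
rewrite exchange_big/= -[leRHS]mulr1 mulr_natl -[X in _ *+ X]card_ord -sumr_const.
apply: ler_sum => k _; have [kM|kM] := ltnP (ix k) M.
  rewrite (bigD1_seq (ix k)) ?mem_index_iota ?iota_uniq//= eqxx big1 ?addr0// => e.
  by rewrite eq_sym => /negbTE ->.
rewrite big_nat big1// => e /andP[_ eM].
by case: eqP => // ke; move: eM; rewrite -ke ltnNge kM.
Qed.

End test_function.

(** * Growth of the pairing along the blocks *)

Section lower_bound.
Context {R : realType}.
Local Notation r := (4 / 5 : R).

(* [freq j k = 2 * idx N j k / 3 ^ (3 N + 3)]: a common denominator for all blocks [j <= N]. *)
Definition idx (N j k : nat) : nat := ((3 * k + 1) * 3 ^ (3 * (N - j)))%N.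

Lemma idx_lt N j k : (j <= N)%N -> (k < 3 ^ j)%N -> (idx N j k < 3 ^ (3 * N + 3))%N.
Proof.
move=> jN kj; rewrite /idx.
have -> : (3 * N + 3 = (3 * j + 3) + 3 * (N - j))%N by lia.
rewrite [X in (_ < X)%N]expnD ltn_pmul2r ?expn_gt0//.
have h : (3 ^ j.+1 <= 3 ^ (3 * j + 3))%N by rewrite leq_exp2l//; lia.
by apply: leq_trans h; rewrite expnS; move: (3 ^ j)%N kj => m; lia.
Qed.

(** As [3 k + 1] is prime to [3], the 3-adic valuation of [idx N j k] is [3 (N - j)], which
    determines [j] and then [k]. *)
Lemma idx_inj N j k n l : (j <= N)%N -> (n <= N)%N -> idx N j k = idx N n l ->
  j = n /\ k = l.
Proof.
have lg m c : logn 3 ((3 * m + 1) * 3 ^ c) = c.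
  rewrite lognM ?expn_gt0 ?addn1// pfactorK// logn_coprime//.
  by rewrite prime_coprime//; lia.
move=> jN nN; rewrite /idx => e.
have e1 : (3 * (N - j) = 3 * (N - n))%N by have := congr1 (logn 3) e; rewrite !lg.
have jn : j = n by lia.
split=> //; move: e; rewrite jn => /eqP; rewrite eqn_pmul2r ?expn_gt0// => /eqP; lia.
Qed.

Definition dcoef (j k : nat) : R[i] := coef j k * (expi (pi + freq j k * pi) - 1).

(** The real part of [expi (pi + f pi) - 1] is [- cos (f pi) - 1], of modulus at least [1] because
    [f <= 1/4] makes the cosine nonnegative. *)
Lemma dcoef_ge j k : (k < 3 ^ j)%N -> r ^+ j * cabs (qc j k : R[i]) <= cabs (dcoef j k).
Proof.
move=> kj; have /andP[f0 f1] := @freq_bound R _ _ kj.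
rewrite !cabsM cabs_real ger0_norm ?r_ge0//.
rewrite ler_peMr ?mulr_ge0 ?cabs_ge0 ?r_ge0//.
apply: le_trans (cabs_Re _); rewrite ReD ReN/= [pi + _]addrC cosDpi.
have p0 := @pi_gt0 R.
have c0 : 0 <= cos (freq j k * (pi : R)).
  apply: ltW; apply: cos_gt0_pihalf.
  have h : freq j k <= (4^-1 : R).
    apply: le_trans f1 _.
    have : (9^-1 : R) ^+ j <= 1 by rewrite exprn_ile1// ?invr_ge0// invf_le1 ?ler1n.
    lra.
  have := mulr_gt0 f0 p0; have := ler_wpM2r (ltW p0) h.
  by move: (freq j k * (pi : R)) (pi : R) p0 => X Y; lra.
rewrite ler0_norm; lra.
Qed.

(** With [M = 3^(3 N + 3)], the phase [(1 + freq) pi s] equals [pi s + 2 pi idx s / M]: all waves of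
    the blocks up to [N] are functions [chi M e] for the same [M]. *)
Lemma wv_chi N j s : (j <= N)%N ->
  wv j (pi * s%:R : R) = \sum_(0 <= k < 3 ^ j) coef j k * chi (3 ^ (3 * N + 3)) (idx N j k) s.
Proof.
move=> jN; rewrite /wv /blk mulr_sumr; apply: eq_bigr => k _.
rewrite mulrCA /chi /root; congr (_ * (_ * expi _)).
have -> : (3 * N + 3 = (3 * j + 3) + 3 * (N - j))%N by lia.
rewrite /freq /lam /idx expnD !natrM !natrX.
have h a : (3 : R) ^+ a != 0 by rewrite expf_neq0.
by field; rewrite !h.
Qed.

Definition dwave (j s : nat) : R[i] := wv j (pi * s.+1%:R) - wv j (pi * s%:R).

Lemma dwave_gdom s : gdom 2 (dwave^~ s).
Proof.
move=> j; rewrite mulr_natl mulr2n; apply: le_trans (cabsD _ _) _; rewrite cabsN.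
have h (t : R) : cabs (wv j t) <= r ^+ j by have := wv_gdom t j; rewrite mul1r.
by apply: lerD; exact: h.
Qed.

Lemma dwave_chi N j s : (j <= N)%N ->
  dwave j s = \sum_(0 <= k < 3 ^ j) dcoef j k * chi (3 ^ (3 * N + 3)) (idx N j k) s.
Proof.
move=> jN; rewrite /dwave !(wv_chi _ jN) -sumrB; apply: eq_bigr => k _.
rewrite -[s.+1]addn1 chiD /dcoef.
have -> : expi (pi + freq j k * pi) = chi (3 ^ (3 * N + 3)) (idx N j k) 1 :> R[i].
  rewrite expiD /chi /root !mulr1; congr (_ * expi _).
  have -> : (3 * N + 3 = (3 * j + 3) + 3 * (N - j))%N by lia.
  rewrite /freq /lam /idx expnD !natrM !natrX.
  have h a : (3 : R) ^+ a != 0 by rewrite expf_neq0.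
  by field; rewrite !h.
by ring.
Qed.

Lemma divdiff1_ffun x y :
  divdiff1 (@ffun R) (pi * x.+1%:R) (pi * x%:R) (pi * y%:R) =
  (pi^-1)%:C * csum (dwave^~ (x + y)%N).
Proof.
have p0 := @pi_gt0 R.
have E : (pi : R) * x.+1%:R - pi * x%:R = pi by rewrite -mulrBr -natrB// subSnn mulr1.
rewrite /divdiff1 -subr_eq0 E gt_eqF// mulrC fmorphV; congr (_ * _).
rewrite /ffun /gfun csumB; [|exact: gdom_csummable (wv_gdom _)..].
by rewrite /= -!mulrDr -!natrD addSn.
Qed.

(** The conjugate sign of [z]; at [z = 0] it is [0], by the convention for the inverse. *)
Definition phase (z : R[i]) : R[i] := Num.conj z * ((cabs z)^-1)%:C.

Lemma phaseK z : z * phase z = (cabs z)%:C.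
Proof.
rewrite /phase mulrA -cabs_conjM -rmorphM/= expr2 -mulrA.
by have [->|z0] := eqVneq (cabs z) 0; rewrite ?mul0r// mulfV// mulr1.
Qed.

Lemma cabs_phase z : cabs (phase z) <= 1.
Proof.
rewrite cabsM cabs_conj cabs_real normfV ger0_norm ?cabs_ge0//.
by have [->|z0] := eqVneq (cabs z) 0; rewrite ?mul0r// mulfV.
Qed.

Lemma pairing_dwave N j (s : nat -> R[i]) : (j <= N)%N ->
  pairing (3 ^ (3 * N + 3)) s (fun x y => dwave j (x + y)) =
  (3 ^ (3 * N + 3))%:R ^+ 2 * \sum_(0 <= k < 3 ^ j) dcoef j k * s (idx N j k).
Proof.
move=> jN; set M := (3 ^ (3 * N + 3))%N.
have -> : (fun x y => dwave j (x + y)) =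
    (fun x y => \sum_(k <- index_iota 0 (3 ^ j)) dcoef j k * chi M (idx N j k) (x + y))
    :> (_ -> _ -> R[i]).
  by apply/funext => x; apply/funext => y; exact: dwave_chi.
rewrite pairing_sum mulr_sumr !big_nat; apply: eq_bigr => k /andP[_ kj].
by rewrite pairingZ pairing_chi; [ring|exact: idx_lt].
Qed.

(** The test sequence lives on the spectrum of block [n], so the other blocks up to [N] pair to
    zero, and its phases align the coefficients of block [n]. The blocks beyond [N] have frequencies
    outside the common denominator and are bounded by their sup norm. *)
Lemma pairing_divdiff N n (M := (3 ^ (3 * N + 3))%N)
    (s := test (3 ^ n) (idx N n) (fun k => phase (dcoef n k))) : (n <= N)%N ->
  M%:R ^+ 2 * (28 / 25) ^+ n <=
  pi * cabs (pairing M s (fun x y =>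
    divdiff1 (@ffun R) (pi * x.+1%:R) (pi * x%:R) (pi * y%:R))) +
  (3 ^ n)%:R * (M%:R ^+ 2 * (10 * r ^+ N)).
Proof.
move=> nN.
have p0 := @pi_gt0 R.
have ph1 k : cabs (phase (dcoef n k)) <= 1 by exact: cabs_phase.
pose Phi (x y : nat) : R[i] := \sum_(j <- index_iota 0 N.+1) dwave j (x + y)%N.
pose T (x y : nat) : R[i] := csum (dwave^~ (x + y)%N) - Phi x y.
have main : pairing M s Phi = (M%:R ^+ 2 * \sum_(0 <= k < 3 ^ n) cabs (dcoef n k))%:C.
  rewrite /Phi pairing_sum (bigD1_seq n) ?mem_index_iota ?iota_uniq//=.
  rewrite [X in _ + X](_ : _ = 0) ?addr0; last first.
    rewrite big_seq_cond big1// => j; rewrite mem_index_iota => /andP[/andP[_ jN] jn].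
    have {}jN : (j <= N)%N := jN.
    rewrite [LHS](pairing_dwave s jN) big1 ?mulr0// => k _; rewrite /s test_out ?mulr0// => l _ e.
    by have [nj _] := idx_inj nN jN e; rewrite nj eqxx in jn.
  rewrite pairing_dwave// rmorphM rmorphXn/= rmorph_nat rmorph_sum/=; congr (_ * _).
  rewrite !big_nat; apply: eq_bigr => k /andP[_ kn].
  rewrite /s test_ix ?phaseK// => i j _ _ e.
  by have [] := idx_inj nN nN e.
have tail : cabs (pairing M s T) <= (3 ^ n)%:R * (M%:R ^+ 2 * (10 * r ^+ N)).
  apply: pairing_sup; [by rewrite mulr_ge0 ?r_ge0|exact: test_l1|].
  move=> x y _ _; rewrite /T /Phi; apply: le_trans (csum_tail N.+1 (dwave_gdom (x + y))) _.
  by have := @r_ge0 R N; rewrite exprS; move: (r ^+ N) => X; lra.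
have split : (pi : R)%:C * pairing M s (fun x y =>
    divdiff1 (@ffun R) (pi * x.+1%:R) (pi * x%:R) (pi * y%:R)) =
    pairing M s Phi + pairing M s T.
  rewrite -pairingD -pairingZ; congr pairing; apply/funext => x; apply/funext => y.
  rewrite divdiff1_ffun mulrA -rmorphM/= mulfV ?gt_eqF// rmorph1 mul1r.
  by rewrite /T addrC subrK.
have lower : (28 / 25) ^+ n <= \sum_(0 <= k < 3 ^ n) cabs (dcoef n k) :> R.
  have -> : (28 / 25) ^+ n = \sum_(0 <= k < 3 ^ n) r ^+ n * cabs (qc n k : R[i]).
    rewrite -mulr_sumr qc_l1 -exprMn; congr (_ ^+ _); lra.
  by apply: ler_sum_nat => k /andP[_ kn]; exact: dcoef_ge.
have := cabsD ((pi : R)%:C * pairing M s (fun x y =>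
    divdiff1 (@ffun R) (pi * x.+1%:R) (pi * x%:R) (pi * y%:R))) (- pairing M s T).
rewrite {1}split addrK main cabsN cabsM !cabs_real (gtr0_norm p0) => h.
apply: (@le_trans _ _ (M%:R ^+ 2 * \sum_(0 <= k < 3 ^ n) cabs (dcoef n k))).
  by rewrite ler_wpM2l// exprn_ge0.
by apply: le_trans (le_trans (ler_norm _) h) _; rewrite lerD2l.
Qed.

Lemma geometric_small (q B : R) : 0 < q < 1 -> 0 <= B ->
  exists N0, forall n, (N0 <= n)%N -> B * q ^+ n < 1.
Proof.
move=> /andP[q0 q1] B0.
have B1 : 0 < (B + 1)^-1 by rewrite invr_gt0 ltr_wpDl.
have /cvgrPdist_lt/(_ _ B1)[N0 _ hN] : q ^+ n @[n --> \oo] --> (0 : R).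
  by apply: cvg_expr; rewrite ger0_norm ?ltW.
exists N0 => n /hN; rewrite sub0r normrN ger0_norm ?exprn_ge0 ?ltW// => h.
have Bp : 0 < B + 1 by rewrite ltr_wpDl.
have h2 : (B + 1) * q ^+ n < 1 by rewrite -ltr_pdivlMl// mulr1.
have h3 : 0 <= q ^+ n by rewrite exprn_ge0 ?ltW.
lra.
Qed.

Lemma divdiff1_not_haagerup (E := atomic_spectral (fun n => pi * n%:R : R)) :
  ~ haagerup E E E (divdiff1 (@ffun R)).
Proof.
move=> /haagerup_pairing[S hS].
have p0 := @pi_gt0 R.
have B (n : nat) : (28 / 25) ^+ n <= pi * S + 1.
  (* [n] is fixed before [N], so that the tail [3^n * 10 r^N] drops below [1] although [3^n] is
     large; the common factor [M^2] then cancels. *)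
  have [||N0 hN] := @geometric_small r (10 * (3 ^ n)%:R); [by apply/andP; split; lra|by []|].
  pose N := maxn N0 n; pose M := (3 ^ (3 * N + 3))%N.
  have nN : (n <= N)%N by rewrite leq_maxr.
  have hr := hN N (leq_maxl _ _).
  have ph1 k : cabs (phase (dcoef n k)) <= 1 by exact: cabs_phase.
  have h1 := pairing_divdiff nN.
  have h2 := hS M _ (test_le1 (3 ^ n) (idx N n) ph1).
  have h3 := ler_wpM2l (ltW p0) h2.
  have M0 : (0 : R) < M%:R ^+ 2 by rewrite exprn_gt0// ltr0n expn_gt0.
  rewrite -(ler_pM2l M0); apply: le_trans h1 _.
  apply: (@le_trans _ _ (pi * (M%:R ^+ 2 * S) + M%:R ^+ 2 * 1)); last by rewrite mulrDr; lra.
  rewrite lerD//; have := ler_wpM2l (ltW M0) (ltW hr); lra.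
have B0 : 0 <= pi * S + 1 by apply: le_trans (B 0%N); rewrite expr0.
(* [25/28] is the reciprocal of the growth rate: a bound on all powers of [28/25], multiplied by a
   large power of it, would be less than [1]. *)
have [|//|n /(_ n (leqnn n))] := @geometric_small (25 / 28) (pi * S + 1).
  by apply/andP; split; lra.
rewrite ltNge => /negP; apply.
have q0 : 0 <= (25 / 28 : R) ^+ n by rewrite exprn_ge0.
apply: le_trans (ler_wpM2r q0 (B n)).
by rewrite -exprMn (_ : 28 / 25 * (25 / 28) = 1) ?expr1n//; field.
Qed.

End lower_bound.

Theorem theorem9p2 (R : realType) (w : R -> R) (hw : cutoff w) :
  exists f : R * R -> R[i], besov_fun w f /\
    exists (H : hilbertSpace R) (E1 E2 E3 : spectralMeasure H),
      ~ haagerup E1 E2 E3 (divdiff1 f).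
Proof.
exists (@ffun R); split; first exact: ffun_besov.
pose E := atomic_spectral (fun n => pi * n%:R : R).
by exists (l2_hilbert R), E, E, E; exact: divdiff1_not_haagerup.
Qed.
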